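(* Every genus $3$ hyperelliptic curve with full automorphism group isomorphic to $\mathbb Z_2^3$ has equation $$Y^2=\mathfrak s_2^2\,X^8+\mathfrak s_2^2\,X^6+\frac{\mathfrak s_3}{2}\,X^4+\mathfrak s_2\,X^2+1$$ for $\mathfrak s_3,\mathfrak s_2\neq 0,4$. Moreover, $k(\mathcal S(\mathbb Z_2^3))=k(\mathfrak s_2,\mathfrak s_3)$, and therefore the field of moduli is a field of definition.
   Context: $k$ is an algebraically closed field of characteristic zero. $\mathcal S(G)$ denotes the locus, in the moduli space $\mathcal H_3$ of genus $3$ hyperelliptic curves over $k$, of the curves $\mathcal X$ with $G\hookrightarrow\mathrm{Aut}(\mathcal X)$, and $k(\mathcal S(G))$ its function field. For a curve $Y^2=X^8+aX^6+bX^4+cX^2+1$ the dihedral invariants are $\mathfrak s_2=ac$, $\mathfrak s_3=(a^2+c^2)b$, $\mathfrak s_4=a^4+c^4$; curves with automorphism group $\mathbb Z_2^3$ are written $Y^2=X^8+uX^6+(v+2)X^4+uX^2+1$, so that $\mathfrak s_2=u^2$, $\mathfrak s_3=2u^2(v+2)$, $\mathfrak s_4=2u^4=2\mathfrak s_2^2$. The field of moduli of a curve is the field of rationality of its moduli point (generated by its absolute invariants); a field of definition is a field over which some curve isomorphic to it has an equation.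
   Formalization: The equality k(S(Z_2^3))=k(s2,s3) is false literally (s2 is not a function on S: u=1,v=1 and u=52/7 give isomorphic curves); proved instead: k(S) restricts into k(s2,s3) and is k-isomorphic to it; the last claim is proved directly, not deduced from this. *)

(* Defs.v *)
From HB Require Import structures.
From mathcomp Require Import all_boot all_order all_fingroup all_algebra all_field.
From mathcomp Require Import mpoly.

Set Implicit Arguments.
Unset Strict Implicit.
Unset Printing Implicit Defensive.

Import GRing.Theory.
Local Open Scope ring_scope.

(* The closure conditions are those of [divring_closed], for Prop-valued sets;
   subfields contain 1, hence the prime field. *)
Definition is_subfield (K : fieldType) (E : K -> Prop) : Prop :=
  [/\ E 1,
      forall x y, E x -> E y -> E (x - y)
    & forall x y, E x -> E y -> E (x / y)].

Definition subfield_gen (K : fieldType) (A : K -> Prop) (z : K) : Prop :=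
  forall E : K -> Prop, is_subfield E -> (forall x, A x -> E x) -> E z.

(* Curves are smooth projective curves over the algebraically closed field k,
   given by their function fields: [iota : k -> L] is the function field of the
   curve Y^2 = f(X) when L = k(x, y) with x transcendental and y^2 = f(x).
   Isomorphism of curves is k-isomorphism of function fields, so the equations
   of the curves isomorphic to a given one are the equations of its field L.
   The genus is 3 exactly when f, assumed separable, has degree 7 or 8. *)
Definition genus3_equation (k L : fieldType) (iota : {rmorphism k -> L})
    (f : {poly k}) : Prop :=
  [/\ separable_poly f,
      (size f == 8%N) || (size f == 9%N)
    & exists x y : L,
        [/\ ~ algebraicOver iota x,
            y ^+ 2 = (map_poly iota f).[x]
          & forall z : L, subfield_gen
              (fun w => w = x \/ w = y \/ exists c, w = iota c) z]].

Definition genus3_hyperelliptic (k L : fieldType) (iota : {rmorphism k -> L}) :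
    Prop :=
  exists f : {poly k}, genus3_equation iota f.

(* Automorphisms of the curve, as k-automorphisms of its function field. *)
Definition is_automorphism (k L : fieldType) (iota : {rmorphism k -> L})
    (s : {rmorphism L -> L}) : Prop :=
  bijective s /\ forall c, s (iota c) = iota c.

Definition is_group_embedding (k L : fieldType) (iota : {rmorphism k -> L})
    (gT : finGroupType) (e : gT -> {rmorphism L -> L}) : Prop :=
  [/\ forall g, is_automorphism iota (e g),
      forall g h, e (g * h)%g =1 e g \o e h
    & forall g h, e g =1 e h -> g = h].

Definition Aut_contains (k L : fieldType) (iota : {rmorphism k -> L})
    (gT : finGroupType) : Prop :=
  exists e : gT -> {rmorphism L -> L}, is_group_embedding iota e.

Definition Aut_isomorphic (k L : fieldType) (iota : {rmorphism k -> L})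
    (gT : finGroupType) : Prop :=
  exists e : gT -> {rmorphism L -> L},
    is_group_embedding iota e /\
    forall s, is_automorphism iota s -> exists g, s =1 e g.

Definition Z2_cubed : finGroupType := ('Z_2 * 'Z_2 * 'Z_2)%type.

(* Binary octics \sum_i f_i X^i Z^(8-i) are dehomogenized to polynomials f of
   degree at most 8; this is f(aX + bZ, cX + dZ). *)
Definition octic_subst (k : fieldType) (a b c d : k) (f : {poly k}) : {poly k} :=
  \sum_(i < 9) f`_i *: ((a *: 'X + b%:P) ^+ i * (c *: 'X + d%:P) ^+ (8 - i)).

(* Value of I, a polynomial in the nine coefficients of an octic, at an octic f
   with coefficients in an extension j : k -> K. *)
Definition octic_eval (k K : fieldType) (j : k -> K) (I : {mpoly k[9]})
    (f : {poly K}) : K :=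
  mmap j (fun i : 'I_9 => f`_i) I.

Definition octic_invariant (k : fieldType) (I : {mpoly k[9]}) : Prop :=
  forall (a b c d : k) (f : {poly k}), a * d - b * c = 1 ->
    octic_eval idfun I (octic_subst a b c d f) = octic_eval idfun I f.

(* I / J is an absolute invariant: a quotient of two SL_2-invariants that are
   homogeneous of the same degree. The moduli space H_3 is the locus of nonzero
   discriminant in the Proj of the ring of SL_2-invariants of octics. *)
Definition absolute_invariant (k : fieldType) (I J : {mpoly k[9]}) : Prop :=
  octic_invariant I /\ octic_invariant J /\
  exists d : nat, I \is d.-homog /\ J \is d.-homog.

Definition over_Z (k : fieldType) (I : {mpoly k[9]}) : Prop :=
  exists I0 : {mpoly int[9]}, I = map_mpoly intr I0.

(* The residue field of the moduli point of Y^2 = f(X), H_3 being defined over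
   the prime field. *)
Definition field_of_moduli (k : fieldType) (f : {poly k}) : k -> Prop :=
  subfield_gen (fun z => exists I J : {mpoly k[9]},
    [/\ absolute_invariant I J, over_Z I /\ over_Z J,
        octic_eval idfun J f != 0
      & z = octic_eval idfun I f / octic_eval idfun J f]).

Definition field_of_definition (k L : fieldType) (iota : {rmorphism k -> L})
    (E : k -> Prop) : Prop :=
  exists g : {poly k}, (forall i, E g`_i) /\ genus3_equation iota g.

(* The locus S(G), as the set of equations of its curves. *)
Definition locus (k : fieldType) (gT : finGroupType) (f : {poly k}) : Prop :=
  exists (L : fieldType) (iota : {rmorphism k -> L}),
    genus3_equation iota f /\ Aut_contains iota gT.

(* Absolute invariants that are defined as rational functions on the locus S. *)
Definition regular_on (k : fieldType) (S : {poly k} -> Prop)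
    (I J : {mpoly k[9]}) : Prop :=
  absolute_invariant I J /\ exists f, S f /\ octic_eval idfun J f != 0.

(* The subfield E of the extension j : k -> K is k-isomorphic to the function
   field k(S) of the irreducible locus S in H_3. The elements of k(S) are the
   restrictions to S of the fractions I / J, two of them being equal when they
   agree on S; phi I J is the image of I / J in E. The first clause is
   irreducibility, i.e. the restrictions to S form an integral domain. *)
Definition function_field_iso (k : fieldType) (S : {poly k} -> Prop)
    (K : fieldType) (j : k -> K) (E : K -> Prop) : Prop :=
  exists phi : {mpoly k[9]} -> {mpoly k[9]} -> K,
    (forall I J I' J', regular_on S I J -> regular_on S I' J' ->
      [/\ exists f, S f /\ octic_eval idfun (J * J') f != 0,
          phi I J = phi I' J' <->
            (forall f, S f ->
               octic_eval idfun (I * J') f = octic_eval idfun (I' * J) f),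
          phi I J + phi I' J' = phi (I * J' + I' * J) (J * J')
        & phi I J * phi I' J' = phi (I * I') (J * J')]) /\
    (forall c J, regular_on S J J -> phi (c *: J) J = j c) /\
    (forall z, E z <-> exists I J, regular_on S I J /\ z = phi I J).

Definition dihedral_s2 (R : comNzRingType) (a b c : R) : R := a * c.
Definition dihedral_s3 (R : comNzRingType) (a b c : R) : R :=
  (a ^+ 2 + c ^+ 2) * b.

Definition normal_form (R : comNzRingType) (u v : R) : {poly R} :=
  'X^8 + u *: 'X^6 + (v + 2) *: 'X^4 + u *: 'X^2 + 1.

Definition dihedral_equation (k : fieldType) (s2 s3 : k) : {poly k} :=
  s2 ^+ 2 *: 'X^8 + s2 ^+ 2 *: 'X^6 + (s3 / 2) *: 'X^4 + s2 *: 'X^2 + 1.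

(* The field k(u, v), with u and v independent indeterminates. *)
Definition ratfun2 (k : fieldType) : fieldType := {fraction {mpoly k[2]}}.
Definition ratfun2C (k : fieldType) (c : k) : ratfun2 k := tofrac c%:MP.
Definition gen_u (k : fieldType) : ratfun2 k := tofrac 'X_(inord 0).
Definition gen_v (k : fieldType) : ratfun2 k := tofrac 'X_(inord 1).

(* The dihedral invariants of the generic curve
   Y^2 = X^8 + u X^6 + (v + 2) X^4 + u X^2 + 1, and the subfield k(s2, s3).
   The normal form singles out one of the three involutions of the reduced
   automorphism group, so s2 and s3 are functions on a triple cover of the
   locus: pulling back along (u, v) embeds the function field of the locus in
   k(s2, s3) with index 3. *)
Definition generic_s2 (k : fieldType) : ratfun2 k :=
  dihedral_s2 (gen_u k) (gen_v k + 2) (gen_u k).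
Definition generic_s3 (k : fieldType) : ratfun2 k :=
  dihedral_s3 (gen_u k) (gen_v k + 2) (gen_u k).
Definition k_s2_s3 (k : fieldType) : ratfun2 k -> Prop :=
  subfield_gen (fun w => w = generic_s2 k \/ w = generic_s3 k \/
                         exists c, w = ratfun2C c).

(* Main.v *)
(* The reduced action of Z_2^3 on the x-line is that of a Klein four-group; in a
   coordinate where it is generated by X |-> -X and X |-> 1/X the octic becomes
   [slice a b c], and substitutions normalizing the four-group permute a, b, c.
   So the curve is determined by the ratios of the elementary symmetric functions
   e1, e2, e3 of a, b, c. When the full group is Z_2^3, a, b, c are distinct, and
   one of their cyclic rearrangements gives the dihedral equation with the required
   inequalities.

   A twist by square roots of a(b - c), b(a - c), c(a - b) turns [slice a b c] into
   an octic with coefficients in Z[e1, e2, e3]. Its specialization e1 = 1, e2 = u^2,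
   e3 = v dominates the locus, so evaluation there embeds the function field of the
   locus in k(u^2, v) = k(s2, s3). The embedding is onto, and the field of moduli
   contains the coefficients of the twisted octic up to scaling, because e2/e1^2 and
   e3/e1^3 are absolute invariants: they are computed from the traces of powers of
   the transvectant A : q |-> (f, q)_4 on quartics and from the pairings of
   (f, f)_6 with A^n (f, f)_6. Curves with e1 = 0 or 15 e1^2 + 4 e2 = 0, where
   these quotients degenerate, are treated separately with traces alone. *)
Require Import Defs.
From HB Require Import structures.
From mathcomp Require Import all_boot all_order all_fingroup all_algebra all_field.
From mathcomp Require Import mpoly.
From mathcomp Require Import ring zify.
From Stdlib Require Import Classical.

Set Implicit Arguments.
Unset Strict Implicit.
Unset Printing Implicit Defensive.

Import GRing.Theory.
Local Open Scope ring_scope.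

(** * Substitutions in binary octics *)

(** Curves are bare function fields, so uniqueness of the hyperelliptic coordinate is not taken from
    divisors. It comes from comparing degrees in the primitive equation between two coordinates;
    automorphisms thereby become substitutions in octics. The parameters of the normal form depend
    on a chosen involution, and restriction to it embeds the function field of the locus with index
    3. The isomorphism with the whole of k(s2, s3) therefore uses other coordinates: [gen_u ^+ 2]
    and [gen_v] then stand for e2 and e3 at e1 = 1, and only the abstract field is shared with the
    normal form. Octics have no invariant of degree 1, while e1 is linear in the coefficients. It is
    recovered as a quotient of invariants of degrees 11 and 10: it is, up to a constant, the trace
    of A on the plane of quartics fixed by the four-group, and the denominator is the Gram
    determinant of (f, f)_6 and its image under A. The zeros of this determinant are the origin of
    the special case 15 e1^2 + 4 e2 = 0. *)

Lemma natS_neq0 (k : fieldType) (char0 : [pchar k] =i pred0) n : n.+1%:R != 0 :> k.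
Proof. by move/pcharf0P: char0 => ->. Qed.

Lemma eq_of_multiple (R : pzRingType) (c x y l r : R) : l = r -> x - y = c * (l - r) -> x = y.
Proof. by move=> ->; rewrite subrr mulr0 => /eqP; rewrite subr_eq0 => /eqP. Qed.

Section ClosedField.
Context (k : closedFieldType).

(** For nonzero [p] the polynomial [p * 'X + 1] is not constant, and at a root of it [p] cannot
    vanish. *)
Lemma poly0_of_vanishing (p : {poly k}) : (forall x, p.[x] = 0) -> p = 0.
Proof.
move=> p0; apply/eqP/negPn/negP => pn0.
have /closed_rootP[x] : size (p * 'X + 1) != 1%N.
  have pX : p * 'X != 0 by rewrite mulf_neq0 ?polyX_eq0.
  rewrite size_polyDl ?size_mulX ?size_poly1 //.
    by rewrite eqSS size_poly_eq0.
  by rewrite ltnS size_poly_gt0.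
by rewrite rootE !hornerE p0 mul0r add0r oner_eq0.
Qed.

(** Substitutions in octics are compared by their values away from the pole of the Moebius map, with
    [r] its denominator. *)
Lemma poly_eq_off (r p q : {poly k}) : r != 0 ->
  (forall x, r.[x] != 0 -> p.[x] = q.[x]) -> p = q.
Proof.
move=> rn0 pq; apply/eqP; rewrite -subr_eq0.
have : (p - q) * r = 0.
  apply: poly0_of_vanishing => x; rewrite hornerM hornerD hornerN.
  case: (eqVneq r.[x] 0) => [->|/pq ->]; first by rewrite mulr0.
  by rewrite subrr mul0r.
by move/eqP; rewrite mulf_eq0 (negPf rn0) orbF.
Qed.

Lemma sqrt_exists (z : k) : exists s, s ^+ 2 = z.
Proof.
have [s] := @solve_monicpoly k 2 (fun i => if i == 0%N then z else 0) isT.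
by rewrite !big_ord_recl big_ord0 /= expr0 mulr1 mul0r !addr0 => sz; exists s.
Qed.

Lemma double_root_of_common_root (f : {poly k}) x :
  root f x -> root f^`() x -> exists h, f = ('X - x%:P) ^+ 2 * h.
Proof.
move=> /factor_theorem[g ->]; rewrite derivM derivXsubC mulr1 rootE !hornerE.
rewrite subrr mulr0 add0r => /factor_theorem[h ->].
by exists h; ring.
Qed.

End ClosedField.

(** The degree is a parameter because the cofactor of a squared linear form in an octic has to be
    transformed as a sextic. *)
Definition moebius_sub (k : fieldType) (n : nat) (a b c d : k) (f : {poly k}) : {poly k} :=
  \sum_(i < n.+1) f`_i *: ((a *: 'X + b%:P) ^+ i * (c *: 'X + d%:P) ^+ (n - i)).

Lemma horner_moebius_sub (k : fieldType) n (a b c d : k) (f : {poly k}) x :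
  (size f <= n.+1)%N -> c * x + d != 0 ->
  (moebius_sub n a b c d f).[x] = (c * x + d) ^+ n * f.[(a * x + b) / (c * x + d)].
Proof.
move=> sf q0; rewrite (horner_coef_wide _ sf) mulr_sumr /moebius_sub horner_sum.
apply: eq_bigr => i _; rewrite !hornerE expr_div_n.
have -> : (c * x + d) ^+ n = (c * x + d) ^+ (n - i) * (c * x + d) ^+ i.
  by rewrite -exprD subnK // -ltnS.
have : (c * x + d) ^+ i != 0 by rewrite expf_eq0 (negPf q0) andbF.
move: (_ ^+ i) (_ ^+ i) (_ ^+ (n - i)) => P D Q P0 /=; by field.
Qed.

Lemma size_moebius_sub (k : fieldType) n (a b c d : k) (f : {poly k}) :
  (size (moebius_sub n a b c d f) <= n.+1)%N.
Proof.
have sl (s t : k) : (size (s *: 'X + t%:P)%R <= 2)%N.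
  by rewrite -mul_polyC size_MXaddC; case: ifP => // _; rewrite ltnS size_polyC; case: eqP.
have se (s t : k) m : (size ((s *: 'X + t%:P) ^+ m)%R <= m.+1)%N.
  apply: leq_trans (size_poly_exp_leq _ _) _; rewrite ltnS -[leqRHS]mul1n leq_mul2r.
  by have := sl s t; case: size => [|[|[]]] //=; rewrite orbT.
apply: leq_trans (size_sum _ _ _) _; apply/bigmax_leqP => i _.
apply: leq_trans (size_scale_leq _ _) _; apply: leq_trans (size_polyMleq _ _) _.
have := se a b i; have := se c d (n - i)%N; have := ltn_ord i; lia.
Qed.

Section Octics.
Context (k : closedFieldType).

Lemma linear_neq0 (c d : k) : (c != 0) || (d != 0) -> c *: 'X + d%:P != 0.
Proof.
move=> cd; apply/eqP => e0.
have := congr1 (fun p : {poly k} => (p`_0, p`_1)) e0.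
rewrite !coefD !coefZ !coefX !coefC /= mulr0 mulr1 add0r addr0 => -[d0 c0].
by move: cd; rewrite c0 d0 eqxx.
Qed.

Lemma horner_linear (c d x : k) : (c *: 'X + d%:P).[x] = c * x + d.
Proof. by rewrite !hornerE. Qed.

Lemma det_row2 (a b c d : k) : a * d - b * c != 0 -> (c != 0) || (d != 0).
Proof.
apply: contraR; rewrite negb_or !negbK => /andP[/eqP-> /eqP->].
by rewrite !mulr0 subrr.
Qed.

Lemma moebius_sub_comp n (a b c d a' b' c' d' : k) (f : {poly k}) :
  (size f <= n.+1)%N -> a * d - b * c != 0 -> a' * d' - b' * c' != 0 ->
  moebius_sub n a b c d (moebius_sub n a' b' c' d' f) =
  moebius_sub n (a' * a + b' * c) (a' * b + b' * d) (c' * a + d' * c) (c' * b + d' * d) f.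
Proof.
move=> sf dM dN.
have dNM : (a' * a + b' * c) * (c' * b + d' * d) - (a' * b + b' * d) * (c' * a + d' * c) != 0.
  suff -> : (a' * a + b' * c) * (c' * b + d' * d) - (a' * b + b' * d) * (c' * a + d' * c)
    = (a * d - b * c) * (a' * d' - b' * c') by rewrite mulf_neq0.
  by ring.
apply: (@poly_eq_off _ ((c *: 'X + d%:P) *
  ((c' * a + d' * c) *: 'X + (c' * b + d' * d)%:P))).
  by rewrite mulf_neq0 ?linear_neq0 ?(det_row2 dM) ?(det_row2 dNM).
move=> x; rewrite hornerM !horner_linear mulf_eq0 negb_or => /andP[q0 q1].
rewrite !horner_moebius_sub ?size_moebius_sub //; last first.
  move: q1; apply: contraNneq => e; move/(congr1 (fun z => z * (c * x + d))): e.
  rewrite mul0r => e; rewrite -e; apply/eqP; by field.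
rewrite mulrA -exprMn; congr (_ ^+ _ * _.[_]); first by field.
by field; rewrite q1 q0.
Qed.

Lemma moebius_sub_scalar n (a : k) (f : {poly k}) :
  (size f <= n.+1)%N -> moebius_sub n a 0 0 a f = a ^+ n *: f.
Proof.
move=> sf; rewrite /moebius_sub {2}(_ : f = \poly_(i < n.+1) f`_i).
  rewrite poly_def scaler_sumr; apply: eq_bigr => i _.
  rewrite scale0r add0r addr0 exprZn -polyC_exp mulrC mul_polyC !scalerA.
  by congr (_ *: _); rewrite [in RHS]mulrC -mulrA -exprD subnK // -ltnS.
apply/polyP => i; rewrite coef_poly; case: ltnP => // le.
by rewrite nth_default // (leq_trans sf).
Qed.

Lemma moebius_subZ n (a b c d e : k) (f : {poly k}) :
  moebius_sub n a b c d (e *: f) = e *: moebius_sub n a b c d f.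
Proof. by rewrite /moebius_sub scaler_sumr; apply: eq_bigr => i _; rewrite coefZ scalerA. Qed.

(** A double zero of the binary octic, the point at infinity included: for [q = 0] the condition
    says that [f] has degree at most 6. In this form nonsingularity is visibly stable under
    substitutions, which the degree of [f] is not. *)
Definition has_double_factor (f : {poly k}) :=
  exists (p q : k) (h : {poly k}), [/\ (p != 0) || (q != 0), (size h <= 7)%N & f = (q *: 'X + p%:P) ^+ 2 * h].

Lemma double_factor_sub (a b c d : k) (f : {poly k}) : a * d - b * c != 0 ->
  has_double_factor f -> has_double_factor (octic_subst a b c d f).
Proof.
move=> det [p [q [h [pq sh ->]]]].
exists (q * b + p * d), (q * a + p * c), (moebius_sub 6 a b c d h); split.
- move: pq; apply: contraLR; rewrite !negb_or !negbK => /andP[/eqP e1 /eqP e2].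
  have: p * (a * d - b * c) = 0.
    by transitivity (a * (q * b + p * d) - b * (q * a + p * c)); [ring | rewrite e1 e2; ring].
  have: q * (a * d - b * c) = 0.
    by transitivity (d * (q * a + p * c) - c * (q * b + p * d)); [ring | rewrite e1 e2; ring].
  by move=> /eqP + /eqP; rewrite !mulf_eq0 (negPf det) !orbF => -> ->.
- exact: size_moebius_sub.
have s9 : (size ((q *: 'X + p%:P) ^+ 2 * h)%R <= 9)%N.
  have sl : (size (q *: 'X + p%:P)%R <= 2)%N.
    by rewrite -mul_polyC size_MXaddC; case: ifP => // _; rewrite ltnS size_polyC; case: eqP.
  rewrite expr2; apply: leq_trans (size_polyMleq _ _) _.
  have := size_polyMleq (q *: 'X + p%:P) (q *: 'X + p%:P); move: sl sh.
  move: (size _) (size _) (size _) => i j l; lia.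
apply: (@poly_eq_off _ (c *: 'X + d%:P)); first by rewrite linear_neq0 ?(det_row2 det).
move=> x; rewrite horner_linear => q0.
rewrite -[octic_subst _ _ _ _ _]/(moebius_sub 8 a b c d _) horner_moebius_sub //.
rewrite !expr2 !hornerM (horner_moebius_sub a b sh q0) !horner_linear.
by move: (h.[_]) => w; field.
Qed.

Definition good_octic (f : {poly k}) := (size f <= 9)%N /\ ~ has_double_factor f.

Lemma good_octicP (f : {poly k}) :
  good_octic f <-> separable_poly f /\ (size f == 8%N) || (size f == 9%N).
Proof.
split=> [[s9 nd]|[sep sz]].
  have s8 : (8 <= size f)%N.
    rewrite leqNgt; apply/negP => lt; apply: nd; exists 1, 0, f.
    by rewrite oner_neq0 scale0r add0r expr1n mul1r; split.
  split; last by move: s8 s9; case: (size f) => [|[|[|[|[|[|[|[|[|[]]]]]]]]]].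
  rewrite separable_poly.unlock; apply/Pdiv.ClosedField.coprimepP => x rx; apply/negP => /= dx.
  have [h fh] := double_root_of_common_root rx dx.
  apply: nd; exists (- x), 1, h; rewrite oner_neq0 orbT scale1r polyCN; split => //.
  have hn0 : h != 0.
    by apply: contraTneq s8 => h0; rewrite fh h0 mulr0 size_poly0.
  by move: s9; rewrite fh size_monicM ?monic_exp ?monicXsubC // size_exp_XsubC.
have s8 : (8 <= size f)%N by case/orP: sz => /eqP->.
split; first by case/orP: sz => /eqP->.
move=> [p [q [h [pq sh fE]]]].
case: (eqVneq q 0) => [q0|q0].
  move: s8; rewrite fE q0 scale0r add0r -polyC_exp mul_polyC leqNgt.
  by rewrite ltnS (leq_trans (size_scale_leq _ _) sh).
have sl : size (q *: 'X + p%:P) != 1%N.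
  by rewrite -mul_polyC size_MXaddC polyC_eq0 (negPf q0) /= size_polyC q0.
by have := separable_nosquare sep (isT : (1 < 2)%N) sl; rewrite fE dvdp_mulr.
Qed.

(** The adjugate substitution takes [g] back to a multiple of [f], so a double factor of [g] would
    give one of [f]. *)
Lemma good_octic_sub (a b c d e : k) (f g : {poly k}) : a * d - b * c != 0 ->
  e != 0 -> octic_subst a b c d f = e *: g -> good_octic f -> good_octic g.
Proof.
move=> det e0 fg [s9 nd]; have gE : g = e^-1 *: octic_subst a b c d f.
  by rewrite fg scalerA mulVf ?scale1r.
split; first by rewrite gE (leq_trans (size_scale_leq _ _)) ?(size_moebius_sub 8).
move=> dg; apply: nd.
have det' : d * a - (- b) * (- c) != 0 by rewrite mulrNN [d * a]mulrC.
have [p [q [h [pq sh gd]]]] := double_factor_sub det' dg.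
have : octic_subst d (- b) (- c) a (octic_subst a b c d f) = (a * d - b * c) ^+ 8 *: f.
  rewrite -(moebius_sub_scalar _ s9).
  rewrite -[LHS]/(moebius_sub 8 _ _ _ _ (moebius_sub 8 _ _ _ _ _)) moebius_sub_comp //.
  by congr (moebius_sub 8 _ _ _ _ _); ring.
rewrite fg -[octic_subst _ _ _ _ _]/(moebius_sub 8 d (- b) (- c) a (e *: g)) moebius_subZ.
rewrite -[moebius_sub _ _ _ _ _ _]/(octic_subst d (- b) (- c) a g) gd => fE.
exists p, q, (((a * d - b * c) ^+ 8)^-1 *: (e *: h)); split=> //.
  by apply: leq_trans (size_scale_leq _ _) _; apply: leq_trans (size_scale_leq _ _) _.
rewrite -[f in LHS]scale1r -(mulVf (_ : (a * d - b * c) ^+ 8 != 0)); last by rewrite expf_neq0.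
by rewrite -scalerA -fE -!scalerAr.
Qed.

End Octics.

(** * Presentations of the function field *)

Section SquareFactor.
Context (k : closedFieldType).

Lemma good_octic_neq0 (f : {poly k}) : good_octic f -> f != 0.
Proof. by case/good_octicP => /separable_poly_neq0. Qed.

Lemma good_octic_size (f : {poly k}) : good_octic f -> (7 < size f)%N.
Proof. by case/good_octicP => _ /orP[]/eqP->. Qed.

(** With [p / c] in lowest terms [p1 / c1], the square of [c1] divides [f]; as [f] is squarefree,
    [c1] is a constant. *)
Lemma square_factor (f p c d : {poly k}) : good_octic f -> c != 0 ->
  c ^+ 2 * d = p ^+ 2 * f -> exists s, d = s ^+ 2 * f /\ p = s * c.
Proof.
move=> gf c0 e.
have [p1 [c1 [g [pE cE cop]]]] :
    exists p1 c1 g, [/\ p = p1 * g, c = c1 * g & coprimep c1 p1].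
  exists (p %/ gcdp p c), (c %/ gcdp p c), (gcdp p c).
  rewrite !divpK ?dvdp_gcdl ?dvdp_gcdr //; split => //.
  by rewrite coprimep_sym coprimep_div_gcd // c0 orbT.
have g0 : g != 0 by apply: contraNneq c0 => g0; rewrite cE g0 mulr0.
have c1n0 : c1 != 0 by apply: contraNneq c0 => c10; rewrite cE c10 mul0r.
have {}e : c1 ^+ 2 * d = p1 ^+ 2 * f.
  have : g ^+ 2 != 0 by rewrite expf_neq0.
  by move/mulfI; apply; move: e; rewrite pE cE !exprMn => e; ring: e.
have c1f : c1 ^+ 2 %| f.
  have cop2 : coprimep (c1 ^+ 2) (p1 ^+ 2) by rewrite coprimep_expl ?coprimep_expr.
  by rewrite -(Gauss_dvdpr _ cop2) -e dvdp_mulr.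
have [sep _] := (good_octicP f).1 gf.
have /size_poly1P[u u0 c1E] : size c1 == 1%N.
  apply: contraT => s1; move: c1f.
  by rewrite (separable_nosquare sep (isT : (1 < 2)%N) s1).
exists (u^-1 *: p1); split.
  apply: (mulfI (expf_neq0 2 c1n0)); rewrite e c1E -!mul_polyC.
  have : u%:P * (u^-1)%:P = 1 :> {poly k} by rewrite -polyCM mulfV.
  move: (u%:P) (u^-1)%:P => U V UV.
  by transitivity ((U * V) ^+ 2 * (p1 ^+ 2 * f)); [rewrite UV | ]; ring.
rewrite pE cE c1E -mul_polyC.
have : u%:P * (u^-1)%:P = 1 :> {poly k} by rewrite -polyCM mulfV.
move: (u%:P) (u^-1)%:P => U V UV.
by transitivity ((U * V) * (p1 * g)); [rewrite UV | ]; ring.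
Qed.

Lemma good_octic_not_square (f p q : {poly k}) : good_octic f ->
  p ^+ 2 = q ^+ 2 * f -> p = 0 /\ q = 0.
Proof.
move=> gf e; have f0 := good_octic_neq0 gf.
case: (eqVneq p 0) e => [->|p0] e.
  split=> //; apply/eqP; move/eqP: e.
  by rewrite expr0n /= eq_sym mulf_eq0 expf_eq0 /= (negPf f0) orbF.
have [s [s1 _]] : exists s, 1 = s ^+ 2 * f /\ q = s * p.
  by apply: square_factor => //; rewrite mulr1.
have s0 : s != 0 by apply: contraTneq (oner_neq0 {poly k}) => s0; rewrite s1 s0 expr0n mul0r eqxx.
have := congr1 (fun r : {poly k} => size r) s1; have := good_octic_size gf.
rewrite size_poly1 size_mul ?expf_neq0 //.
have : (0 < size (s ^+ 2)%R)%N by rewrite size_poly_gt0 expf_neq0.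
by move: (size _) (size _) => i j; lia.
Qed.

End SquareFactor.

Section Presentations.
Context (k : closedFieldType) (L : fieldType) (iota : {rmorphism k -> L}).

Definition peval (x : L) : {poly k} -> L := horner_eval x \o map_poly iota.
HB.instance Definition _ (x : L) :=
  GRing.RMorphism.copy (peval x) (horner_eval x \o map_poly iota).

Lemma pevalE x p : peval x p = (map_poly iota p).[x]. Proof. by []. Qed.
Lemma pevalX x : peval x 'X = x. Proof. by rewrite pevalE map_polyX hornerX. Qed.
Lemma pevalC x c : peval x c%:P = iota c. Proof. by rewrite pevalE map_polyC hornerC. Qed.
Lemma pevalZ x c p : peval x (c *: p) = iota c * peval x p.
Proof. by rewrite -mul_polyC rmorphM /= pevalC. Qed.

Lemma rmorph_peval (s : {rmorphism L -> L}) x p : (forall c, s (iota c) = iota c) ->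
  s (peval x p) = peval (s x) p.
Proof.
move=> sc; rewrite !pevalE -horner_map -map_poly_comp; congr (_.[_]).
by apply: eq_map_poly => c /=.
Qed.

Definition presentation (x y : L) (f : {poly k}) :=
  [/\ good_octic f, ~ algebraicOver iota x, y ^+ 2 = peval x f
    & forall z, subfield_gen (fun w => w = x \/ w = y \/ exists c, w = iota c) z].

Lemma genus3_equationP f : genus3_equation iota f <-> exists x y, presentation x y f.
Proof.
split=> [[sep sz [x [y [tr e gen]]]]|[x [y [gf tr e gen]]]].
  by exists x, y; split=> //; apply/good_octicP.
by have [sep sz] := (good_octicP f).1 gf; split=> //; exists x, y.
Qed.

Lemma peval_eq0 x p : ~ algebraicOver iota x -> (peval x p == 0) = (p == 0).
Proof.
move=> tr; apply/eqP/eqP => [p0|->]; last by rewrite rmorph0.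
by apply/eqP/negPn/negP => pn0; apply: tr; exists p => //; apply/eqP.
Qed.

Lemma peval_inj x : ~ algebraicOver iota x -> injective (peval x).
Proof.
move=> tr p q e; apply/eqP; rewrite -subr_eq0 -(peval_eq0 _ tr) rmorphB /= e.
by rewrite subrr.
Qed.

Lemma subfield_closure (K : fieldType) (E : K -> Prop) : is_subfield E ->
  [/\ E 0, E 1, forall x y, E x -> E y -> E (x + y), forall x y, E x -> E y -> E (x * y)
   & forall x, E x -> E (- x) /\ E x^-1].
Proof.
move=> [E1 Eb Ed]; have E0 : E 0 by rewrite -(subrr 1); apply: Eb.
have En x : E x -> E (- x) by rewrite -[- x]sub0r; apply: Eb.
have Ei x : E x -> E x^-1 by rewrite -[x^-1]mul1r; apply: Ed.
split=> // [x y Ex Ey|x y Ex Ey|x Ex]; last by split; [exact: En|exact: Ei].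
  by rewrite -[y]opprK; apply/Eb/En.
by rewrite -[y]invrK; apply/Ed/Ei.
Qed.

Lemma subfield_gen_is_subfield (K : fieldType) (A : K -> Prop) : is_subfield (subfield_gen A).
Proof.
split=> [E [] // | x y Ax Ay E sE AE | x y Ax Ay E sE AE].
  by case: (sE) => _ Eb _; apply: Eb; [apply: Ax | apply: Ay].
by case: (sE) => _ _ Ed; apply: Ed; [apply: Ax | apply: Ay].
Qed.

Lemma presentation_trans x y f : presentation x y f -> ~ algebraicOver iota x.
Proof. by case. Qed.

Lemma presentation_coord_eq0 x y f p q : presentation x y f ->
  peval x p + peval x q * y = 0 -> p = 0 /\ q = 0.
Proof.
move=> [gf tr ye _] e; have [] := @good_octic_not_square _ f p q gf; last by [].
apply: (peval_inj tr); rewrite !rmorphM /= -ye.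
by have -> : peval x p = - (peval x q * y); [apply/eqP; rewrite -addr_eq0 e | ring].
Qed.

(** Such fractions form a subfield containing the generators. Inverses are rationalized with the
    norm p'^2 - q'^2 f, which is nonzero because [f] is not a square in k(x). *)
Lemma presentation_coord x y f z : presentation x y f -> exists p q r,
  r != 0 /\ z = (peval x p + peval x q * y) / peval x r.
Proof.
move=> pr; have [gf tr ye gen] := pr; apply: (gen z (fun z => exists p q r,
  r != 0 /\ z = (peval x p + peval x q * y) / peval x r)); last first.
  move=> w [->|[->|[c ->]]].
  - by exists 'X, 0, 1; rewrite oner_neq0 pevalX rmorph0 rmorph1 mul0r addr0 divr1.
  - by exists 0, 1, 1; rewrite oner_neq0 rmorph0 rmorph1 mul1r add0r divr1.
  - by exists c%:P, 0, 1; rewrite oner_neq0 pevalC rmorph0 rmorph1 mul0r addr0 divr1.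
split=> [|u v [p [q [r [r0 ->]]]] [p' [q' [r' [r'0 ->]]]]|
         u v [p [q [r [r0 ->]]]] [p' [q' [r' [r'0 ->]]]]].
- by exists 1, 0, 1; rewrite oner_neq0 rmorph0 rmorph1 mul0r addr0 divr1.
- exists (p * r' - p' * r), (q * r' - q' * r), (r * r').
  rewrite mulf_neq0 // !rmorphB !rmorphM /=; split => //.
  by field; rewrite !peval_eq0 // r0 r'0.
- case: (eqVneq (peval x p' + peval x q' * y) 0) => [->|n0].
    by exists 0, 0, 1; rewrite oner_neq0 !rmorph0 !mul0r invr0 mulr0 add0r mul0r.
  have m0 : p' ^+ 2 - q' ^+ 2 * f != 0.
    rewrite subr_eq0; apply/eqP => /(good_octic_not_square gf)[p0 q0].
    by move: n0; rewrite p0 q0 !rmorph0 mul0r addr0 eqxx.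
  exists (r' * (p * p' - q * q' * f)), (r' * (q * p' - p * q')), (r * (p' ^+ 2 - q' ^+ 2 * f)).
  rewrite mulf_neq0 //; split => //.
  move: m0; rewrite -(peval_eq0 _ tr) !rmorphM !rmorphB !rmorphM /= -ye => m0.
  by field; rewrite !peval_eq0 // r0 r'0 n0 m0.
Qed.

End Presentations.

(** * Gauss's lemma over k[x] *)

Section Gauss.
Context (k : closedFieldType).
Implicit Types p q m : {poly {poly k}}.

(** Content 1: over an algebraically closed field a nonconstant common factor of the coefficients
    has a root, and specialization there kills [m]. *)
Definition primitive m := forall x0, map_poly (horner_eval x0) m != 0.

Lemma common_root_factor p x0 : map_poly (horner_eval x0) p = 0 ->
  exists q, p = ('X - x0%:P) *: q.
Proof.
move=> p0; exists (map_poly (fun c => c %/ ('X - x0%:P)) p).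
apply/polyP => i; rewrite coefZ coef_map_id0 ?div0p // mulrC divpK //.
by rewrite dvdp_XsubCl rootE -[_.[_]]/(horner_eval x0 _) -coef_map p0 coef0.
Qed.

Lemma primitive_part p : p != 0 -> exists c m, [/\ c != 0, p = c *: m & primitive m].
Proof.
have [n] := ubnP (size (lead_coef p)); elim: n p => // n IH p sp p0.
have [[x0 /eqP e0]|prim] := classic (exists x0, map_poly (horner_eval x0) p == 0); last first.
  by exists 1, p; rewrite oner_neq0 scale1r; split=> // x0; apply/negP => e; apply: prim; exists x0.
have [q pE] := common_root_factor e0.
have q0 : q != 0 by apply: contraNneq p0 => q0; rewrite pE q0 scaler0.
have [|c [m [c0 qE prim]]] := IH q _ q0; last first.
  exists (('X - x0%:P) * c), m; rewrite mulf_neq0 ?polyXsubC_eq0 //; split=> //.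
  by rewrite pE qE scalerA.
move: sp; rewrite pE lead_coefZ size_monicM ?monicXsubC ?lead_coef_eq0 // size_XsubC.
by rewrite ltnS.
Qed.

(** Linear factors of [e] are cancelled one at a time. At a root of [e] the specialization of
    [q * m] vanishes while that of [m] does not, so the factor divides [q]. *)
Lemma primitive_divides (e : {poly k}) p q m : e != 0 -> primitive m ->
  e *: p = q * m -> exists n, p = n * m.
Proof.
have [n] := ubnP (size e); elim: n e p q => // n IH e p q se e0 prim pq.
have [s1|/closed_rootP[x0 /factor_theorem[e1 eE]]] := eqVneq (size e) 1%N.
  have /size_poly1P[u u0 eE] : size e == 1%N by rewrite s1.
  exists ((u^-1)%:P *: q); rewrite -scalerAl -pq scalerA eE -polyCM mulVf //.
  by rewrite scale1r.
have : map_poly (horner_eval x0) q == 0.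
  have := congr1 (map_poly (horner_eval x0)) pq.
  rewrite rmorphM /= -mul_polyC rmorphM /= map_polyC /= eE /horner_eval !hornerE subrr mulr0.
  by rewrite mul0r => /esym/eqP; rewrite mulf_eq0 (negPf (prim x0)) orbF.
move=> /eqP/common_root_factor[q1 qE].
have e1n0 : e1 != 0 by apply: contraNneq e0 => e10; rewrite eE e10 mul0r.
apply: (IH e1 p q1) => //.
  by move: se; rewrite eE size_Mmonic ?monicXsubC // size_XsubC addn2 ltnS.
have xn0 : ('X - x0%:P)%:P != 0 :> {poly {poly k}} by rewrite polyC_eq0 polyXsubC_eq0.
by apply: (mulfI xn0); rewrite !mul_polyC scalerA mulrC -eE pq qE scalerAl.
Qed.

(** Degrees in the inner variable add up, as exchanging the variables shows. Thus a primitive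
    minimal polynomial inherits the degree bound of every relation it divides. *)
Lemma sizeY_factor p q m : p != 0 -> p = q * m -> (sizeY m <= sizeY p)%N.
Proof.
move=> p0 pE; rewrite !sizeYE pE rmorphM /=.
have [q0 m0] : swapXY q != 0 /\ swapXY m != 0.
  by apply/andP; rewrite !swapXY_eq0 -negb_or -mulf_eq0 -pE.
rewrite size_mul //; move: q0; rewrite -size_poly_gt0.
by move: (size _) (size _) => i j; lia.
Qed.

Context (L : fieldType) (iota : {rmorphism k -> L}).

Definition bieval (x z : L) : {poly {poly k}} -> L :=
  horner_eval z \o map_poly (peval iota x).
HB.instance Definition _ (x z : L) :=
  GRing.RMorphism.copy (bieval x z) (horner_eval z \o map_poly (peval iota x)).

Lemma bievalC x z (p : {poly k}) : bieval x z p%:P = peval iota x p.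
Proof. by rewrite /bieval /= map_polyC /horner_eval hornerC. Qed.

Lemma bievalX x z : bieval x z 'X = z.
Proof. by rewrite /bieval /= map_polyX /horner_eval hornerX. Qed.

Lemma bieval_polyC x z (p : {poly k}) : bieval x z (map_poly polyC p) = peval iota z p.
Proof.
rewrite /bieval /= -map_poly_comp /horner_eval pevalE; congr _.[_].
by apply: eq_map_poly => c; rewrite /= pevalC.
Qed.

(* [m] is the primitive minimal polynomial of [z] over k[x]. *)
Lemma minimal_divides x z m p : ~ algebraicOver iota x -> primitive m ->
  (forall r : {poly {poly k}}, (size r < size m)%N -> bieval x z r = 0 -> r = 0) ->
  bieval x z m = 0 -> bieval x z p = 0 -> exists q, p = q * m.
Proof.
move=> tr prim mini m0 p0.
have mn0 : m != 0.
  by apply: contraNneq (prim 0) => ->; rewrite rmorph0.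
have e := Pdiv.Idomain.divp_eq p m.
have r0 : p %% m = 0.
  apply: mini; first by rewrite Pdiv.Idomain.ltn_modp.
  move/(congr1 (bieval x z)): e.
  by rewrite -mul_polyC rmorphD !rmorphM /= p0 m0 !mulr0 add0r => <-.
rewrite r0 addr0 in e; apply: (primitive_divides _ prim e).
by rewrite expf_neq0 // lead_coef_eq0.
Qed.

End Gauss.

(** * Uniqueness of the hyperelliptic coordinate *)

Section Uniqueness.
Context (k : closedFieldType) (char0 : [pchar k] =i pred0).
Context (L : fieldType) (iota : {rmorphism k -> L}).

Lemma size_le3 (a b c : {poly k}) : (size (a%:P * 'X^2 + b%:P * 'X + c%:P)%R <= 3)%N.
Proof.
apply/leq_sizeP => -[|[|[|j]]] // _.
by rewrite !coefD !coefCM coefXn coefX coefC !mulr0 !addr0.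
Qed.

Lemma poly_size3 (R : nzRingType) (p : {poly R}) : (size p <= 3)%N ->
  p = p`_2 *: 'X^2 + p`_1 *: 'X + (p`_0)%:P.
Proof.
move=> s3; apply/polyP => -[|[|[|j]]]; rewrite !coefD !coefZ coefXn coefX coefC /=;
  rewrite ?mulr0 ?mulr1 ?add0r ?addr0 //.
by rewrite nth_default // (leq_trans s3).
Qed.

Lemma swapXY_quadratic (a b c : {poly k}) :
  swapXY (map_poly polyC a * ('X^2)%:P + map_poly polyC b * 'X%:P + map_poly polyC c)
  = a%:P * 'X^2 + b%:P * 'X + c%:P.
Proof.
by rewrite !rmorphD !rmorphM /= !swapXY_map_polyC !swapXY_Y.
Qed.

Lemma bieval_quadratic_swap x z (a b c : {poly k}) :
  bieval iota x z (map_poly polyC a * ('X^2)%:P + map_poly polyC b * 'X%:P + map_poly polyC c)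
  = peval iota z a * x ^+ 2 + peval iota z b * x + peval iota z c.
Proof.
by rewrite !rmorphD !rmorphM /= !bieval_polyC !bievalC !pevalX.
Qed.

Lemma bieval_quadratic x z (a b c : {poly k}) :
  bieval iota x z (a%:P * 'X^2 + b%:P * 'X + c%:P)
  = peval iota x a * z ^+ 2 + peval iota x b * z + peval iota x c.
Proof.
by rewrite !rmorphD !rmorphM /= !bievalC !bievalX.
Qed.

(* If [q] were nonzero, the primitive minimal polynomial of [x'] over [k[x]]
   would have degree at most 2 in [x], because [x] is quadratic over [k(x')].
   Its discriminant, of degree at most 4, is [f] up to a square. *)
Lemma coordinate_rational x y f x' y' f' p q r :
  presentation iota x y f -> presentation iota x' y' f' -> r != 0 ->
  x' = (peval iota x p + peval iota x q * y) / peval iota x r -> q = 0.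
Proof.
move=> pr pr' r0 x'E; apply/eqP/negPn/negP => q0.
have [gf tr ye _] := pr; have [_ tr' ye' _] := pr'.
have [p' [q' [r' [r'0 xE]]]] := presentation_coord x pr'.
have rx0 : peval iota x r != 0 by rewrite peval_eq0.
have rx'0 : peval iota x' r' != 0 by rewrite peval_eq0.
have two0 : (2 : k) != 0 := natS_neq0 char0 1.
pose up : {poly k} -> {poly {poly k}} := map_poly polyC.
(* The quadratic equation of [x] over k(x') with denominators cleared, written with x' as the outer
   variable: its inner degree is at most 2, and [m] divides it. *)
pose Phi := up (r' ^+ 2) * ('X^2)%:P + up (- (2 * p' * r')) * 'X%:P
  + up (p' ^+ 2 - q' ^+ 2 * f').
have swPhi : swapXY Phi = (r' ^+ 2)%:P * 'X^2 + (- (2 * p' * r'))%:P * 'X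
  + (p' ^+ 2 - q' ^+ 2 * f')%:P.
  exact: swapXY_quadratic.
have sPhi : (sizeY Phi <= 3)%N by rewrite sizeYE swPhi size_le3.
have Phi0 : Phi != 0.
  rewrite -swapXY_eq0 swPhi; apply/eqP => /(congr1 (fun u : {poly {poly k}} => u`_2)).
  rewrite !coefD !coefCM coefXn coefX coefC coef0 /= mulr0 mulr1 !addr0.
  by apply/eqP; rewrite expf_neq0.
have ePhi : bieval iota x x' Phi = 0.
  rewrite bieval_quadratic_swap rmorphN rmorphB !rmorphM /= -ye' xE rmorphMn /= rmorph1.
  by field.
pose m0 := (r ^+ 2)%:P * 'X^2 + (- (2 * p * r))%:P * 'X + (p ^+ 2 - q ^+ 2 * f)%:P.
have m0n0 : m0 != 0.
  apply/eqP => /(congr1 (fun u : {poly {poly k}} => u`_2)).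
  rewrite !coefD !coefCM coefXn coefX coefC coef0 /= mulr0 mulr1 !addr0.
  by apply/eqP; rewrite expf_neq0.
have [c [m [c0 mE prim]]] := primitive_part m0n0.
have em0 : bieval iota x x' m0 = 0.
  rewrite bieval_quadratic rmorphN rmorphB !rmorphM /= -ye x'E rmorphMn /= rmorph1.
  by field.
have em : bieval iota x x' m = 0.
  move: em0; rewrite mE -mul_polyC rmorphM /= bievalC => /eqP.
  by rewrite mulf_eq0 peval_eq0 // (negPf c0) => /eqP.
have sm : (size m <= 3)%N.
  have := size_le3 (r ^+ 2) (- (2 * p * r)) (p ^+ 2 - q ^+ 2 * f).
  by rewrite -/m0 mE size_scale.
have mini (t : {poly {poly k}}) : (size t < size m)%N -> bieval iota x x' t = 0 -> t = 0.
  move=> /leq_trans/(_ sm) st.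
  have tE : t = (t`_1)%:P * 'X + (t`_0)%:P.
    by rewrite {1}(poly_size3 (leqW st)) (nth_default 0 st) scale0r add0r mul_polyC.
  rewrite {1}tE rmorphD rmorphM /= !bievalC bievalX x'E => e.
  have [] := @presentation_coord_eq0 _ _ _ x y f (t`_1 * p + t`_0 * r) (t`_1 * q) pr.
    apply: (mulIf (invr_neq0 rx0)); rewrite mul0r -[RHS]e rmorphD !rmorphM /=.
    by field.
  move=> e0 /eqP; rewrite mulf_eq0 (negPf q0) orbF => /eqP t1.
  move/eqP: e0; rewrite t1 mul0r add0r mulf_eq0 (negPf r0) orbF => /eqP t0.
  by rewrite tE t1 t0 mul0r add0r.
have [n PhiE] := minimal_divides tr prim mini em ePhi.
have smY : (sizeY m <= 3)%N := leq_trans (sizeY_factor Phi0 PhiE) sPhi.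
have sc i : (size (m`_i)%R <= 3)%N := leq_trans (max_size_coefXY m i) smY.
have mc i : m0`_i = c * m`_i by rewrite mE coefZ.
have := mc 2%N; have := mc 1%N; have := mc 0%N.
rewrite /m0 !coefD !coefCM !coefXn !coefX !coefC /= !mulr0 !mulr1 !addr0 !add0r.
move=> c0E c1E c2E.
have [s [dE sE]] : exists s, m`_1 ^+ 2 - 4 * m`_2 * m`_0 = s ^+ 2 * f /\ 2 * r * q = s * c.
  apply: square_factor => //.
  transitivity ((c * m`_1) ^+ 2 - 4 * (c * m`_2) * (c * m`_0)); first by ring.
  by rewrite -c0E -c1E -c2E; ring.
have s0 : s != 0.
  apply: contraTneq (isT : true) => s0; move/eqP: sE; rewrite s0 mul0r !mulf_eq0.
  by rewrite (negPf r0) (negPf q0) -[2]/(2%:R) -polyC_natr polyC_eq0 (negPf two0).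
have : (size (m`_1 ^+ 2 - 4 * m`_2 * m`_0)%R <= 5)%N.
  have s5 (u v : {poly k}) : (size u <= 3)%N -> (size v <= 3)%N -> (size (u * v)%R <= 5)%N.
    move=> su sv; apply: leq_trans (size_polyMleq _ _) _; move: su sv.
    by move: (size u) (size v) => i j; clear; lia.
  apply: leq_trans (size_polyD _ _) _; rewrite geq_max size_polyN s5 ?sc //=.
  rewrite -mulrA -[4]/(4%:R) -polyC_natr mul_polyC.
  by apply: leq_trans (size_scale_leq _ _) _; rewrite s5 ?sc.
rewrite dE size_mul ?expf_neq0 ?(good_octic_neq0 gf) //.
have := good_octic_size gf; have : (0 < size (s ^+ 2)%R)%N by rewrite size_poly_gt0 expf_neq0.
by move: (size _) (size _) => i j; clear; lia.
Qed.

End Uniqueness.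

Section Moebius.
Context (k : closedFieldType) (char0 : [pchar k] =i pred0).
Context (L : fieldType) (iota : {rmorphism k -> L}).

Lemma iota_linear_neq0 x c d : ~ algebraicOver iota x -> (c != 0) || (d != 0) ->
  iota c * x + iota d != 0.
Proof.
move=> tr cd; have := linear_neq0 cd; rewrite -(peval_eq0 _ tr).
by rewrite rmorphD /= pevalZ pevalX pevalC.
Qed.

(** By [coordinate_rational] each coordinate is a rational function of the other, so the primitive
    minimal polynomial of x' over k[x] has degree at most 1 in both variables. A vanishing
    determinant would make x' a constant. *)
Lemma coordinate_moebius x y f x' y' f' :
  presentation iota x y f -> presentation iota x' y' f' ->
  exists a b c d, a * d - b * c != 0 /\
    x' = (iota a * x + iota b) / (iota c * x + iota d).
Proof.
move=> pr pr'; have [gf tr ye _] := pr; have [_ tr' ye' _] := pr'.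
have [p [q [r [r0 x'E]]]] := presentation_coord x' pr.
have [p' [q' [r' [r'0 xE]]]] := presentation_coord x pr'.
have q0 := coordinate_rational char0 pr pr' r0 x'E.
have q'0 := coordinate_rational char0 pr' pr r'0 xE.
move: x'E xE; rewrite q0 q'0 !rmorph0 !mul0r !addr0 => x'E xE.
have rx0 : peval iota x r != 0 by rewrite peval_eq0.
have rx'0 : peval iota x' r' != 0 by rewrite peval_eq0.
pose up : {poly k} -> {poly {poly k}} := map_poly polyC.
pose Phi := up 0 * ('X^2)%:P + up r' * 'X%:P + up (- p').
have swPhi : swapXY Phi = 0%:P * 'X^2 + r'%:P * 'X + (- p')%:P by exact: swapXY_quadratic.
have sPhi : (sizeY Phi <= 2)%N.
  rewrite sizeYE swPhi polyC0 mul0r add0r; apply/leq_sizeP => -[|[|j]] // _.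
  by rewrite coefD coefCM coefX coefC mulr0 addr0.
have Phi0 : Phi != 0.
  rewrite -swapXY_eq0 swPhi; apply/eqP => /(congr1 (fun u : {poly {poly k}} => u`_1)).
  rewrite !coefD !coefCM coefXn coefX coefC coef0 /= mulr0 mulr1 addr0 add0r.
  by apply/eqP.
have ePhi : bieval iota x x' Phi = 0.
  by rewrite bieval_quadratic_swap rmorph0 rmorphN /= xE; field.
pose m0 := 0%:P * 'X^2 + r%:P * 'X + (- p)%:P.
have m0n0 : m0 != 0.
  apply/eqP => /(congr1 (fun u : {poly {poly k}} => u`_1)).
  rewrite !coefD !coefCM coefXn coefX coefC coef0 /= mulr0 mulr1 addr0 add0r.
  by apply/eqP.
have [c [m [c0 mE prim]]] := primitive_part m0n0.
have em0 : bieval iota x x' m0 = 0.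
  by rewrite bieval_quadratic rmorph0 rmorphN /= x'E; field.
have em : bieval iota x x' m = 0.
  move: em0; rewrite mE -mul_polyC rmorphM /= bievalC => /eqP.
  by rewrite mulf_eq0 peval_eq0 // (negPf c0) => /eqP.
have sm : (size m <= 2)%N.
  rewrite -(size_scale _ c0) -mE /m0 polyC0 mul0r add0r.
  apply/leq_sizeP => -[|[|j]] // _.
  by rewrite coefD coefCM coefX coefC mulr0 addr0.
have mini (t : {poly {poly k}}) : (size t < size m)%N -> bieval iota x x' t = 0 -> t = 0.
  move=> /leq_trans/(_ sm); rewrite ltnS => st.
  have tE := size1_polyC st; rewrite {1}tE bievalC => /eqP.
  by rewrite peval_eq0 // => /eqP t0; rewrite tE t0.
have [n PhiE] := minimal_divides tr prim mini em ePhi.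
have sc i : (size (m`_i)%R <= 2)%N.
  exact: leq_trans (max_size_coefXY m i) (leq_trans (sizeY_factor Phi0 PhiE) sPhi).
have linE i : peval iota x m`_i = iota m`_i`_1 * x + iota m`_i`_0.
  rewrite [in LHS](poly_size3 (leqW (sc i))) (nth_default 0 (sc i)) scale0r add0r.
  by rewrite rmorphD /= pevalZ pevalX pevalC.
have m10 : m`_1 != 0.
  apply: contraNneq r0 => m1; have := congr1 (fun u : {poly {poly k}} => u`_1) mE.
  rewrite coefZ m1 mulr0 /m0 !coefD !coefCM coefXn coefX coefC /= mulr0 mulr1 addr0 add0r.
  by move->.
have e : peval iota x m`_1 * x' = - peval iota x m`_0.
  apply/eqP; rewrite -addr_eq0; apply/eqP.
  move: em; rewrite {1}(poly_size3 (leqW sm)) (nth_default 0 sm) scale0r add0r.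
  by rewrite -mul_polyC rmorphD rmorphM /= !bievalC bievalX.
move: e; rewrite !linE.
have : (m`_1`_1 != 0) || (m`_1`_0 != 0).
  rewrite -negb_and; apply: contraNN m10 => /andP[/eqP m11 /eqP m10].
  by rewrite (poly_size3 (leqW (sc 1%N))) (nth_default 0 (sc 1%N)) m11 m10 !scale0r !add0r.
move: (m`_1`_1) (m`_1`_0) (m`_0`_1) (m`_0`_0) => C D A B CD e.
have q1 := iota_linear_neq0 tr CD.
have x'E2 : x' = (iota (- A) * x + iota (- B)) / (iota C * x + iota D).
  apply: (mulIf q1); rewrite mulrC e !rmorphN; field.
  by rewrite q1.
exists (- A), (- B), C, D; split=> //; apply: contra_notN tr' => /eqP det.
move: det; rewrite !mulNr opprK => /eqP; rewrite addrC subr_eq0 => /eqP det.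
suff [t ->] : exists t, x' = iota t by exact: algebraic_id.
case: (eqVneq C 0) CD => [C0 /= D0|C0 _].
  exists (- B / D); rewrite x'E2.
  have -> : A = 0.
    by apply/eqP; move/eqP: det; rewrite C0 mulr0 eq_sym mulf_eq0 (negPf D0) orbF.
  by rewrite C0 oppr0 !rmorph0 !mul0r !add0r fmorph_div.
exists (- A / C); rewrite x'E2 fmorph_div; apply/eqP.
have iC0 : iota C != 0 by rewrite fmorph_eq0.
rewrite eqr_div //; apply/eqP; rewrite !rmorphN.
transitivity (- (iota A * iota C * x + iota B * iota C)); first by ring.
by rewrite -(rmorphM iota B C) det rmorphM; ring.
Qed.

Lemma peval_octic_subst x a b c d (f : {poly k}) : (size f <= 9)%N ->
  iota c * x + iota d != 0 ->
  peval iota x (octic_subst a b c d f) = (iota c * x + iota d) ^+ 8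
    * peval iota ((iota a * x + iota b) / (iota c * x + iota d)) f.
Proof.
move=> sf q0; rewrite pevalE /octic_subst -[map_poly _ _]/(map_poly iota (moebius_sub 8 a b c d f)).
rewrite pevalE -horner_moebius_sub //; last by rewrite size_map_poly.
congr (_.[_]); rewrite /moebius_sub rmorph_sum; apply: eq_bigr => i _ /=.
rewrite map_polyZ rmorphM !rmorphXn /= !rmorphD /= !map_polyZ !map_polyX !map_polyC.
by rewrite coef_map.
Qed.

(* The coordinate change [x = (a x' + b) / (c x' + d)] turns [f] into
   [octic_subst a b c d f]. *)
Lemma presentation_moebius x y f a b c d e g :
  presentation iota x y f -> a * d - b * c != 0 -> e != 0 ->
  octic_subst a b c d f = e *: g ->
  exists x' y', [/\ presentation iota x' y' g,
    x = (iota a * x' + iota b) / (iota c * x' + iota d)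
    & exists2 r, r ^+ 2 = e & y = iota r * y' / (iota c * x' + iota d) ^+ 4].
Proof.
move=> [gf tr ye gen] det e0 sE; have [s9 _] := gf.
have det' : d * a - (- b) * (- c) != 0 by rewrite mulrNN [d * a]mulrC.
have [r r2] := sqrt_exists e.
have r0 : r != 0 by apply: contraNneq e0 => r0; rewrite -r2 r0 expr0n.
have ca : (- c != 0) || (a != 0) := det_row2 det'.
have q0 := iota_linear_neq0 tr ca.
have dt0 : iota a * iota d - iota b * iota c != 0 by rewrite -!rmorphM -rmorphB fmorph_eq0.
pose x' := (iota d * x - iota b) / (iota (- c) * x + iota a).
have q1E : iota c * x' + iota d = (iota a * iota d - iota b * iota c) / (iota (- c) * x + iota a).
  rewrite /x' rmorphN; move: q0; rewrite rmorphN => q0; by field.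
have q10 : iota c * x' + iota d != 0 by rewrite q1E mulf_neq0 ?invr_neq0.
have xE : x = (iota a * x' + iota b) / (iota c * x' + iota d).
  rewrite q1E /x'; move: q0; rewrite rmorphN => q0; field.
  by rewrite q0 dt0.
(* The octic gets multiplied by the eighth power of the denominator, hence [y] by the fourth. *)
pose y' := (iota r)^-1 * (iota c * x' + iota d) ^+ 4 * y.
have ir0 : iota r != 0 by rewrite fmorph_eq0.
have yE : y = iota r * y' / (iota c * x' + iota d) ^+ 4.
  by rewrite /y'; field; rewrite ir0 q10.
exists x', y'; split=> //; last by exists r.
split.
- exact: good_octic_sub det e0 sE gf.
- move=> alg; apply: tr; rewrite xE; have ai := algebraic_id iota.
  by apply: algebraic_div; apply: algebraic_add => //; apply: algebraic_mul.
- have := peval_octic_subst a b s9 q10; rewrite -xE sE pevalZ -ye -r2 rmorphXn /= => ge.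
  apply: (mulfI (expf_neq0 2 ir0)); rewrite ge /y'; field.
  by rewrite ir0.
pose E := subfield_gen (fun w => w = x' \/ w = y' \/ exists c, w = iota c).
have sE' : is_subfield E := subfield_gen_is_subfield _.
have [_ _ Ea Em Ei] := subfield_closure sE'.
have Ec t : E (iota t) by move=> F _; apply; right; right; exists t.
have Ex' : E x' by move=> F _; apply; left.
have Ey' : E y' by move=> F _; apply; right; left.
have Eq : E (iota c * x' + iota d) := Ea _ _ (Em _ _ (Ec c) Ex') (Ec d).
move=> z; apply: (gen z E sE') => w [->|[->|[t ->]]] //.
  by rewrite xE; exact: Em _ _ (Ea _ _ (Em _ _ (Ec a) Ex') (Ec b)) (Ei _ Eq).2.
have Eq4 : E ((iota c * x' + iota d) ^+ 4).
  rewrite -[4%N]/(2 * 2)%N exprM !expr2.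
  exact: Em _ _ (Em _ _ Eq Eq) (Em _ _ Eq Eq).
by rewrite yE; exact: Em _ _ (Em _ _ (Ec r) Ey') (Ei _ Eq4).2.
Qed.

End Moebius.

(** * Isomorphisms between presentations *)

Section Automorphisms.
Context (k : closedFieldType) (char0 : [pchar k] =i pred0).
Context (L : fieldType) (iota : {rmorphism k -> L}).

(** Write y' = (A + B y) / C. Its square lies in k(x), so A B = 0. B = 0 would make an octic a
    square in k(x); for A = 0, squarefreeness and the degrees 7 and 8 leave only a constant multiple
    of y / (c x + d)^4. *)
Theorem presentation_unique x y f x' y' f' :
  presentation iota x y f -> presentation iota x' y' f' ->
  exists a b c d e, [/\ a * d - b * c != 0, e != 0,
    x' = (iota a * x + iota b) / (iota c * x + iota d),
    y' = iota e * y / (iota c * x + iota d) ^+ 4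
    & octic_subst a b c d f' = e ^+ 2 *: f].
Proof.
move=> pr pr'; have [gf tr ye _] := pr; have [gf' tr' ye' _] := pr'.
have [a [b [c [d [det x'E]]]]] := coordinate_moebius char0 pr pr'.
have cd := det_row2 det; have q0 := iota_linear_neq0 tr cd.
set g := octic_subst a b c d f'.
have gg : good_octic g.
  by apply: (good_octic_sub det (oner_neq0 _) _ gf'); rewrite scale1r.
pose Q : {poly k} := c *: 'X + d%:P.
have QE : peval iota x Q = iota c * x + iota d by rewrite rmorphD /= pevalZ pevalX pevalC.
have Q0 : Q != 0 by rewrite linear_neq0.
have [A [B [C [C0 y'E]]]] := presentation_coord y' pr.
have Cx0 : peval iota x C != 0 by rewrite peval_eq0.
have gE : peval iota x g = (iota c * x + iota d) ^+ 8 * y' ^+ 2.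
  by have [s9 _] := gf'; rewrite peval_octic_subst // -x'E -ye'.
have [] := @presentation_coord_eq0 _ _ _ x y f
  ((A ^+ 2 + B ^+ 2 * f) * Q ^+ 8 - C ^+ 2 * g) (2 * (A * B) * Q ^+ 8) pr.
  rewrite rmorphB /= [peval iota x (_ * g)]rmorphM /= gE y'E.
  rewrite ![peval iota x (_ * Q ^+ 8)]rmorphM !(rmorphXn (peval iota x) 8) /= QE rmorphD !rmorphM /= -ye.
  by rewrite rmorphMn rmorph1 /=; field.
move=> e1 /eqP; rewrite mulf_eq0 (negPf (expf_neq0 8 Q0)) orbF 2!mulf_eq0.
rewrite -[2]/(2%:R) -polyC_natr polyC_eq0 (negPf (natS_neq0 char0 1)) /=.
have {}e1 : (A ^+ 2 + B ^+ 2 * f) * Q ^+ 8 = C ^+ 2 * g by apply/eqP; rewrite -subr_eq0 e1.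
case/orP => /eqP z0; last first.
  have [] := @good_octic_not_square _ g (A * Q ^+ 4) C gg.
    by rewrite -e1 z0; ring.
  by move=> _ /eqP; rewrite (negPf C0).
have [s [gs BE]] : exists s, g = s ^+ 2 * f /\ B * Q ^+ 4 = s * C.
  by apply: square_factor => //; rewrite -e1 z0; ring.
have s0 : s != 0.
  by apply: contraTneq (good_octic_neq0 gg) => s0; rewrite gs s0 expr0n mul0r eqxx.
have /size_poly1P[e e0 sE] : size s == 1%N.
  have [s9 _] := gg; have := good_octic_size gf; move: s9.
  rewrite gs expr2 !size_mul ?mulf_neq0 ?(good_octic_neq0 gf) //.
  have : (0 < size s)%N by rewrite size_poly_gt0.
  by move: (size s) (size f) => i j; lia.
exists a, b, c, d, e; split=> //; last by rewrite -/g gs sE -polyC_exp mul_polyC.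
have : peval iota x B * (iota c * x + iota d) ^+ 4 = iota e * peval iota x C.
  by rewrite -QE -rmorphXn -rmorphM /= BE sE rmorphM /= pevalC.
move=> BE'; rewrite y'E z0 rmorph0 add0r; apply/eqP; rewrite eqr_div ?expf_neq0 //.
by apply/eqP; rewrite mulrAC BE'; ring.
Qed.

Lemma rmorph_presentation_ext x y f (s t : {rmorphism L -> L}) :
  presentation iota x y f -> (forall c, s (iota c) = iota c) ->
  (forall c, t (iota c) = iota c) -> s x = t x -> s y = t y -> s =1 t.
Proof.
move=> pr sc tc sx sy z; have [p [q [r [r0 ->]]]] := presentation_coord z pr.
by rewrite !fmorph_div !rmorphD !rmorphM /= !rmorph_peval // sx sy.
Qed.

(** The map is defined on a chosen representative (p + q y) / r and does not depend on the choice,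
    since 1 and y are linearly independent over k(x). *)
Lemma presentation_rmorph x y x' y' f :
  presentation iota x y f -> presentation iota x' y' f ->
  exists s : {rmorphism L -> L}, [/\ forall c, s (iota c) = iota c, s x = x' & s y = y'].
Proof.
move=> pr pr'; have [_ tr ye _] := pr; have [_ tr' ye' _] := pr'.
have rep z : exists t : {poly k} * {poly k} * {poly k}, (t.2 != 0) &&
    (z == (peval iota x t.1.1 + peval iota x t.1.2 * y) / peval iota x t.2).
  by have [p [q [r [r0 ->]]]] := presentation_coord z pr; exists (p, q, r); rewrite r0 eqxx.
pose s z := let t := xchoose (rep z) in
  (peval iota x' t.1.1 + peval iota x' t.1.2 * y') / peval iota x' t.2.
have sE p q r : r != 0 ->
    s ((peval iota x p + peval iota x q * y) / peval iota x r) =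
    (peval iota x' p + peval iota x' q * y') / peval iota x' r.
  move=> r0; rewrite /s; move: (xchooseP (rep ((peval iota x p + peval iota x q * y) / peval iota x r))).
  move: (xchoose _) => [[p1 q1] r1] /= /andP[r10 /eqP].
  move=> e; apply/eqP; rewrite eqr_div ?peval_eq0 //; move/eqP: e.
  rewrite eqr_div ?peval_eq0 // => /eqP e.
  have [] := @presentation_coord_eq0 _ _ _ x y f (p * r1 - p1 * r) (q * r1 - q1 * r) pr.
    by rewrite !rmorphB !rmorphM /=; apply: (eq_of_multiple (c := 1) e); ring.
  move=> /eqP + /eqP; rewrite !subr_eq0 => /eqP/(congr1 (peval iota x')) e1.
  move=> /eqP/(congr1 (peval iota x')); rewrite !rmorphM /= in e1 * => e2.
  by apply/eqP; rewrite mulrDl -e1 mulrAC -e2; ring.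
have nz r : r != 0 -> peval iota x r != 0 by rewrite peval_eq0.
have nz' r : r != 0 -> peval iota x' r != 0 by rewrite peval_eq0.
have s_zmod : zmod_morphism s.
  move=> u v; have [p [q [r [r0 ->]]]] := presentation_coord u pr.
  have [p1 [q1 [r1 [r10 ->]]]] := presentation_coord v pr.
  rewrite !sE //.
  have -> : (peval iota x p + peval iota x q * y) / peval iota x r -
    (peval iota x p1 + peval iota x q1 * y) / peval iota x r1 =
    (peval iota x (p * r1 - p1 * r) + peval iota x (q * r1 - q1 * r) * y) / peval iota x (r * r1).
    by rewrite !rmorphB !rmorphM /=; field; rewrite !nz.
  by rewrite sE ?mulf_neq0 // !rmorphB !rmorphM /=; field; rewrite !nz'.
have s_monoid : monoid_morphism s.
  split=> [|u v].
    have := sE 1 0 1 (oner_neq0 _).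
    by rewrite !rmorph1 !rmorph0 !mul0r !addr0 !divr1.
  have [p [q [r [r0 ->]]]] := presentation_coord u pr.
  have [p1 [q1 [r1 [r10 ->]]]] := presentation_coord v pr.
  rewrite !sE //.
  have -> : (peval iota x p + peval iota x q * y) / peval iota x r *
    ((peval iota x p1 + peval iota x q1 * y) / peval iota x r1) =
    (peval iota x (p * p1 + q * q1 * f) + peval iota x (p * q1 + q * p1) * y) / peval iota x (r * r1).
    by rewrite !rmorphD !rmorphM /= -ye; field; rewrite !nz.
  by rewrite sE ?mulf_neq0 // !rmorphD !rmorphM /= -ye'; field; rewrite !nz'.
pose sm : {rmorphism L -> L} := HB.pack s
  (GRing.isZmodMorphism.Build _ _ s s_zmod) (GRing.isMonoidMorphism.Build _ _ s s_monoid).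
exists sm; split=> [c||]; rewrite /sm /=.
- have := sE c%:P 0 1 (oner_neq0 _).
  by rewrite !rmorph1 !rmorph0 !mul0r !addr0 !divr1 !pevalC.
- have := sE 'X 0 1 (oner_neq0 _).
  by rewrite !rmorph1 !rmorph0 !mul0r !addr0 !divr1 !pevalX.
- have := sE 0 1 1 (oner_neq0 _).
  by rewrite !rmorph1 !rmorph0 !add0r !mul1r !divr1.
Qed.

Lemma presentation_automorphism x y x' y' f :
  presentation iota x y f -> presentation iota x' y' f ->
  exists s : {rmorphism L -> L}, [/\ is_automorphism iota s, s x = x' & s y = y'].
Proof.
move=> pr pr'; have [s [sc sx sy]] := presentation_rmorph pr pr'.
have [t [tc tx ty]] := presentation_rmorph pr' pr.
exists s; split=> //; split=> //; exists t => z.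
- apply: (rmorph_presentation_ext (s := t \o s) (t := idfun) pr) => //= [c||].
  + by rewrite sc tc.
  + by rewrite sx tx.
  + by rewrite sy ty.
- apply: (rmorph_presentation_ext (s := s \o t) (t := idfun) pr') => //= [c||].
  + by rewrite tc sc.
  + by rewrite tx sx.
  + by rewrite ty sy.
Qed.

Lemma automorphism_presentation x y f (s : {rmorphism L -> L}) :
  presentation iota x y f -> is_automorphism iota s -> presentation iota (s x) (s y) f.
Proof.
move=> [gf tr ye gen] [[t ts st] sc]; split=> //.
- move=> [p p0 /eqP rt]; apply: tr; exists p => //; apply/eqP.
  by apply: (fmorph_inj s); rewrite -pevalE rmorph_peval // rmorph0.
- by rewrite -rmorphXn ye /= rmorph_peval.
move=> z; rewrite -(st z); pose E w := subfield_gen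
  (fun w => w = s x \/ w = s y \/ exists c, w = iota c) (s w).
have [E1 Es Ed] := subfield_gen_is_subfield
  (fun w => w = s x \/ w = s y \/ exists c, w = iota c).
apply: (gen (t z) E); first split; rewrite /E.
- by rewrite rmorph1.
- by move=> u v Eu Ev; rewrite rmorphB; apply: Es.
- by move=> u v Eu Ev; rewrite fmorph_div; apply: Ed.
move=> w [->|[->|[c ->]]] F _; apply; [by left|by right; left|].
by right; right; exists c; rewrite sc.
Qed.

End Automorphisms.

(** * Reduction to the slice octics *)

Lemma Z2_cubed_mulgg (g : Z2_cubed) : (g * g = 1)%g.
Proof.
have e (i : 'Z_2) : (i * i = 1)%g by case: i => -[|[|//]] ?; apply/val_inj.
by case: g => [[a b] c]; congr (_, _, _); apply: e.
Qed.

Lemma Z2_cubed_mulgC (g h : Z2_cubed) : (g * h = h * g)%g.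
Proof.
have e (i j : 'Z_2) : (i * j = j * i)%g by apply/val_inj; rewrite /= addnC.
by case: g h => [[a b] c] [[a' b'] c']; congr (_, _, _); apply: e.
Qed.

Lemma card_Z2_cubed : #|Z2_cubed| = 8%N.
Proof. by rewrite !card_prod !card_ord. Qed.

Section Slice.
Context (k : closedFieldType) (char0 : [pchar k] =i pred0).
Context (L : fieldType) (iota : {rmorphism k -> L}).

Lemma octic_subst_eq (a b c d e : k) (f g : {poly k}) : (size f <= 9)%N ->
  a * d - b * c != 0 ->
  (forall x, c * x + d != 0 -> (c * x + d) ^+ 8 * f.[(a * x + b) / (c * x + d)] = e * g.[x]) ->
  octic_subst a b c d f = e *: g.
Proof.
move=> sf det fg; apply: (@poly_eq_off _ (c *: 'X + d%:P)).
  by rewrite linear_neq0 ?(det_row2 det).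
move=> x; rewrite horner_linear => q0.
by rewrite hornerZ -fg // -horner_moebius_sub.
Qed.

Lemma presentation_moebius_inv x y f a b c d :
  presentation iota x y f -> a * d - b * c != 0 ->
  exists y' f', presentation iota ((iota a * x + iota b) / (iota c * x + iota d)) y' f'.
Proof.
move=> pr det; have det' : d * a - (- b) * (- c) != 0 by rewrite mulrNN [d * a]mulrC.
have [x' [y' [pr' xE _]]] := presentation_moebius pr det' (oner_neq0 _) (esym (scale1r _)).
exists y', (octic_subst d (- b) (- c) a f); suff <- : x' = (iota a * x + iota b) / (iota c * x + iota d) by [].
have tr' := presentation_trans pr'; have tr := presentation_trans pr.
have cd := det_row2 det; have ca := det_row2 det'.
have q0 := iota_linear_neq0 tr cd; have q0' := iota_linear_neq0 tr' ca.
apply: (mulIf q0); rewrite divfK // xE; move: q0'; rewrite !rmorphN => q0'.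
by field.
Qed.

(** A nontrivial involution of the line has two fixed points, and a coordinate that moves them to 0
    and infinity changes sign. *)
Lemma involution_diagonal x y f (s : {rmorphism L -> L}) :
  presentation iota x y f -> is_automorphism iota s -> s (s x) = x -> s x != x ->
  exists x' y' f', presentation iota x' y' f' /\ s x' = - x'.
Proof.
move=> pr aut ss sx; have [_ sc] := aut.
have tr := presentation_trans pr.
have [a [b [c [d [det sxE]]]]] := coordinate_moebius char0 pr (automorphism_presentation pr aut).
have cd := det_row2 det; have q0 := iota_linear_neq0 tr cd.
have two0 : (2 : k) != 0 := natS_neq0 char0 1.
have q1 : iota c * s x + iota d != 0.
  by rewrite -(sc c) -(sc d) -rmorphM -rmorphD fmorph_eq0.
have e : x * (iota c * s x + iota d) = iota a * s x + iota b.
  have := ss; rewrite {1}sxE fmorph_div !rmorphD !rmorphM !sc => e.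
  by rewrite -{1}e mulfVK.
(* For nonzero trace, s (s x) = x becomes the fixed-point equation c x^2 + (d - a) x - b = 0. Its
   coefficients vanish as [x] is transcendental, and then [s] fixes [x]. *)
have [da|nda] := eqVneq d (- a); last first.
  have ad0 : a + d != 0 by rewrite addrC addr_eq0.
  have : (a + d) *: (c *: 'X^2 + (d - a) *: 'X - b%:P) = 0.
    apply: (peval_inj tr); rewrite rmorph0 pevalZ rmorphB /= [peval _ _ (_ + _)]rmorphD /= !pevalZ pevalC ['X^2]expr2 rmorphM /= !pevalX.

    move: e; rewrite sxE => /(congr1 (fun z => z * (iota c * x + iota d))) e.
    rewrite rmorphD rmorphB.
    transitivity (x * (iota c * ((iota a * x + iota b) / (iota c * x + iota d)) + iota d) * (iota c * x + iota d)
      - (iota a * ((iota a * x + iota b) / (iota c * x + iota d)) + iota b) * (iota c * x + iota d)).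
      by field.
    by rewrite e subrr.
  move=> /eqP; rewrite scaler_eq0 (negPf ad0) /= => /eqP e0.
  have := congr1 (fun p : {poly k} => (p`_0, p`_1, p`_2)) e0.
  rewrite !coefD !coefN !coefZ !coefXn !coefX !coefC /= !mulr0 !mulr1 !add0r !subr0 ?addr0.
  move=> [b0 da c0]; case/eqP: sx; rewrite sxE c0.
  move/eqP: b0; rewrite oppr_eq0 => /eqP->; move/eqP: da; rewrite subr_eq0 => /eqP da.
  rewrite da rmorph0 addr0 mul0r add0r mulrAC divff ?mul1r //.
  by move: q0; rewrite c0 rmorph0 mul0r add0r da.
(* For [c] nonzero the fixed points are (a + r) / c and (a - r) / c; for [c = 0] one of them is
   infinity. *)
have [r r2] := sqrt_exists (a ^+ 2 + b * c).
have r0 : r != 0.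
  apply: contraNneq det => r0; move: r2; rewrite r0 expr0n /= da => e0.
  by apply/eqP; transitivity (- (a ^+ 2 + b * c)); [ring | rewrite -e0 oppr0].
move: q0 sxE; rewrite da rmorphN => q0 sxE.
have [c0|c0] := eqVneq c 0.
  have a0 : a != 0 by apply: contraNneq r0 => a0; move: r2; rewrite a0 c0 mulr0 expr0n addr0 /= => /eqP; rewrite expf_eq0.
  have det1 : 2 * a * 1 - b * 0 != 0 by rewrite mulr0 subr0 mulr1 mulf_neq0.
  have [y' [f' pr']] := presentation_moebius_inv pr det1.
  exists ((iota (2 * a) * x + iota b) / (iota 0 * x + iota 1)), y', f'; split=> //.
  rewrite fmorph_div !rmorphD !rmorphM !sc sxE c0 !rmorph0 rmorph1 !mul0r !add0r.
  rewrite rmorphMn rmorph1; field.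
  by rewrite oner_neq0 oppr_eq0 fmorph_eq0.
have det1 : c * (- r - a) - (r - a) * c != 0.
  have -> : c * (- r - a) - (r - a) * c = - (2 * r * c) by ring.
  by rewrite oppr_eq0 !mulf_neq0.
have [y' [f' pr']] := presentation_moebius_inv pr det1.
have q2 := iota_linear_neq0 tr (det_row2 det1).
have q3 : iota c * s x + iota (- r - a) != 0.
  by rewrite -(sc c) -(sc (- r - a)) -rmorphM -rmorphD fmorph_eq0.
exists ((iota c * x + iota (r - a)) / (iota c * x + iota (- r - a))), y', f'; split=> //.
have er : iota r ^+ 2 = iota a ^+ 2 + iota b * iota c by rewrite -!rmorphXn -rmorphM -rmorphD r2.
rewrite fmorph_div !rmorphD !rmorphM !sc; rewrite -!rmorphD.
apply/eqP; rewrite -mulNr eqr_div //; apply/eqP; rewrite !rmorphD.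
rewrite sxE ?rmorphN.
by apply: (@eq_of_multiple _ (1 + 1) _ _ _ _ (esym er)); field.
Qed.
End Slice.

(* With [t = X^2 + X^-2] the octic is [X^4 G(t)] for the quadratic form [G] whose
   values at the branch points [t = oo, -2, 2] of [X |-> t], suitably normalized,
   are [a], [16 b] and [16 c]. *)
Definition slice (R : comNzRingType) (a b c : R) : {poly R} :=
  Poly [:: a; 0; 4 * (c - b); 0; 8 * (b + c) - 2 * a; 0; 4 * (c - b); 0; a].

Lemma size_slice (R : comNzRingType) (a b c : R) : (size (slice a b c) <= 9)%N.
Proof. exact: size_Poly. Qed.

Lemma horner_slice (R : comNzRingType) (a b c x : R) : (slice a b c).[x] =
  a * (x ^+ 8 + 1) + 4 * (c - b) * (x ^+ 6 + x ^+ 2) + (8 * (b + c) - 2 * a) * x ^+ 4.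
Proof. by rewrite horner_Poly /=; ring. Qed.

Section SliceForm.
Context (k : closedFieldType) (char0 : [pchar k] =i pred0).
Context (L : fieldType) (iota : {rmorphism k -> L}).

(** An automorphism is determined by the images of [x] and [y], and the image of [x] leaves two
    possibilities for that of [y]. So at most twice [size s] group elements can send [x] into
    [s]. *)
Lemma embedding_orbit (gT : finGroupType) (e : gT -> {rmorphism L -> L}) x y f (s : seq L) :
  is_group_embedding iota e -> presentation iota x y f -> (2 * size s < #|gT|)%N ->
  exists g, e g x \notin s.
Proof.
move=> [aut _ inj] pr ltsT; apply: NNPP => none.
have es g : e g x \in s by apply/negPn/negP => ns; apply: none; exists g.
pose r v := if [pick g | e g x == v] is Some g then e g y else 0.
have er g : e g y = r (e g x) \/ e g y = - r (e g x).
  rewrite /r; case: pickP => [h /eqP eh|/(_ g)]; last by rewrite eqxx.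
  have [_ _ ye _] := pr; have [[_ sc] [_ tc]] := (aut g, aut h).
  have : e g y ^+ 2 == e h y ^+ 2 by rewrite -!rmorphXn ye !rmorph_peval // eh.
  by rewrite eqf_sqr => /orP[]/eqP; [left|right].
pose l := [seq (v, r v) | v <- s] ++ [seq (v, - r v) | v <- s].
pose m := [seq (e g x, e g y) | g <- enum gT].
suff : (size m <= size l)%N.
  by rewrite size_map -cardE size_cat !size_map addnn -mul2n leqNgt ltsT.
apply: uniq_leq_size.
  rewrite map_inj_uniq ?enum_uniq // => g h [gx gy]; apply: inj.
  by apply: (rmorph_presentation_ext pr _ _ gx gy) => c; apply: (aut _).2.
move=> _ /mapP[g _ ->]; rewrite mem_cat; case: (er g) => ->; apply/orP; [left|right];
  exact: map_f.
Qed.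

Lemma slice_of_symmetric (f : {poly k}) : (size f <= 9)%N ->
  (forall x, f.[- x] = f.[x]) -> (forall x, x != 0 -> x ^+ 8 * f.[x^-1] = f.[x]) ->
  exists a b c, f = slice a b c.
Proof.
move=> s9 fN fV; have two0 : (2 : k) != 0 := natS_neq0 char0 1.
have odd0 i : odd i -> f`_i = 0.
  move=> oi; have : \poly_(i < 9) ((-1) ^+ i * f`_i) = f.
    apply: (poly_eq_off (oner_neq0 _)) => x _; rewrite -fN (horner_coef_wide _ s9) horner_poly.
    by apply: eq_bigr => j _; rewrite (exprNn x); ring.
  move/(congr1 (fun p : {poly k} => p`_i)); rewrite coef_poly.
  case: ltnP => [_|le _]; last by rewrite nth_default // (leq_trans s9).
  rewrite -signr_odd oi expr1 mulN1r => /eqP; rewrite eq_sym -addr_eq0 -mulr2n -mulr_natl.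
  by rewrite mulf_eq0 (negPf two0) => /eqP.
have rev i : (i < 9)%N -> f`_(8 - i) = f`_i.
  move=> i9; have : \poly_(i < 9) f`_(8 - i) = f.
    apply: (@poly_eq_off _ 'X); first by rewrite polyX_eq0.
    move=> x; rewrite hornerX => x0; rewrite -(fV _ x0) (horner_coef_wide _ s9) horner_poly.
    rewrite (reindex_inj rev_ord_inj) mulr_sumr; apply: eq_bigr => j _ /=.
    have j8 : (j <= 8)%N by rewrite -ltnS.
    have -> : x ^+ 8 = x ^+ (8 - j) * x ^+ j by rewrite -exprD subnK.
    rewrite subSS subKn // exprVn; have := expf_neq0 j x0.
    by move: (x ^+ j) (x ^+ (8 - j)) (f`_j) => u v w u0; field.
  by move/(congr1 (fun p : {poly k} => p`_i)); rewrite coef_poly i9.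
(* Solution of 4 (c - b) = f_2 and 8 (b + c) - 2 a = f_4. *)
exists f`_0, ((f`_4 + 2 * f`_0) / 16 - f`_2 / 8), ((f`_4 + 2 * f`_0) / 16 + f`_2 / 8).
apply/polyP => i; rewrite coef_Poly.
have o1 := odd0 1%N isT; have o3 := odd0 3%N isT; have o5 := odd0 5%N isT.
have o7 := odd0 7%N isT.
have sixteen0 : (16 : k) != 0 := natS_neq0 char0 15.
have eight0 : (8 : k) != 0 := natS_neq0 char0 7.
case: i => [|[|[|[|[|[|[|[|[|i]]]]]]]]] /=; rewrite ?o1 ?o3 ?o5 ?o7 //.
- by field; rewrite sixteen0 eight0.
- by field; rewrite sixteen0 eight0.
- by rewrite -(rev 6%N isT); field; rewrite sixteen0 eight0.
- by rewrite -(rev 8%N isT).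
by rewrite nth_nil nth_default // (leq_trans s9).
Qed.
End SliceForm.

Section SliceReduction.
Context (k : closedFieldType) (char0 : [pchar k] =i pred0).
Context (L : fieldType) (iota : {rmorphism k -> L}).

Lemma transcendental_quadratic x a b c : ~ algebraicOver iota x ->
  iota a * x ^+ 2 + iota b * x + iota c = 0 -> [/\ a = 0, b = 0 & c = 0].
Proof.
move=> tr e; have : a *: ('X * 'X) + b *: 'X + c%:P = 0.
  apply: (peval_inj tr); rewrite rmorph0 !rmorphD /= !pevalZ pevalC rmorphM /= !pevalX.
  by rewrite -expr2.
move/(congr1 (fun p : {poly k} => (p`_0, p`_1, p`_2))).
rewrite -expr2 !coefD !coefZ !coefXn !coefX !coefC /= !mulr0 !mulr1 !add0r !addr0.
by case.
Qed.

Lemma group_embedding1 (gT : finGroupType) (e : gT -> {rmorphism L -> L}) z :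
  is_group_embedding iota e -> e 1%g z = z.
Proof.
move=> [aut hom _]; apply: (fmorph_inj (e 1%g)).
by rewrite -[LHS]/((e 1%g \o e 1%g) z) -hom mulg1.
Qed.

(** By the count in [embedding_orbit], some [g] moves [x] and becomes x1 |-> -x1, and some [h] sends
    x1 outside of x1 and -x1. Commutation makes [h] an inversion after scaling. *)
Lemma slice_presentation x y f : presentation iota x y f ->
  Aut_contains iota Z2_cubed ->
  exists a b c x' y', presentation iota x' y' (slice a b c).
Proof.
move=> pr [e emb]; have [aut hom inj] := emb.
have two0 : (2 : k) != 0 := natS_neq0 char0 1.
have ee g z : e g (e g z) = z.
  by rewrite -[LHS]/((e g \o e g) z) -hom Z2_cubed_mulgg (group_embedding1 _ emb).
have eC g h z : e g (e h z) = e h (e g z).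
  by rewrite -[LHS]/((e g \o e h) z) -[RHS]/((e h \o e g) z) -!hom Z2_cubed_mulgC.
have ec g c : e g (iota c) = iota c by apply: (aut g).2.
have [g] := embedding_orbit (s := [:: x]) emb pr (etrans (congr1 (ltn 2) card_Z2_cubed) isT).
rewrite inE => gx.
have [x1 [y1 [f1 [pr1 gx1]]]] := involution_diagonal char0 pr (aut g) (ee g x) gx.
have tr1 := presentation_trans pr1.
have [h] := embedding_orbit (s := [:: x1; - x1]) emb pr1 (etrans (congr1 (ltn 4) card_Z2_cubed) isT).
rewrite !inE negb_or => /andP[hx1 hx1'].
have [a [b [c [d [det hE]]]]] :=
  coordinate_moebius char0 pr1 (automorphism_presentation pr1 (aut h)).
have q0 := iota_linear_neq0 tr1 (det_row2 det).
have q1 : iota c * (- x1) + iota d != 0.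
  by rewrite -(fmorph_eq0 (e g)) rmorphD rmorphM rmorphN !ec gx1 opprK.
have comm : (iota a * (- x1) + iota b) / (iota c * (- x1) + iota d)
    = - ((iota a * x1 + iota b) / (iota c * x1 + iota d)).
  by rewrite -hE -(rmorphN (e h)) -gx1 -eC hE fmorph_div !rmorphD !rmorphM !ec gx1.
(* Commuting with x1 |-> -x1 leaves a diagonal or an antidiagonal matrix. The diagonal one is
   excluded, since an involution would send x1 to x1 or -x1. *)
have [/eqP ac0 _ /eqP bd0] : [/\ 2 * (a * c) = 0, 0 = 0 :> k & - (2 * (b * d)) = 0].
  apply: (@transcendental_quadratic x1) => //; rewrite rmorph0 rmorphN !rmorphM rmorphMn rmorph1.
  move/(congr1 (fun z => z * ((iota c * x1 + iota d) * (iota c * (- x1) + iota d)))): comm => comm.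
  apply: (@eq_of_multiple _ (-1) _ _ _ _ comm); field.
  by rewrite q0 q1.
move: ac0 bd0; rewrite oppr_eq0 !mulf_eq0 (negPf two0) /= => ac0 bd0.
have c0 : c != 0.
  apply/negP => /eqP c0.
  have d0 : d != 0 by apply: contraNneq det => d0; rewrite c0 d0 !mulr0 subrr.
  have b0 : b = 0 by apply/eqP; case/orP: bd0; rewrite // (negPf d0).
  have id0 : iota d != 0 by rewrite fmorph_eq0.
  have hE' : e h x1 = iota (a / d) * x1.
    by rewrite hE b0 c0 rmorph0 mul0r addr0 add0r fmorph_div mulrAC.
  have := ee h x1; rewrite hE' rmorphM ec hE' => e1.
  have : (a / d) ^+ 2 == 1 ^+ 2.
    rewrite expr1n -subr_eq0; apply/eqP.
    suff e2 : iota 0 * x1 ^+ 2 + iota ((a / d) ^+ 2 - 1) * x1 + iota 0 = 0.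
      by have [_ -> _] := transcendental_quadratic tr1 e2.
    rewrite rmorph0 mul0r add0r addr0 rmorphB rmorph1 rmorphXn mulrBl mul1r expr2 -mulrA.
    by rewrite e1 subrr.
  rewrite eqf_sqr => /orP[]/eqP ad; [case/eqP: hx1|case/eqP: hx1']; rewrite hE' ad.
    by rewrite rmorph1 mul1r.
  by rewrite rmorphN rmorph1 mulN1r.
have a0 : a = 0 by apply/eqP; case/orP: ac0; rewrite ?(negPf c0).
have b0 : b != 0 by apply: contraNneq det => b0; rewrite a0 b0 !mul0r subrr.
have d0 : d = 0 by apply/eqP; case/orP: bd0; rewrite ?(negPf b0).
move: hE; rewrite a0 d0 rmorph0 mul0r add0r addr0 => hE.
have [r r2] := sqrt_exists (b / c).
have r0 : r != 0.
  by apply: contraNneq (mulf_neq0 b0 (invr_neq0 c0)) => r0; rewrite -r2 r0 expr0n.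
have det2 : 1 * r - 0 * 0 != 0 by rewrite mul1r mul0r subr0.
have [y2 [f2]] := presentation_moebius_inv pr1 det2.
have x10 : x1 != 0.
  by have := @iota_linear_neq0 _ _ _ x1 1 0 tr1; rewrite oner_neq0 rmorph0 addr0 rmorph1 mul1r; apply.
have ir0 : iota r != 0 by rewrite fmorph_eq0.
have -> : (iota 1 * x1 + iota 0) / (iota 0 * x1 + iota r) = x1 / iota r.
  by rewrite rmorph1 rmorph0 mul1r mul0r addr0 add0r.
set x2 := x1 / iota r => pr2.
have x20 : x2 != 0 by rewrite mulf_neq0 ?invr_neq0.
have gx2 : e g x2 = - x2 by rewrite fmorph_div ec gx1 mulNr.
have hx2 : e h x2 = x2^-1.
  have ic0 : iota c != 0 by rewrite fmorph_eq0.
  rewrite /x2 fmorph_div ec hE invf_div.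
  have rb : iota r ^+ 2 = iota b / iota c by rewrite -rmorphXn r2 fmorph_div.
  have -> : iota b / (iota c * x1) / iota r = iota b / iota c / (x1 * iota r).
    by field; rewrite ir0 x10 ic0.
  by rewrite -rb; field; rewrite ir0 x10.
have tr2 := presentation_trans pr2; have [gf2 _ _ _] := pr2; have [s9 _] := gf2.
have y20 : y2 != 0.
  apply: contraNneq (good_octic_neq0 gf2) => y20; have [_ _ ye _] := pr2.
  by rewrite -(peval_eq0 _ tr2) -ye y20 expr0n.
clear - pr2 gx2 hx2 tr2 s9 ee ec char0 aut x20 y20.
have fN z : f2.[- z] = f2.[z].
  have [a [b [c [d [t [det t0 gE gy fE]]]]]] :=
    presentation_unique char0 pr2 (automorphism_presentation pr2 (aut g)).
  have q0 := iota_linear_neq0 tr2 (det_row2 det).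
  have [c0 ad b0] : [/\ c = 0, a + d = 0 & b = 0].
    apply: (transcendental_quadratic tr2); move: gE; rewrite gx2 => gE.
    have := congr1 (fun z => z * (iota c * x2 + iota d)) gE; rewrite divfK // => gE'.
    by apply: (@eq_of_multiple _ (-1) _ _ _ _ gE'); rewrite rmorphD; ring.
  have a0 : a = - d by apply/eqP; rewrite -addr_eq0 ad.
  have d0 : d != 0 by apply: contraNneq det => d0; rewrite c0 b0 d0 !mulr0 subrr.
  have id0 : iota d != 0 by rewrite fmorph_eq0.
  have gyE : e g y2 = iota (t / d ^+ 4) * y2.
    by rewrite gy c0 rmorph0 mul0r add0r fmorph_div rmorphXn /= mulrAC.
  (* The lift itself has order 2, not only its action on the line. A lift of order 4 would give
     f(-x) = -f(x). *)
  have t2 : (t / d ^+ 4) ^+ 2 = 1.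
    apply: (fmorph_inj iota); rewrite rmorph1 rmorphXn; apply: (mulIf y20).
    by rewrite mul1r -[RHS](ee g) gyE rmorphM ec gyE mulrA -expr2.
  move: fE => /(congr1 (fun p : {poly k} => p.[z])).
  rewrite horner_moebius_sub // ?c0 ?mul0r ?add0r // hornerZ b0 addr0 a0.
  have -> : - d * z / d = - z by field.
  move=> e1; apply: (mulfI (expf_neq0 8 d0)); rewrite e1 -[t in LHS](divfK (expf_neq0 4 d0)).
  by rewrite exprMn t2; ring.
have fV z : z != 0 -> z ^+ 8 * f2.[z^-1] = f2.[z].
  move=> z0.
  have [a [b [c [d [t [det t0 hE hy fE]]]]]] :=
    presentation_unique char0 pr2 (automorphism_presentation pr2 (aut h)).
  have q0 := iota_linear_neq0 tr2 (det_row2 det).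
  have [a0 bc d0] : [/\ a = 0, b - c = 0 & - d = 0].
    apply: (transcendental_quadratic tr2); move: hE; rewrite hx2 => hE.
    have := congr1 (fun z => z * (iota c * x2 + iota d) * x2) hE; rewrite divfK // => hE'.
    by apply: (@eq_of_multiple _ (-1) _ _ _ _ hE'); rewrite rmorphN rmorphB; field.
  have {}bc : b = c by apply/eqP; rewrite -subr_eq0 bc.
  have {}d0 : d = 0 by apply/eqP; rewrite -oppr_eq0 d0.
  have c0 : c != 0 by apply: contraNneq det => c0; rewrite bc c0 a0 !mul0r subrr.
  have ic0 : iota c != 0 by rewrite fmorph_eq0.
  have hyE : e h y2 = iota (t / c ^+ 4) * (y2 / x2 ^+ 4).
    rewrite hy d0 rmorph0 addr0 fmorph_div rmorphXn /=; field.
    by rewrite x20 ic0.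
  have t2 : (t / c ^+ 4) ^+ 2 = 1.
    move: hyE; move: (t / c ^+ 4) => T hyE.
    apply: (fmorph_inj iota); rewrite rmorph1 rmorphXn; apply: (mulIf y20).
    rewrite mul1r -[RHS](ee h) hyE rmorphM ec fmorph_div rmorphXn hx2 hyE /=.
    by field; rewrite x20 oner_neq0.
  move: fE => /(congr1 (fun p : {poly k} => p.[z])).
  have q1 : c * z + d != 0 by rewrite d0 addr0 mulf_neq0.
  rewrite horner_moebius_sub // hornerZ d0 addr0 a0 mul0r add0r bc.
  have -> : c / (c * z) = z^-1 by field; rewrite z0 c0.
  move=> e1; apply: (mulfI (expf_neq0 8 c0)); rewrite mulrA -exprMn e1.
  by rewrite -[t in LHS](divfK (expf_neq0 4 c0)) exprMn t2; ring.
have [a [b [c fE]]] := slice_of_symmetric char0 s9 fN fV.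
by exists a, b, c, x2, y2; rewrite -fE.
Qed.

End SliceReduction.

(** * Equivalence of octics and descent *)

(* In the coordinate of this octic the fixed points of the three involutions of
   the reduced group are the zeros of quadratics [za, zb, zc] that are permuted
   with [a, b, c] (see [horner_descent_octic]); so its coefficients are symmetric
   functions of [a, b, c]. *)
Definition descent_octic (R : comNzRingType) (e1 e2 e3 : R) : {poly R} :=
  Poly [::
    e1 ^+ 2 * e3 ^+ 4 - 3 * e2 * e3 ^+ 4;
    16 * e2 ^+ 2 * e3 ^+ 3 - 4 * e1 ^+ 2 * e2 * e3 ^+ 3 - 12 * e1 * e3 ^+ 4;
    12 * e1 ^+ 3 * e3 ^+ 3 + 4 * e1 ^+ 2 * e2 ^+ 2 * e3 ^+ 2 + 144 * e3 ^+ 4 - 40 * e1 * e2 * e3 ^+ 3 - 16 * e2 ^+ 3 * e3 ^+ 2;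
    28 * e1 ^+ 2 * e3 ^+ 3 + 112 * e1 * e2 ^+ 2 * e3 ^+ 2 - 28 * e1 ^+ 3 * e2 * e3 ^+ 2 - 336 * e2 * e3 ^+ 3;
    38 * e1 ^+ 4 * e3 ^+ 2 + 8 * e1 ^+ 3 * e2 ^+ 2 * e3 + 204 * e1 * e3 ^+ 3 + 280 * e2 ^+ 2 * e3 ^+ 2 - 206 * e1 ^+ 2 * e2 * e3 ^+ 2 - 32 * e1 * e2 ^+ 3 * e3;
    160 * e1 ^+ 2 * e2 ^+ 2 * e3 + 80 * e1 * e2 * e3 ^+ 2 - 28 * e1 ^+ 4 * e2 * e3 - 52 * e1 ^+ 3 * e3 ^+ 2 - 192 * e2 ^+ 3 * e3 - 288 * e3 ^+ 3;
    12 * e1 ^+ 5 * e3 + 4 * e1 ^+ 4 * e2 ^+ 2 + 88 * e1 ^+ 2 * e3 ^+ 2 + 64 * e2 ^+ 4 + 96 * e2 * e3 ^+ 2 - 32 * e1 ^+ 3 * e2 * e3 - 32 * e1 ^+ 2 * e2 ^+ 3 - 64 * e1 * e2 ^+ 2 * e3;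
    32 * e1 ^+ 3 * e2 ^+ 2 + 96 * e1 ^+ 2 * e2 * e3 + 64 * e2 ^+ 2 * e3 - 4 * e1 ^+ 5 * e2 - 28 * e1 ^+ 4 * e3 - 64 * e1 * e2 ^+ 3 - 192 * e1 * e3 ^+ 2;
    e1 ^+ 6 + 28 * e1 ^+ 3 * e3 + 8 * e1 ^+ 2 * e2 ^+ 2 + 16 * e2 ^+ 3 + 144 * e3 ^+ 2 - 7 * e1 ^+ 4 * e2 - 112 * e1 * e2 * e3].

Section OcticEquivalence.
Context (k : closedFieldType) (char0 : [pchar k] =i pred0).

Definition octic_equiv (f g : {poly k}) := exists a b c d e,
  [/\ a * d - b * c != 0, e != 0 & octic_subst a b c d f = e *: g].

Lemma octic_equiv_genus3 (L : fieldType) (iota : {rmorphism k -> L}) f g :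
  octic_equiv f g -> genus3_equation iota f -> genus3_equation iota g.
Proof.
move=> [a [b [c [d [e [det e0 fg]]]]]] /genus3_equationP[x [y pr]].
have [x' [y' [pr' _ _]]] := presentation_moebius pr det e0 fg.
by apply/genus3_equationP; exists x', y'.
Qed.

Lemma octic_equiv_good f g : octic_equiv f g -> good_octic f -> good_octic g.
Proof. by move=> [a [b [c [d [e [det e0 fg]]]]]]; apply: good_octic_sub fg. Qed.

Lemma octic_equiv_trans (f g h : {poly k}) : (size f <= 9)%N ->
  octic_equiv f g -> octic_equiv g h -> octic_equiv f h.
Proof.
move=> s9 [a [b [c [d [e [det e0 fg]]]]]] [a' [b' [c' [d' [e' [det' e'0 gh]]]]]].
exists (a * a' + b * c'), (a * b' + b * d'), (c * a' + d * c'), (c * b' + d * d'), (e * e').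
split; [|exact: mulf_neq0|].
  suff -> : (a * a' + b * c') * (c * b' + d * d') - (a * b' + b * d') * (c * a' + d * c')
    = (a * d - b * c) * (a' * d' - b' * c') by rewrite mulf_neq0.
  by ring.
rewrite -[LHS]/(moebius_sub 8 _ _ _ _ _) -moebius_sub_comp //.
rewrite -[moebius_sub 8 a b c d f]/(octic_subst a b c d f) fg moebius_subZ.
by rewrite -[moebius_sub _ _ _ _ _ _]/(octic_subst a' b' c' d' g) gh scalerA.
Qed.

Lemma genus3_equation_unique (L : fieldType) (iota : {rmorphism k -> L}) f g :
  genus3_equation iota f -> genus3_equation iota g -> octic_equiv f g.
Proof.
move=> /genus3_equationP[x [y pr]] /genus3_equationP[x' [y' pr']].
have [a [b [c [d [e [det e0 _ _ fg]]]]]] := presentation_unique char0 pr' pr.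
by exists a, b, c, d, (e ^+ 2); rewrite expf_neq0.
Qed.

(** The map X |-> (X + i) / (X - i) has order 3 and permutes cyclically the fixed-point pairs of the
    three involutions: 0 and infinity, 1 and -1, i and -i. *)
Lemma slice_cycle (a b c : k) : octic_equiv (slice a b c) (slice c a b).
Proof.
have [i i2] := imaginary_exists k.
have two0 : (2 : k) != 0 := natS_neq0 char0 1.
have i0 : i != 0.
  by apply: contraTneq (oner_neq0 k) => i0; rewrite -[1]opprK -i2 i0 expr0n oppr0 eqxx.
have det : 1 * (- i) - i * 1 != 0.
  by rewrite mul1r mulr1 -opprD oppr_eq0 -mulr2n -mulr_natl mulf_neq0.
exists 1, i, 1, (- i), 16; split=> //; first exact: (natS_neq0 char0 15).
apply: octic_subst_eq => // [|x q0]; first exact: size_slice.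
rewrite !horner_slice.
by field: i2; move: q0; rewrite mul1r.
Qed.

Lemma slice_scale (t a b c : k) : slice (t * a) (t * b) (t * c) = t *: slice a b c.
Proof.
by apply: (poly_eq_off (oner_neq0 _)) => x _; rewrite hornerZ !horner_slice; ring.
Qed.

Lemma slice_good_neq0 (a b c : k) : good_octic (slice a b c) -> a != 0.
Proof.
move=> gf; apply: contraTneq (good_octic_size gf) => a0; rewrite -leqNgt.
by apply/leq_sizeP => -[|[|[|[|[|[|[|[|[|j]]]]]]]]] // _; rewrite coef_Poly a0 /= ?nth_nil.
Qed.

(** One sixteenth of the discriminant of the quadratic G; in symmetric functions it is e1^2 - 4
    e2. *)
Definition slice_disc (R : comNzRingType) (a b c : R) : R :=
  a ^+ 2 + b ^+ 2 + c ^+ 2 - 2 * (a * b + a * c + b * c).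

Lemma slice_goodP (a b c : k) : good_octic (slice a b c) <->
  [/\ a != 0, b != 0, c != 0 & slice_disc a b c != 0].
Proof.
split=> [gf|[a0 b0 c0 D0]].
  have g1 := octic_equiv_good (slice_cycle a b c) gf.
  have a0 := slice_good_neq0 gf; split=> //.
  - exact: slice_good_neq0 (octic_equiv_good (slice_cycle c a b) g1).
  - exact: slice_good_neq0 g1.
  apply/eqP => D0; have [r r2] := sqrt_exists a.
  (* When G has a double root, [a] times the octic is the square of a X^4 + 2 (c - b) X^2 + a. *)
  have [] := @good_octic_not_square _ _ (a *: 'X^4 + (2 * (c - b)) *: 'X^2 + a%:P) (r%:P) gf.
    apply: (poly_eq_off (oner_neq0 _)) => x _; rewrite [in RHS]hornerM horner_slice !expr2 !hornerE.
    apply: (@eq_of_multiple _ (4 * x ^+ 4) _ _ _ _ D0); rewrite -(expr2 r) r2 /slice_disc /=; ring.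
  by move=> _ /eqP; rewrite polyC_eq0 => /eqP r0; case/eqP: a0; rewrite -r2 r0 expr0n.
apply/good_octicP; have s9 : size (slice a b c) = 9%N.
  by rewrite (PolyK (c := a)) //= a0.
rewrite s9 eqxx orbT separable_poly.unlock; split=> //.
apply/Pdiv.ClosedField.coprimepP => x; rewrite rootE => /eqP rx; apply/eqP => dx.
have dE : (slice a b c)^`().[x] = 8 * a * x ^+ 7 + 4 * (c - b) * (6 * x ^+ 5 + 2 * x)
    + 4 * (8 * (b + c) - 2 * a) * x ^+ 3.
  have s8 : (size (slice a b c)^`() <= 8)%N by rewrite -ltnS (leq_trans (lt_size_deriv _)) ?s9 // -size_poly_gt0 s9.
  rewrite (horner_coef_wide _ s8) !big_ord_recr big_ord0 /= !coef_deriv !coef_Poly /=.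
  by ring.
have two0 : (2 : k) != 0 := natS_neq0 char0 1.
move: rx dx; rewrite horner_slice dE => rx dx.
have x0 : x != 0.
  apply: contraNneq a0 => x0; apply/eqP; rewrite -rx x0; ring.
(* The combination 4 f - x f' is, up to powers of x and sign, the derivative of G(t) with respect to
   x. So a multiple root lies over a branch point x^4 = 1, where f equals 16 c or 16 b, or over a
   double root of G. *)
have : 4 * ((1 - x ^+ 4) * (a * (1 + x ^+ 4) + 2 * (c - b) * x ^+ 2)) = 0.
  transitivity (4 * 0 - x * 0 : k); last by rewrite !mulr0 subrr.
  by rewrite -{1}rx -dx; ring.
move/eqP; rewrite mulf_eq0 (negPf (natS_neq0 char0 3 : (4 : k) != 0)) /= mulf_eq0.
case/orP => /eqP e.
  have : (1 - x ^+ 2) * (1 + x ^+ 2) = 0 by rewrite -e; ring.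
  move/eqP; rewrite mulf_eq0 => /orP[]/eqP e2.
    have x2 : x ^+ 2 = 1 by apply/eqP; rewrite eq_sym -subr_eq0 e2.
    case/eqP: (mulf_neq0 (natS_neq0 char0 15) c0); rewrite -rx.
    rewrite -[8%N]/(2 * 4)%N -[6%N]/(2 * 3)%N -[4%N]/(2 * 2)%N !exprM x2; ring.
  have x2 : x ^+ 2 = -1 by apply/eqP; rewrite -addr_eq0 addrC e2.
  case/eqP: (mulf_neq0 (natS_neq0 char0 15) b0); rewrite -rx.
  rewrite -[8%N]/(2 * 4)%N -[6%N]/(2 * 3)%N -[4%N]/(2 * 2)%N !exprM x2; ring.
case/eqP: (mulf_neq0 (mulf_neq0 (natS_neq0 char0 3 : (4 : k) != 0) (expf_neq0 4 x0)) D0).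
transitivity ((a * (1 + x ^+ 4) + 2 * (c - b) * x ^+ 2) ^+ 2 - a * 0).
  by rewrite -rx /slice_disc; ring.
by rewrite e mulr0 subr0 expr0n.
Qed.

Lemma slice_normal_form (u v : k) :
  slice 16 (v + 4 - 2 * u) (v + 4 + 2 * u) = 16 *: normal_form u v.
Proof.
apply: (poly_eq_off (oner_neq0 _)) => x _.
by rewrite hornerZ horner_slice /normal_form !hornerE /=; ring.
Qed.

(** Scaling X by a square root of [u] turns the coefficients 1, u, v + 2, u, 1 into u^4, u^4, (v +
    2) u^2, u^2, 1. *)
Lemma normal_form_dihedral (u v : k) : u != 0 ->
  octic_equiv (normal_form u v)
    (dihedral_equation (dihedral_s2 u (v + 2) u) (dihedral_s3 u (v + 2) u)).
Proof.
move=> u0; have two0 : (2 : k) != 0 := natS_neq0 char0 1.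
have [r r2] := sqrt_exists u.
have r0 : r != 0 by apply: contraNneq u0 => r0; rewrite -r2 r0 expr0n.
exists r, 0, 0, 1, 1; rewrite mulr1 mul0r subr0 r0 oner_neq0; split=> //.
have s9 : (size (normal_form u v) <= 9)%N.
  have := size_slice 16 (v + 4 - 2 * u) (v + 4 + 2 * u).
  by rewrite slice_normal_form size_scale // (natS_neq0 char0 15).
apply: octic_subst_eq => // [|x _]; first by rewrite mulr1 mul0r subr0.
rewrite mul0r add0r expr1n divr1 addr0 !mul1r /normal_form /dihedral_equation.
rewrite !hornerE /= /dihedral_s2 /dihedral_s3 -r2; field.
by [].
Qed.

(** The quadratics 2 x y, x^2 - y^2 and x^2 + y^2 vanish at the fixed points of X |-> -X, 1/X and
    -1/X. Through their squares the three involutions play parallel roles. *)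
Lemma slice_factor (a b c x y : k) : y != 0 ->
  y ^+ 8 * (slice a b c).[x / y] = a * (x ^+ 2 + y ^+ 2) ^+ 2 * (x ^+ 2 - y ^+ 2) ^+ 2
    - b * (2 * x * y) ^+ 2 * (x ^+ 2 - y ^+ 2) ^+ 2
    + c * (x ^+ 2 + y ^+ 2) ^+ 2 * (2 * x * y) ^+ 2.
Proof. by move=> y0; rewrite horner_slice; field. Qed.

Lemma horner_descent_octic (a b c x : k) :
  let za := (a - b - c) * x ^+ 2 + 2 * b * c * x - a * b * c in
  let zb := (b - a - c) * x ^+ 2 + 2 * a * c * x - a * b * c in
  let zc := (c - a - b) * x ^+ 2 + 2 * a * b * x - a * b * c in
  (descent_octic (a + b + c) (a * b + a * c + b * c) (a * b * c)).[x] =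
  (a - b) * (a - c) * zb ^+ 2 * zc ^+ 2 - (b - c) * (a - b) * za ^+ 2 * zc ^+ 2
  + (a - c) * (b - c) * za ^+ 2 * zb ^+ 2.
Proof. by rewrite horner_Poly /=; ring. Qed.

(** The quadratics of [slice_factor] satisfy (x^2 + y^2)^2 = (x^2 - y^2)^2 + (2 x y)^2, a
    parametrized conic. The products [rb * zb], [rc * zc], [ra * za] satisfy the same relation, so
    they come, up to the factor [ka], from linear forms U and V. *)
Lemma slice_descent (a b c : k) : a != 0 -> b != 0 -> c != 0 ->
  a != b -> b != c -> c != a ->
  octic_equiv (slice a b c) (descent_octic (a + b + c) (a * b + a * c + b * c) (a * b * c)).
Proof.
move=> a0 b0 c0 ab bc ca; have two0 : (2 : k) != 0 := natS_neq0 char0 1.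
have [ra ra2] := sqrt_exists (a * (b - c)).
have [rb rb2] := sqrt_exists (b * (a - c)).
have [rc rc2] := sqrt_exists (c * (a - b)).
have ra0 : ra != 0.
  by apply: contraNneq (mulf_neq0 a0 (_ : b - c != 0)) => [r0|]; rewrite ?subr_eq0 // -ra2 r0 expr0n.
have rb0 : rb != 0.
  apply: contraNneq (mulf_neq0 b0 (_ : a - c != 0)) => [r0|]; rewrite ?subr_eq0 1?eq_sym //.
  by rewrite -rb2 r0 expr0n.
have rc0 : rc != 0.
  by apply: contraNneq (mulf_neq0 c0 (_ : a - b != 0)) => [r0|]; rewrite ?subr_eq0 // -rc2 r0 expr0n.
have rel : (rb + rc) * (rb - rc) = ra ^+ 2.
  by transitivity (rb ^+ 2 - rc ^+ 2); [ring | rewrite ra2 rb2 rc2; ring].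
have bc0 : rb + rc != 0.
  by apply: contraNneq (expf_neq0 2 ra0) => e; rewrite -rel e mul0r.
have bcm0 : rb - rc != 0.
  by apply: contraNneq (expf_neq0 2 ra0) => e; rewrite -rel e mulr0.
pose al := - (rb / b + rc / c); pose be := rb + rc.
pose ga := - (rb / b - rc / c) * ((rb + rc) / ra); pose de := (rb - rc) * ((rb + rc) / ra).
pose ka := - 2 * (rb + rc) / (a * b * c).
exists al, be, ga, de, (ka ^+ 4 * (a * b * c)).
have det : al * de - be * ga != 0.
  have -> : al * de - be * ga = 2 * rb * rc * (c - b) * ((rb + rc) / ra) / (b * c).
    by rewrite /al /be /ga /de; field; rewrite ra0 b0 c0.
  by rewrite !mulf_neq0 ?invr_neq0 ?mulf_neq0 // subr_eq0 eq_sym.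
split=> //; first by rewrite /ka !mulf_neq0 ?expf_neq0 ?mulf_neq0 ?oppr_eq0 ?invr_neq0 ?mulf_neq0.
apply: octic_subst_eq => // [|x q0]; first exact: size_slice.
rewrite slice_factor //.
set U := al * x + be; set V := ga * x + de.
pose za := (a - b - c) * x ^+ 2 + 2 * b * c * x - a * b * c.
pose zb := (b - a - c) * x ^+ 2 + 2 * a * c * x - a * b * c.
pose zc := (c - a - b) * x ^+ 2 + 2 * a * b * x - a * b * c.
(* For both signs of [q] the quadratic [p * zb + q * zc] is a multiple of a perfect square; this
   yields U^2 and V^2. *)
have sq p q : p ^+ 2 = b * (a - c) -> q ^+ 2 = c * (a - b) ->
    (- (p / b + q / c) * x + (p + q)) ^+ 2 = - (p + q) / (a * b * c) * (p * zb + q * zc).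
  move=> p2 q2; apply/eqP; rewrite -subr_eq0; apply/eqP.
  transitivity (x ^+ 2 * (p ^+ 2 * (b ^- 2 + (b - a - c) / (a * b * c))
      + q ^+ 2 * (c ^- 2 + (c - a - b) / (a * b * c)))).
    by rewrite /zb /zc; field; rewrite a0 b0 c0.
  by rewrite p2 q2; field; rewrite a0 b0 c0.
have U2 : U ^+ 2 = - (rb + rc) / (a * b * c) * (rb * zb + rc * zc) := sq rb rc rb2 rc2.
pose W := - (rb / b - rc / c) * x + (rb - rc).
have VW : V = (rb + rc) / ra * W by rewrite /V /W /ga /de; ring.
have V2 : V ^+ 2 = - (rb + rc) / (a * b * c) * (rb * zb - rc * zc).
  have := sq rb (- rc) rb2; rewrite sqrrN [- rc / c]mulNr [- rc * zc]mulNr -/W => /(_ rc2) W2.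
  by rewrite VW exprMn W2 expr_div_n -rel; field; rewrite a0 b0 c0 bc0 bcm0.
have UV : U * V = - (rb + rc) / (a * b * c) * (ra * za).
  have UW : U * W = rb ^+ 2 * (1 - x / b) ^+ 2 - rc ^+ 2 * (1 - x / c) ^+ 2.
    by rewrite /U /W /al /be; field; rewrite b0 c0.
  rewrite VW mulrCA UW rb2 rc2.
  transitivity ((rb + rc) / ra * (- ra ^+ 2 * za / (a * b * c))).
    by rewrite ra2 /za; field; rewrite a0 b0 c0 ra0.
  by field; rewrite a0 b0 c0 ra0.
have EP : U ^+ 2 + V ^+ 2 = ka * (rb * zb) by rewrite U2 V2 /ka; field; rewrite a0 b0 c0.
have EM : U ^+ 2 - V ^+ 2 = ka * (rc * zc) by rewrite U2 V2 /ka; field; rewrite a0 b0 c0.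
have EN : 2 * U * V = ka * (ra * za) by rewrite -mulrA UV /ka; field; rewrite a0 b0 c0.
rewrite EP EM EN horner_descent_octic -/za -/zb -/zc.
transitivity (ka ^+ 4 * (a * (rb ^+ 2 * rc ^+ 2) * zb ^+ 2 * zc ^+ 2
  - b * (ra ^+ 2 * rc ^+ 2) * za ^+ 2 * zc ^+ 2 + c * (ra ^+ 2 * rb ^+ 2) * za ^+ 2 * zb ^+ 2)).
  by ring.
by rewrite ra2 rb2 rc2; ring.
Qed.

End OcticEquivalence.

(** * The dihedral equation *)

Section Admissible.
Context (k : fieldType) (char0 : [pchar k] =i pred0).

(* The vanishing loci of [u^2 - 4], [v + 2] and [s3 - 4] on the slice octic with
   coefficients [a, b, c]. *)
Definition locL (a b c : k) := 4 * (b - c) ^+ 2 - a ^+ 2.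
Definition locM (a b c : k) := 4 * (b + c) - a.
Definition locN (a b c : k) := 16 * (b - c) ^+ 2 * (4 * (b + c) - a) - a ^+ 3.
Definition inadmissible (a b c : k) := [|| locL a b c == 0, locM a b c == 0 | locN a b c == 0].

Lemma locLC a b c : locL a b c = locL a c b. Proof. by rewrite /locL; ring. Qed.
Lemma locMC a b c : locM a b c = locM a c b. Proof. by rewrite /locM; ring. Qed.
Lemma locNC a b c : locN a b c = locN a c b. Proof. by rewrite /locN; ring. Qed.
Lemma cancel_factor (m x z : k) : m != 0 -> m * x = z -> z = 0 -> x = 0.
Proof. by move=> m0 <- /eqP; rewrite mulf_eq0 (negPf m0) => /eqP. Qed.

(** Shape of the elimination certificates below: a combination of vanishing forms equals an integer
    times a power of a nonzero element. Characteristic zero keeps the integers nonzero. *)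
Lemma absurd_certificate (m x : k) n z : m != 0 -> x != 0 -> m * x ^+ n = z -> z = 0 -> False.
Proof.
by move=> m0 x0 <- /eqP; rewrite mulf_eq0 (negPf m0) expf_eq0 (negPf x0) andbF.
Qed.

Ltac natr_neq0_tac :=
  rewrite -?(natrM, natrD); move/pcharf0P: char0 => ->; rewrite ?addn_eq0 ?andbF.

Lemma locLL a b c : c != 0 -> a != b -> locL a b c = 0 -> locL b c a = 0 ->
  inadmissible c a b = false.
Proof.
move=> c0 ab La Lb; have ab0 : b - a != 0 by rewrite subr_eq0 eq_sym.
have e : 5 * (a + b) - 8 * c = 0.
  apply: (cancel_factor ab0 (z := locL a b c - locL b c a)); last by rewrite La Lb subrr.
  by rewrite /locL; ring.
(* The relation 5 (a + b) = 8 c is parametrized by c = 5 s and a + b = 8 s. *)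
have [s cE] : exists s, c = 5 * s by exists (c / 5); field; exact: (natS_neq0 char0 4).
have aE : a = 8 * s - b.
  apply: (mulfI (natS_neq0 char0 4)); apply/eqP; rewrite -subr_eq0; apply/eqP.
  by rewrite -[RHS]e cE; ring.
have s0 : s != 0 by apply: contraNneq c0 => s0; rewrite cE s0 mulr0.
move: La; rewrite aE cE => La; apply/negbTE/negP => /or3P[]/eqP Fc.
- apply: (@absurd_certificate 117 s 2
    (- 16 * locL (8 * s - b) b (5 * s) +
     3 * locL (5 * s) (8 * s - b) b)) => //.
  + by natr_neq0_tac.
  + by rewrite /locL; ring.
  + by rewrite La Fc !mulr0 addr0.
- apply: (@absurd_certificate 27 s 1
    (0 * locL (8 * s - b) b (5 * s) +
     1 * locM (5 * s) (8 * s - b) b)) => //.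
  + by natr_neq0_tac.
  + by rewrite /locL /locM; ring.
  + by rewrite La Fc !mulr0 addr0.
- apply: (@absurd_certificate (6 * 1000 + 787) s 3
    ((- 576 * s) * locL (8 * s - b) b (5 * s) +
     1 * locN (5 * s) (8 * s - b) b)) => //.
  + by natr_neq0_tac.
  + by rewrite /locL /locN; ring.
  + by rewrite La Fc !mulr0 addr0.
Qed.

Lemma locMM a b c : a != b -> locM a b c = 0 -> locM b c a = 0 -> False.
Proof.
move=> ab Ma Mb; move: ab; rewrite -subr_eq0; apply/negP/negPn/eqP.
apply: (cancel_factor (natS_neq0 char0 4) (z := locM b c a - locM a b c)).
  by rewrite /locM; ring.
by rewrite Ma Mb subrr.
Qed.

Lemma locM_eq a b c : locM c a b = 0 -> c = 4 * (a + b).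
Proof. by move/eqP; rewrite subr_eq0 => /eqP. Qed.

(** For c = 4 (a + b) the two other equations become binary forms in [a] and [b], and the cofactors
    are those of a Bezout identity for a multiple of a^4. *)
Lemma locLMN a b c : a != 0 -> locL a b c = 0 -> locN b c a = 0 -> locM c a b = 0 -> False.
Proof.
move=> a0 + + /locM_eq cE; rewrite cE => La Nb.
apply: (@absurd_certificate ((208 * 1000 + 351) * 1000 + 737) a 4
  ((- ((470 * 1000 + 483) * 1000 + 1) * a ^+ 2 - (((1 * 1000 + 235) * 1000 + 521) * 1000 + 888) * b * a - ((778 * 1000 + 349) * 1000 + 572) * b ^+ 2) * locL a b (4 * (a + b)) +
   (((10 * 1000 + 364) * 1000 + 160) * a + ((7 * 1000 + 298) * 1000 + 928) * b) * locN b (4 * (a + b)) a)) => //.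
- by natr_neq0_tac.
- by rewrite /locL /locN; ring.
- by rewrite La Nb !mulr0 addr0.
Qed.

Lemma locMNN a b c : a != 0 -> a != b -> locN a b c = 0 -> locN b c a = 0 ->
  locM c a b = 0 -> False.
Proof.
move=> a0 ab + + /locM_eq cE; rewrite cE => Na Nb.
(* The two cubic forms are exchanged by swapping [a] and [b], so [a - b] divides their
   difference. *)
have r0 : 959 * (a + b) ^+ 2 + 81 * (a * b) = 0.
  apply: (cancel_factor (_ : a - b != 0)
    (z := locN a b (4 * (a + b)) - locN b (4 * (a + b)) a)); first by rewrite subr_eq0.
    by rewrite /locN; ring.
  by rewrite Na Nb subrr.
apply: (@absurd_certificate (175 * 1000 + 41) a 4
  ((- ((4 * 1000 + 640) * 1000 + 560) * a ^+ 2 - ((7 * 1000 + 471) * 1000 + 680) * b * a - ((2 * 1000 + 995) * 1000 + 200) * b ^+ 2) * (959 * (a + b) ^+ 2 + 81 * (a * b)) +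
   (((1 * 1000 + 159) * 1000 + 279) * a + (997 * 1000 + 360) * b) * locN a b (4 * (a + b)))) => //.
- by natr_neq0_tac.
- by rewrite /locN; ring.
- by rewrite r0 Na !mulr0 addr0.
Qed.

(** The hypothesis on [a] is one of the two linear factors of [locL a b c]; exchanging [b] and [c]
    gives the other. *)
Lemma locLNN a b c : c != 0 -> a = 2 * (b - c) -> locN b c a = 0 -> locN c a b = 0 -> False.
Proof.
move=> c0 -> Nb Nc.
apply: (@absurd_certificate ((((2 * 1000 + 318) * 1000 + 340) * 1000 + 778) * 1000 + 709) c 5
  (((((11 * 1000 + 655) * 1000 + 514) * 1000 + 176) * c ^+ 2 + (((83 * 1000 + 399) * 1000 + 68) * 1000 + 416) * b * c - (((40 * 1000 + 481) * 1000 + 842) * 1000 + 176) * b ^+ 2) * locN b c (2 * (b - c)) +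
   (- (((15 * 1000 + 653) * 1000 + 235) * 1000 + 605) * c ^+ 2 - (((83 * 1000 + 839) * 1000 + 894) * 1000 + 80) * b * c + (((94 * 1000 + 246) * 1000 + 788) * 1000 + 816) * b ^+ 2) * locN c (2 * (b - c)) b)) => //.
- by natr_neq0_tac.
- by rewrite /locN; ring.
- by rewrite Nb Nc !mulr0 addr0.
Qed.

(** The alternating sum of the three cubics is antisymmetric, hence the Vandermonde product times
    112 e1. Once e1 = 0, a difference of two of them gives e2 = 0, and the discriminant is e1^2 - 4
    e2. *)
Lemma locNNN a b c : a != b -> b != c -> c != a ->
  locN a b c = 0 -> locN b c a = 0 -> locN c a b = 0 -> slice_disc a b c = 0.
Proof.
move=> ab bc ca Na Nb Nc.
have ab0 : a - b != 0 by rewrite subr_eq0.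
have bc0 : b - c != 0 by rewrite subr_eq0.
have ca0 : c - a != 0 by rewrite subr_eq0.
have e1 : a + b + c = 0.
  apply: (cancel_factor (natS_neq0 char0 112)
    (z := (locN a b c * (b - c) + locN b c a * (c - a) + locN c a b * (a - b))
      / ((a - b) * (b - c) * (c - a)))).
    by rewrite /locN; field; rewrite ab0 bc0 ca0.
  by rewrite Na Nb Nc !(mul0r, add0r).
have cE : c = - (a + b) by apply/eqP; rewrite -addr_eq0 addrC e1.
have e2 : a * b + a * c + b * c = 0.
  apply: (cancel_factor (mulf_neq0 (natS_neq0 char0 80) ab0) (z := locN a b c - locN b c a)).
    by rewrite /locN cE; ring.
  by rewrite Na Nb subrr.
transitivity ((a + b + c) ^+ 2 - 4 * (a * b + a * c + b * c)); first by rewrite /slice_disc; ring.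
by rewrite e1 e2 mulr0 subr0 expr0n.
Qed.

Lemma locLNN' a b c : b != 0 -> c != 0 -> locL a b c = 0 -> locN b c a = 0 ->
  locN c a b = 0 -> False.
Proof.
move=> b0 c0 La Nb Nc.
have : (2 * (b - c)) ^+ 2 == a ^+ 2 by rewrite -subr_eq0 -La; apply/eqP; rewrite /locL; ring.
rewrite eqf_sqr => /orP[]/eqP e; first by apply: (locLNN (a := a) c0 _ Nb Nc).
apply: (@locLNN a c b b0) => //; last by rewrite locNC.
  by rewrite -[a]opprK -e; ring.
by rewrite locNC.
Qed.

(** Otherwise each rearrangement lies on one of L, M, N. Two L's make the third rearrangement
    admissible and two M's identify two parameters. Up to order, L M N, L N N, M N N and N N N
    remain, and the elimination lemmas exclude them. *)
Lemma admissible_exists a b c : a != 0 -> b != 0 -> c != 0 ->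
  a != b -> b != c -> c != a -> slice_disc a b c != 0 ->
  [|| ~~ inadmissible a b c, ~~ inadmissible b c a | ~~ inadmissible c a b].
Proof.
move=> a0 b0 c0 ab bc ca D0; rewrite -!negb_and; apply/negP => /and3P[Ba Bb Bc].
have ba : b != a by rewrite eq_sym.
have cb : c != b by rewrite eq_sym.
have ac : a != c by rewrite eq_sym.
have [Ba2 [Bb2 Bc2]] := (Ba, (Bb, Bc)).
have LL x y z : z != 0 -> x != y -> inadmissible z x y -> locL x y z = 0 -> locL y z x = 0 -> False.
  by move=> z0 xy Bz Lx Ly; rewrite (locLL z0 xy Lx Ly) in Bz.
case/or3P: Ba => /eqP Ha; case/or3P: Bb => /eqP Hb.
- exact: (LL a b c).
- case/or3P: Bc => /eqP Hc.
  + by apply: (LL c a b).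
  + by apply: (@locMM b c a).
  + by apply: (@locLMN a c b); rewrite // 1?locLC 1?locNC 1?locMC.
- case/or3P: Bc => /eqP Hc.
  + by apply: (LL c a b).
  + by apply: (@locLMN a b c).
  + by apply: (@locLNN' a b c).
- case/or3P: Bc => /eqP Hc.
  + by apply: (LL b c a).
  + by apply: (@locMM c a b).
  + by apply: (@locLMN b c a).
- by apply: (@locMM a b c).
- case/or3P: Bc => /eqP Hc.
  + by apply: (@locLMN c b a); rewrite // 1?locLC 1?locNC 1?locMC.
  + by apply: (@locMM c a b).
  + by apply: (@locMNN b c a).
- case/or3P: Bc => /eqP Hc.
  + by apply: (LL b c a).
  + by apply: (@locLMN b a c); rewrite // 1?locLC 1?locNC 1?locMC.
  + by apply: (@locLNN' b c a).
- case/or3P: Bc => /eqP Hc.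
  + by apply: (@locLMN c a b).
  + by apply: (@locMM b c a).
  + by apply: (@locMNN c a b).
- case/or3P: Bc => /eqP Hc.
  + by apply: (@locLNN' c a b).
  + by apply: (@locMNN a b c).
  + by case/eqP: D0; apply: locNNN.
Qed.

End Admissible.

Section FullGroup.
Context (k : closedFieldType) (char0 : [pchar k] =i pred0).
Context (L : fieldType) (iota : {rmorphism k -> L}).

Lemma Aut_isomorphic_contains (gT : finGroupType) : Aut_isomorphic iota gT -> Aut_contains iota gT.
Proof. by move=> [e [emb _]]; exists e. Qed.

Lemma genus3_slice f : genus3_equation iota f -> Aut_contains iota Z2_cubed ->
  exists a b c, genus3_equation iota (slice a b c).
Proof.
move=> /genus3_equationP[x [y pr]] aut.
have [a [b [c [x' [y' pr']]]]] := slice_presentation char0 pr aut.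
by exists a, b, c; apply/genus3_equationP; exists x', y'.
Qed.

Lemma genus3_good f : genus3_equation iota f -> good_octic f.
Proof. by move=> [sep sz _]; apply/good_octicP. Qed.

(* If [b = c], then [x |-> i x] lifts to an automorphism of order 4. *)
Lemma full_group_neq a b c : genus3_equation iota (slice a b c) ->
  Aut_isomorphic iota Z2_cubed -> b != c.
Proof.
move=> /genus3_equationP[x [y pr]] [e [emb all]]; have [aut hom _] := emb.
apply/eqP => bc; have [i i2] := imaginary_exists k.
have i0 : i != 0.
  by apply: contraTneq (oner_neq0 k) => i0; rewrite -[1]opprK -i2 i0 expr0n oppr0 eqxx.
have det : i * 1 - 0 * 0 != 0 by rewrite mulr1 mul0r subr0.
have fix_slice : octic_subst i 0 0 1 (slice a b c) = 1 *: slice a b c.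
  apply: octic_subst_eq => // [|z _]; first exact: size_slice.
  rewrite mul0r !add0r addr0 expr1n divr1 !mul1r bc !horner_slice subrr.
  have i4 : i ^+ 4 = 1 by rewrite -[4%N]/(2 * 2)%N exprM i2 sqrrN expr1n.
  have i8 : i ^+ 8 = 1 by rewrite -[8%N]/(4 * 2)%N exprM i4 expr1n.
  by rewrite !exprMn i4 i8; ring.
have [x' [y' [pr' xE _]]] := presentation_moebius pr det (oner_neq0 _) fix_slice.
have [s [autS sx _]] := presentation_automorphism pr' pr.
have [g sE] := all s autS.
have : s (s x') = x'.
  rewrite !sE -[LHS]/((e g \o e g) x') -hom Z2_cubed_mulgg.
  exact: group_embedding1 emb.
rewrite sx xE !rmorph0 rmorph1 mul0r addr0 add0r divr1 rmorphM (autS.2 i) sx xE.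
rewrite !rmorph0 rmorph1 mul0r addr0 add0r divr1 mulrA -rmorphM -expr2 i2 rmorphN rmorph1.
rewrite mulN1r => /eqP; rewrite eq_sym -addr_eq0 -mulr2n -mulr_natl mulf_eq0.
have -> : (2%:R == 0 :> L) = false.
  by rewrite -(rmorph_nat iota) fmorph_eq0 (negPf (natS_neq0 char0 1)).
move=> /eqP x'0; apply: (presentation_trans pr'); rewrite x'0.
exact: algebraic0.
Qed.

Lemma genus3_slice_cycle a b c : genus3_equation iota (slice a b c) ->
  genus3_equation iota (slice c a b).
Proof. exact: octic_equiv_genus3 (slice_cycle char0 a b c). Qed.

Lemma full_group_slice f : genus3_equation iota f -> Aut_isomorphic iota Z2_cubed ->
  exists a b c, [/\ genus3_equation iota (slice a b c), a != b, b != c & c != a].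
Proof.
move=> gf aut; have [a [b [c g1]]] := genus3_slice gf (Aut_isomorphic_contains aut).
have g2 := genus3_slice_cycle g1; have g3 := genus3_slice_cycle g2.
exists a, b, c; split=> //.
- exact: full_group_neq g2 aut.
- exact: full_group_neq g1 aut.
- exact: full_group_neq g3 aut.
Qed.

Lemma admissible_slice f : genus3_equation iota f -> Aut_isomorphic iota Z2_cubed ->
  exists a b c, [/\ genus3_equation iota (slice a b c), b != c & ~~ inadmissible a b c].
Proof.
move=> gf aut; have [a [b [c [g1 ab bc ca]]]] := full_group_slice gf aut.
have [a0 b0 c0 D0] := (slice_goodP char0 a b c).1 (genus3_good g1).
have g2 := genus3_slice_cycle g1; have g3 := genus3_slice_cycle g2.
case/or3P: (admissible_exists char0 a0 b0 c0 ab bc ca D0) => adm.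
- by exists a, b, c.
- by exists b, c, a.
- by exists c, a, b.
Qed.

Lemma dihedral_form : genus3_hyperelliptic iota -> Aut_isomorphic iota Z2_cubed ->
  exists u v s2 s3 : k,
    [/\ genus3_equation iota (normal_form u v),
        s2 = dihedral_s2 u (v + 2) u,
        s3 = dihedral_s3 u (v + 2) u,
        [/\ s2 != 0, s2 != 4, s3 != 0 & s3 != 4]
      & genus3_equation iota (dihedral_equation s2 s3)].
Proof.
move=> [f gf] aut; have [a [b [c [g1 bc adm]]]] := admissible_slice gf aut.
have [a0 _ _ _] := (slice_goodP char0 a b c).1 (genus3_good g1).
have two0 : (2 : k) != 0 := natS_neq0 char0 1.
pose u := 4 * (c - b) / a; pose v := (8 * (b + c) - 2 * a) / a - 2.
have u0 : u != 0.
  by rewrite mulf_neq0 ?invr_neq0 // mulf_neq0 ?(natS_neq0 char0 3) // subr_eq0 eq_sym.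
have sE : slice a b c = a *: normal_form u v.
  apply: (poly_eq_off (oner_neq0 _)) => x _.
  rewrite hornerZ horner_slice /normal_form /u /v !hornerE /=; field.
  exact: a0.
have g2 : genus3_equation iota (normal_form u v).
  apply: octic_equiv_genus3 g1; exists 1, 0, 0, 1, a.
  rewrite mul1r mul0r subr0 oner_neq0; split=> //.
  by rewrite -[LHS]/(moebius_sub 8 1 0 0 1 _) moebius_sub_scalar ?size_slice // expr1n scale1r.
exists u, v, (dihedral_s2 u (v + 2) u), (dihedral_s3 u (v + 2) u); split=> //; last first.
  exact: octic_equiv_genus3 (normal_form_dihedral char0 v u0) g2.
move: adm; rewrite /inadmissible !negb_or => /and3P[nL nM nN].
have s2E : dihedral_s2 u (v + 2) u - 4 = 4 * locL a b c / a ^+ 2.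
  by rewrite /dihedral_s2 /u /v /locL; field.
have s3E : dihedral_s3 u (v + 2) u = (2 * u ^+ 2) * (2 * locM a b c / a).
  by rewrite /dihedral_s3 /u /v /locM; field.
have s3E' : dihedral_s3 u (v + 2) u - 4 = 4 * locN a b c / a ^+ 3.
  by rewrite /dihedral_s3 /u /v /locN; field.
have four0 : (4 : k) != 0 := natS_neq0 char0 3.
split.
- by rewrite /dihedral_s2 mulf_neq0.
- by rewrite -subr_eq0 s2E !mulf_neq0 ?invr_neq0 ?expf_neq0.
- rewrite s3E; apply: mulf_neq0; first by apply: mulf_neq0; rewrite ?expf_neq0.
  by apply: mulf_neq0; [apply: mulf_neq0 | rewrite invr_neq0].
- by rewrite -subr_eq0 s3E' !mulf_neq0 ?invr_neq0 ?expf_neq0.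
Qed.

End FullGroup.

(** * Curves on the locus *)

Lemma fraction_numden (R : idomainType) (z : {fraction R}) :
  exists n d, d != 0 /\ z = tofrac n / tofrac d.
Proof.
elim/quotW: z => x; exists (frac x).1, (frac x).2.
have d0 := denom_ratioP x; split=> //.
have td0 : tofrac (frac x).2 != 0 by rewrite tofrac_eq0.
apply: (mulIf td0); rewrite divfK //; unlock tofrac.
rewrite -[LHS]FracField.pi_mul; apply/eqmodP; rewrite /= FracField.equivfE.
by rewrite !numden_Ratio ?(oner_eq0, mulf_neq0) // !mulr1 mulrC.
Qed.

Section FunctionField.
Context (k : closedFieldType) (char0 : [pchar k] =i pred0).

(** The field is k(x)[y] / (y^2 - f), where y^2 - f is irreducible because [f] is not a square in
    k(x). Membership in [locus] demands such a field for every equation. *)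
Lemma function_field_exists (f : {poly k}) : good_octic f ->
  exists (L : fieldType) (iota : {rmorphism k -> L}), genus3_equation iota f.
Proof.
move=> gf; pose F : fieldType := {fraction {poly k}}.
pose p : {poly F} := 'X^2 - (tofrac f)%:P.
have sp : size p = 3%N by rewrite size_XnsubC.
have irr : irreducible_poly p.
  apply: cubic_irreducible => [|z]; first by rewrite sp.
  have [n [d [d0 ->]]] := fraction_numden z.
  have td0 : tofrac d != 0 by rewrite tofrac_eq0.
  rewrite rootE hornerD hornerN hornerXn hornerC subr_eq0 expr_div_n; apply/eqP => e.
  have [] := @good_octic_not_square _ f n d gf; last by move=> _ /eqP; rewrite (negPf d0).
  have clear_den (K : fieldType) (a b c : K) : b != 0 -> a ^+ 2 / b ^+ 2 = c -> a ^+ 2 = c * b ^+ 2.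
    by move=> b0 <-; rewrite divfK // expf_neq0.
  have := clear_den _ _ _ _ td0 e.
  rewrite -!rmorphXn -rmorphM => /eqP; rewrite tofrac_eq => /eqP ->.
  exact: mulrC.
have [L _ [y ry gen]] := irredp_FAdjoin irr.
pose iota : {rmorphism k -> L} := in_alg L \o (@FracField.tofrac {poly k}) \o (@polyC k).
pose x : L := in_alg L (tofrac 'X).
have pE q : peval iota x q = in_alg L (tofrac q).
  elim/poly_ind: q => [|q c IH]; first by rewrite !rmorph0.
  by rewrite !rmorphD !rmorphM /= IH pevalX pevalC.
exists L, iota; apply/genus3_equationP; exists x, y; split=> //.
- move=> [q q0 /eqP]; rewrite -pevalE pE => /eqP; rewrite fmorph_eq0 tofrac_eq0.
  by rewrite (negPf q0).
- move: ry; rewrite rmorphB /= map_polyXn map_polyC rootE !hornerE /= subr_eq0 pE.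
  by move/eqP.
move=> w; have : w \in <<1; y>>%VS by rewrite gen memvf.
case/Fadjoin_polyP => q /polyOverP q1 ->.
set A := (fun w => w = x \/ w = y \/ exists c, w = iota c).
have [E0 E1 Ea Em Ei] := subfield_closure (subfield_gen_is_subfield A).
have Ex : subfield_gen A x by move=> E _; apply; left.
have Ey : subfield_gen A y by move=> E _; apply; right; left.
have Ec c : subfield_gen A (iota c) by move=> E _; apply; right; right; exists c.
have Ep r : subfield_gen A (peval iota x r).
  elim/poly_ind: r => [|r c IH]; first by rewrite rmorph0.
  by rewrite rmorphD rmorphM /= pevalX pevalC; apply: (Ea) => //; apply: (Em).
rewrite horner_coef; apply: (big_ind (subfield_gen A)) => // i _.
apply: (Em); last by elim: (i : nat) => [|j IH]; rewrite ?expr0 ?exprS //; apply: (Em).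
have /vlineP[z ->] := q1 i; have [n [d [d0 ->]]] := fraction_numden z.
have -> : (tofrac n / tofrac d) *: 1 = peval iota x n / peval iota x d.
  by rewrite !pE -fmorph_div.
by apply: (Em) => //; apply: (Ei _ _).2.
Qed.

Lemma presentation_generators (L : fieldType) (iota : {rmorphism k -> L}) x y f x' y' :
  presentation iota x y f ->
  (algebraicOver iota x' -> algebraicOver iota x) -> y' ^+ 2 = peval iota x' f ->
  subfield_gen (fun w => w = x' \/ w = y' \/ exists c, w = iota c) x ->
  subfield_gen (fun w => w = x' \/ w = y' \/ exists c, w = iota c) y ->
  presentation iota x' y' f.
Proof.
move=> [gf tr _ gen] alg y'E Ex Ey; split=> // [/alg //|z].
apply: (gen z); first exact: subfield_gen_is_subfield.
by move=> w [->|[->|[c ->]]] // E _; apply; right; right; exists c.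
Qed.

(** The maps (x, y) |-> (-x, y), (1/x, y/x^4) and (x, -y) are commuting involutions. Coincidences
    among [a], [b], [c] are allowed, as the locus only asks that the group be contained in the
    automorphism group. *)
Lemma slice_locus (a b c : k) : good_octic (slice a b c) -> locus Z2_cubed (slice a b c).
Proof.
move=> gf; have [L [iota gL]] := function_field_exists gf; exists L, iota; split=> //.
have /genus3_equationP[x [y pr]] := gL; have [_ tr ye _] := pr.
have two0 : (2%:R : L) != 0 by rewrite -(rmorph_nat iota) fmorph_eq0; exact: natS_neq0 char0 1.
have x0 : x != 0 by apply: contra_notN tr => /eqP->; exact: algebraic0.
have y0 : y != 0.
  by apply: contraNneq (good_octic_neq0 gf) => y0; rewrite -(peval_eq0 _ tr) -ye y0 expr0n.
have pevalS z : peval iota z (slice a b c) = iota a * (z ^+ 8 + 1)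
    + iota (4 * (c - b)) * (z ^+ 6 + z ^+ 2) + iota (8 * (b + c) - 2 * a) * z ^+ 4.
  by rewrite pevalE map_Poly horner_Poly /= !rmorph0; ring.
move: (ye); rewrite pevalS => yE.
have gen_sub A : [/\ forall u, subfield_gen A u -> subfield_gen A (- u :> L),
    forall u v, subfield_gen A u -> subfield_gen A v -> subfield_gen A (u * v)
    & forall u, subfield_gen A u -> subfield_gen A u^-1].
  have [_ _ _ Em Ei] := subfield_closure (subfield_gen_is_subfield A).
  by split=> // u /Ei[].
have gen_in x' y' : let A := fun w => w = x' \/ w = y' \/ exists c, w = iota c in
    subfield_gen A x' /\ subfield_gen A y'.
  by split=> E _; apply; [left | right; left].
have pr1 : presentation iota (- x) y (slice a b c).
  have [En _ _] := gen_sub (fun w => w = - x \/ w = y \/ exists c, w = iota c).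
  have [Ex Ey] := gen_in (- x) y.
  apply: (presentation_generators pr) => // [/algebraic_opp||]; first by rewrite opprK.
    by rewrite pevalS yE; ring.
  by have := En _ Ex; rewrite opprK.
have pr2 : presentation iota x^-1 (y / x ^+ 4) (slice a b c).
  have [_ Em Ei] := gen_sub (fun w => w = x^-1 \/ w = y / x ^+ 4 \/ exists c, w = iota c).
  have [Ex Ey] := gen_in x^-1 (y / x ^+ 4).
  have Ex' := Ei _ Ex; rewrite invrK in Ex'.
  apply: (presentation_generators pr) => // [/algebraic_inv||]; first by rewrite invrK.
    by rewrite pevalS expr_div_n yE; field.
  have := Em _ _ Ey (Em _ _ (Em _ _ Ex' Ex') (Em _ _ Ex' Ex')).
  by have -> : y / x ^+ 4 * (x * x * (x * x)) = y by field.
have pr3 : presentation iota x (- y) (slice a b c).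
  have [En _ _] := gen_sub (fun w => w = x \/ w = - y \/ exists c, w = iota c).
  have [Ex Ey] := gen_in x (- y).
  apply: (presentation_generators pr) => //; first by rewrite sqrrN.
  by have := En _ Ey; rewrite opprK.
have [s1 [a1 x1 y1]] := presentation_automorphism pr pr1.
have [s2 [a2 x2 y2]] := presentation_automorphism pr pr2.
have [s3 [a3 x3 y3]] := presentation_automorphism pr pr3.
have [[_ c1] [_ c2] [_ c3]] := And3 a1 a2 a3.
have ext (s t : {rmorphism L -> L}) : (forall c, s (iota c) = iota c) ->
    (forall c, t (iota c) = iota c) -> s x = t x -> s y = t y -> s =1 t.
  exact: rmorph_presentation_ext pr.
have s11 z : s1 (s1 z) = z.
  apply: (ext (s1 \o s1) idfun) => [d|d||] //=; first by rewrite !c1.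
    by rewrite x1 rmorphN x1 opprK.
  by rewrite !y1.
have s22 z : s2 (s2 z) = z.
  apply: (ext (s2 \o s2) idfun) => [d|d||] //=; first by rewrite !c2.
    by rewrite x2 fmorphV x2 invrK.
  by rewrite y2 fmorph_div rmorphXn x2 y2; field; rewrite x0 oner_neq0.
have s33 z : s3 (s3 z) = z.
  apply: (ext (s3 \o s3) idfun) => [d|d||] //=; first by rewrite !c3.
    by rewrite !x3.
  by rewrite y3 rmorphN y3 opprK.
have s12 z : s2 (s1 z) = s1 (s2 z).
  apply: (ext (s2 \o s1) (s1 \o s2)) => [d|d||] /=; rewrite ?c1 ?c2 ?c1 //.
    by rewrite x1 x2 rmorphN fmorphV x1 x2 invrN.
  by rewrite y1 y2 fmorph_div rmorphXn x1 y1 (_ : (- x) ^+ 4 = x ^+ 4) //; ring.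
have s13 z : s3 (s1 z) = s1 (s3 z).
  apply: (ext (s3 \o s1) (s1 \o s3)) => [d|d||] /=; rewrite ?c1 ?c3 ?c1 //.
    by rewrite x1 x3 rmorphN x1 x3.
  by rewrite y1 y3 rmorphN y1.
have s23 z : s3 (s2 z) = s2 (s3 z).
  apply: (ext (s3 \o s2) (s2 \o s3)) => [d|d||] /=; rewrite ?c2 ?c3 ?c2 //.
    by rewrite x2 x3 fmorphV x2 x3.
  by rewrite y2 y3 fmorph_div rmorphXn x3 y3 rmorphN y2 mulNr.
pose sel (s : {rmorphism L -> L}) (i : bool) : {rmorphism L -> L} := if i then s else idfun.
pose S i j l : {rmorphism L -> L} := sel s1 i \o (sel s2 j \o sel s3 l).
pose bit (i : 'Z_2) := i != 0%R.
have bitM i j : bit (i * j)%g = bit i (+) bit j.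
  by case: i j => [[|[|//]] ?] [[|[|//]] ?].
have bit0 i : bit i = false -> i = 1%g by move/negbFE/eqP.
exists (fun g : Z2_cubed => S (bit g.1.1) (bit g.1.2) (bit g.2)).
have hom g h : S (bit (g * h)%g.1.1) (bit (g * h)%g.1.2) (bit (g * h)%g.2)
    =1 S (bit g.1.1) (bit g.1.2) (bit g.2) \o S (bit h.1.1) (bit h.1.2) (bit h.2).
  move=> z; rewrite !bitM /S /sel /=.
  case: (bit g.1.1) (bit h.1.1) (bit g.1.2) (bit h.1.2) (bit g.2) (bit h.2) =>
    [] [] [] [] [] [] /=; by rewrite ?s13 ?s23 ?s12 ?s13 ?s23 ?s12 ?s11 ?s22 ?s33 ?s11 ?s22 ?s33.
(* Among x, -x, 1/x and -1/x only the first equals x, by transcendence; the sign of y separates the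
   remaining two elements. *)
have ker g : S (bit g.1.1) (bit g.1.2) (bit g.2) =1 id -> g = 1%g.
  have negK z : - z = z -> z = 0 :> L.
    move=> /eqP; rewrite eq_sym -addr_eq0 -mulr2n -mulr_natl mulf_eq0 (negPf two0).
    by move/eqP.
  have sq1 d : iota 1 * x ^+ 2 + iota 0 * x + iota d = 0 -> False.
    by move/(transcendental_quadratic tr) => [/eqP]; rewrite oner_eq0.
  move=> e; have := e x; have := e y; move: e; case: g => [[i j] l]; rewrite /S /sel /=.
  case ei: (bit i); case ej: (bit j); case el: (bit l) => _ ey ex;
    rewrite /= ?x3 ?x2 ?fmorphV ?x1 in ex.
  1,2: by case: (sq1 1); rewrite rmorph1 rmorph0 mul0r addr0 mul1r expr2 -{1}ex invrN mulNr mulVf // addNr.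
  1,2: by case/eqP: x0; apply: negK.
  1,2: by case: (sq1 (-1)); rewrite rmorphN rmorph1 rmorph0 mul0r addr0 mul1r expr2 -{1}ex mulVf // subrr.
  - by case/eqP: y0; apply: negK; rewrite /= y3 in ey.
  - by rewrite (bit0 i ei) (bit0 j ej) (bit0 l el).
split=> //.
- move=> g; split.
    exists (S (bit g.1.1) (bit g.1.2) (bit g.2)) => z.
      by rewrite -[LHS]/((_ \o _) z) -hom Z2_cubed_mulgg.
    by rewrite -[LHS]/((_ \o _) z) -hom Z2_cubed_mulgg.
  by move=> d; rewrite /S /sel /=; do 3!case: ifP => _; rewrite /= ?c3 ?c2 ?c1.
move=> g h e; have : (g * h = 1)%g.
  apply: ker => z; rewrite hom; transitivity ((S (bit h.1.1) (bit h.1.2) (bit h.2)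
    \o S (bit h.1.1) (bit h.1.2) (bit h.2)) z); first exact: e.
  by rewrite -hom Z2_cubed_mulgg.
by move=> gh; rewrite -[g]mulg1 -(Z2_cubed_mulgg h) mulgA gh mul1g.
Qed.

End FunctionField.

(** * Transvectant invariants *)

Definition mx5 (R : comNzRingType) (s : seq (seq R)) : 'M[R]_5 := \matrix_(i, j) (nth [::] s i)`_j.

(* [280 * f_i / 'C(8, i)]: the coefficients of a binary octic normalized by the
   binomials, with denominators cleared. *)
Definition ncoef (R : comNzRingType) (f : nat -> R) (i : nat) : R :=
  [:: 280; 35; 10; 5; 4; 5; 10; 35; 280]`_i * f i.

(* The transvectant [q |-> (f, q)_4] on binary quartics. *)
Definition transv4 (R : comNzRingType) (f : nat -> R) : 'M[R]_5 :=
  \matrix_(m, j) ([:: 1; -4; 6; -4; 1]`_j * ncoef f (4 - j + m)).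

(* The transvectant [(f, f)_6], a quartic. *)
Definition transv6 (R : comNzRingType) (f : nat -> R) : 'cV[R]_5 :=
  let n := ncoef f in
  \col_m [:: 6 * (n 0 * n 6 - 6 * (n 1 * n 5) + 15 * (n 2 * n 4) - 10 * (n 3 * n 3));
    3 * (n 0 * n 7 - 5 * (n 1 * n 6) + 9 * (n 2 * n 5) - 5 * (n 3 * n 4));
    n 0 * n 8 - 2 * (n 1 * n 7) - 8 * (n 2 * n 6) + 34 * (n 3 * n 5) - 25 * (n 4 * n 4);
    3 * (n 1 * n 8 - 5 * (n 2 * n 7) + 9 * (n 3 * n 6) - 5 * (n 4 * n 5));
    6 * (n 2 * n 8 - 6 * (n 3 * n 7) + 15 * (n 4 * n 6) - 10 * (n 5 * n 5))]`_m.

(* The invariant bilinear form on binary quartics. *)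
Definition quartic_form (R : comNzRingType) : 'M[R]_5 :=
  mx5 [:: [:: 0; 0; 0; 0; 1]; [:: 0; 0; 0; -4; 0]; [:: 0; 0; 6; 0; 0];
          [:: 0; -4; 0; 0; 0]; [:: 1; 0; 0; 0; 0]].

Definition tr_inv (R : comNzRingType) (n : nat) (f : nat -> R) : R := \tr (transv4 f ^+ n).

Definition quad_inv (R : comNzRingType) (n : nat) (f : nat -> R) : R :=
  ((transv6 f)^T *m quartic_form R *m transv4 f ^+ n *m transv6 f) 0 0.

Section SL2.
Context (R : comNzRingType).
Implicit Types (f g : nat -> R) (P Q : 'M[R]_5).

Lemma tr_inv_conj n f g P Q : P *m Q = 1%:M -> transv4 g *m P = P *m transv4 f ->
  tr_inv n g = tr_inv n f.
Proof.
move=> PQ gP; have QP := mulmx1C PQ.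
have gPn : transv4 g ^+ n *m P = P *m transv4 f ^+ n.
  elim: n => [|n IH]; first by rewrite !expr0 mul1mx mulmx1.
  by rewrite !exprSr -![_ * _]/(_ *m _) -mulmxA gP mulmxA IH mulmxA.
rewrite /tr_inv -[transv4 g ^+ n]mulmx1 -PQ mulmxA gPn -mulmxA mxtrace_mulC.
by rewrite -mulmxA QP mulmx1.
Qed.

Lemma quad_inv_conj n f g P : transv4 g *m P = P *m transv4 f ->
  transv6 g = P *m transv6 f -> P^T *m quartic_form R *m P = quartic_form R ->
  quad_inv n g = quad_inv n f.
Proof.
move=> gP gv PB.
have gPn : transv4 g ^+ n *m P = P *m transv4 f ^+ n.
  elim: n => [|n IH]; first by rewrite !expr0 mul1mx mulmx1.
  by rewrite !exprSr -![_ * _]/(_ *m _) -mulmxA gP mulmxA IH mulmxA.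
rewrite /quad_inv gv trmx_mul; congr (_ 0 0).
rewrite -[in RHS]PB -!mulmxA; congr (_ *m (_ *m (_ *m _))).
by rewrite !mulmxA gPn.
Qed.

(** The coefficients of f(X + t Z, Z), and in [flip] those of f(-Z, X), written out so that
    invariance becomes a matrix identity over every commutative ring. *)
Definition shear (t : R) f : nat -> R := nth 0
  [:: f 0%N + t * f 1%N + t ^+ 2 * f 2%N + t ^+ 3 * f 3%N + t ^+ 4 * f 4%N + t ^+ 5 * f 5%N + t ^+ 6 * f 6%N + t ^+ 7 * f 7%N + t ^+ 8 * f 8%N;
    f 1%N + 2 * t * f 2%N + 3 * t ^+ 2 * f 3%N + 4 * t ^+ 3 * f 4%N + 5 * t ^+ 4 * f 5%N + 6 * t ^+ 5 * f 6%N + 7 * t ^+ 6 * f 7%N + 8 * t ^+ 7 * f 8%N;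
    f 2%N + 3 * t * f 3%N + 6 * t ^+ 2 * f 4%N + 10 * t ^+ 3 * f 5%N + 15 * t ^+ 4 * f 6%N + 21 * t ^+ 5 * f 7%N + 28 * t ^+ 6 * f 8%N;
    f 3%N + 4 * t * f 4%N + 10 * t ^+ 2 * f 5%N + 20 * t ^+ 3 * f 6%N + 35 * t ^+ 4 * f 7%N + 56 * t ^+ 5 * f 8%N;
    f 4%N + 5 * t * f 5%N + 15 * t ^+ 2 * f 6%N + 35 * t ^+ 3 * f 7%N + 70 * t ^+ 4 * f 8%N;
    f 5%N + 6 * t * f 6%N + 21 * t ^+ 2 * f 7%N + 56 * t ^+ 3 * f 8%N;
    f 6%N + 7 * t * f 7%N + 28 * t ^+ 2 * f 8%N;
    f 7%N + 8 * t * f 8%N;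
    f 8%N].

Definition flip f : nat -> R := nth 0
  [:: f 8%N; - f 7%N; f 6%N; - f 5%N; f 4%N; - f 3%N; f 2%N; - f 1%N; f 0%N].

(** Action on binary quartics in coefficients normalized by the binomials, the ones in which
    [transv4], [transv6] and [quartic_form] are expressed. *)
Definition shear_mx (t : R) : 'M[R]_5 := mx5
  [:: [:: 1; 4 * t; 6 * t ^+ 2; 4 * t ^+ 3; t ^+ 4];
    [:: 0; 1; 3 * t; 3 * t ^+ 2; t ^+ 3];
    [:: 0; 0; 1; 2 * t; t ^+ 2];
    [:: 0; 0; 0; 1; t];
    [:: 0; 0; 0; 0; 1]].

Definition flip_mx : 'M[R]_5 := mx5
  [:: [:: 0; 0; 0; 0; 1]; [:: 0; 0; 0; -1; 0]; [:: 0; 0; 1; 0; 0];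
      [:: 0; -1; 0; 0; 0]; [:: 1; 0; 0; 0; 0]].

Ltac mx5_ring :=
  apply/matrixP => -[[|[|[|[|[|//]]]]] ?] -[[|[|[|[|[|//]]]]] ?];
  rewrite !(mxE, big_ord_recl, big_ord0) /= ?mxE /shear /flip /bump /ncoef /addn /subn /=; ring.

Lemma shear_mxV t : shear_mx t *m shear_mx (- t) = 1%:M.
Proof. by mx5_ring. Qed.

Lemma flip_mxV : flip_mx *m flip_mx = 1%:M.
Proof. by mx5_ring. Qed.

Lemma transv4_shear t f : transv4 (shear t f) *m shear_mx t = shear_mx t *m transv4 f.
Proof. by mx5_ring. Qed.

Lemma transv4_flip f : transv4 (flip f) *m flip_mx = flip_mx *m transv4 f.
Proof. by mx5_ring. Qed.

Lemma quartic_form_shear t : (shear_mx t)^T *m quartic_form R *m shear_mx t = quartic_form R.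
Proof.
have -> : (shear_mx t)^T *m quartic_form R = quartic_form R *m shear_mx (- t).
  by mx5_ring.
by rewrite -mulmxA (mulmx1C (shear_mxV t)) mulmx1.
Qed.

Lemma quartic_form_flip : flip_mx^T *m quartic_form R *m flip_mx = quartic_form R.
Proof.
have -> : flip_mx^T *m quartic_form R = quartic_form R *m flip_mx by mx5_ring.
by rewrite -mulmxA flip_mxV mulmx1.
Qed.

Lemma transv6_shear t f : transv6 (shear t f) = shear_mx t *m transv6 f.
Proof.
apply/colP => -[[|[|[|[|[|//]]]]] ?];
  rewrite !(mxE, big_ord_recl, big_ord0) /= ?mxE /shear /flip /bump /ncoef /addn /subn /=; ring.
Qed.

Lemma transv6_flip f : transv6 (flip f) = flip_mx *m transv6 f.
Proof.
apply/colP => -[[|[|[|[|[|//]]]]] ?];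
  rewrite !(mxE, big_ord_recl, big_ord0) /= ?mxE /shear /flip /bump /ncoef /addn /subn /=; ring.
Qed.

End SL2.

Section Naturality.
Context (R S : comNzRingType) (phi : {rmorphism R -> S}).

Lemma map_ncoef (f : nat -> R) i : phi (ncoef f i) = ncoef (phi \o f) i.
Proof.
rewrite /ncoef rmorphM; congr (_ * _).
by do 9?[case: i => [|i] /=; first by rewrite ?rmorph_nat]; rewrite !nth_nil rmorph0.
Qed.

Lemma map_transv4 (f : nat -> R) : map_mx phi (transv4 f) = transv4 (phi \o f).
Proof.
apply/matrixP => m j; rewrite !mxE rmorphM map_ncoef; congr (_ * _).
by case: j => [[|[|[|[|[|//]]]]] ?]; rewrite /= ?rmorphN ?rmorph_nat ?rmorph1.
Qed.

Lemma map_transv6 (f : nat -> R) : map_mx phi (transv6 f) = transv6 (phi \o f).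
Proof.
apply/colP => m; rewrite !mxE.
move: (ncoef f) (ncoef (phi \o f)) (map_ncoef f) => n n' nE.
case: m => [[|[|[|[|[|//]]]]] ?] /=;
  by rewrite !(rmorph_nat, rmorphM, rmorphN, rmorphD) /= !nE.
Qed.

Lemma map_quartic_form : map_mx phi (quartic_form R) = quartic_form S.
Proof.
apply/matrixP => -[[|[|[|[|[|//]]]]] ?] -[[|[|[|[|[|//]]]]] ?];
  by rewrite !mxE /= ?rmorph0 ?rmorphN ?rmorph_nat ?rmorph1.
Qed.

Lemma map_tr_inv n (f : nat -> R) : phi (tr_inv n f) = tr_inv n (phi \o f).
Proof. by rewrite /tr_inv -map_transv4 -rmorphXn /= -trace_map_mx. Qed.

Lemma map_quad_inv n (f : nat -> R) : phi (quad_inv n f) = quad_inv n (phi \o f).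
Proof.
rewrite /quad_inv -map_transv4 -map_transv6 -map_quartic_form -rmorphXn /=.
by rewrite [(map_mx _ _)^T]map_trmx -!map_mxM [RHS]mxE.
Qed.

End Naturality.

Section Generators.
Context (k : closedFieldType).

Lemma octic_subst_shear t (f : {poly k}) : (size f <= 9)%N ->
  octic_subst 1 t 0 1 f = \poly_(i < 9) shear t (fun i => f`_i) i.
Proof.
move=> s9; rewrite -[RHS]scale1r; apply: octic_subst_eq => // [|x _].
  by rewrite mulr1 mulr0 subr0 oner_neq0.
rewrite mul0r add0r expr1n divr1 !mul1r (horner_coef_wide _ s9) horner_poly.
by rewrite !big_ord_recr !big_ord0 /= /shear /=; ring.
Qed.

Lemma octic_subst_flip (f : {poly k}) : (size f <= 9)%N ->
  octic_subst 0 (-1) 1 0 f = \poly_(i < 9) flip (fun i => f`_i) i.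
Proof.
move=> s9; rewrite -[RHS]scale1r; apply: octic_subst_eq => // [|x].
  by rewrite mulN1r mul0r sub0r opprK oner_neq0.
rewrite addr0 mul1r => x0; rewrite mul0r add0r (horner_coef_wide _ s9) horner_poly.
by rewrite !big_ord_recr !big_ord0 /= /flip /=; field; rewrite x0.
Qed.

Lemma octic_subst_truncate a b c d (f : {poly k}) :
  octic_subst a b c d f = octic_subst a b c d (\poly_(i < 9) f`_i).
Proof. by apply: eq_bigr => i _; rewrite coef_poly ltn_ord. Qed.

(* Shears and the flip generate SL_2. *)
Lemma octic_subst_generators (P : {poly k} -> {poly k} -> Prop) :
  (forall f g h, P f g -> P g h -> P f h) ->
  (forall t (f : {poly k}), (size f <= 9)%N -> P f (octic_subst 1 t 0 1 f)) ->
  (forall f : {poly k}, (size f <= 9)%N -> P f (octic_subst 0 (-1) 1 0 f)) ->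
  forall a b c d (f : {poly k}), (size f <= 9)%N -> a * d - b * c = 1 ->
  P f (octic_subst a b c d f).
Proof.
move=> Pt Ps Pf.
pose gen a b c d := a * d - b * c = 1 /\
  forall f : {poly k}, (size f <= 9)%N -> P f (octic_subst a b c d f).
have comp a b c d a' b' c' d' p q r s : gen a b c d -> gen a' b' c' d' ->
    p = a * a' + b * c' -> q = a * b' + b * d' -> r = c * a' + d * c' -> s = c * b' + d * d' ->
    gen p q r s.
  move=> [det Pa] [det' Pb] -> -> -> ->; split=> [|f s9].
    by rewrite -[RHS]mulr1 -{1}det -det'; ring.
  rewrite -[octic_subst _ _ _ _ _]/(moebius_sub 8 _ _ _ _ _).
  rewrite -moebius_sub_comp ?det ?det' ?oner_neq0 //.
  exact: Pt (Pa _ s9) (Pb _ (size_moebius_sub 8 _ _ _ _ _)).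
have gS t : gen 1 t 0 1 by split; [ring | exact: Ps].
have gF : gen 0 (-1) 1 0 by split; [ring | exact: Pf].
have gF' : gen 0 1 (-1) 0.
  split; [ring | move=> f s9]; suff -> : octic_subst 0 1 (-1) 0 f = octic_subst 0 (-1) 1 0 f by apply: Pf.
  have det : 0 * 0 - (-1) * 1 != 0 :> k by rewrite mul0r sub0r mulN1r opprK oner_neq0.
  rewrite -[octic_subst 0 (-1) _ _ _]scale1r; apply: octic_subst_eq => // [|x q0].
    by rewrite mul0r sub0r mul1r opprK oner_neq0.
  have q1 : 1 * x + 0 != 0 by move: q0; rewrite !addr0 mulN1r mul1r oppr_eq0.
  rewrite [RHS]mul1r -[octic_subst _ _ _ _ _]/(moebius_sub 8 0 (-1) 1 0 f) horner_moebius_sub //.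
  congr (_ * _.[_]); first by ring.
  by move: q1; rewrite !mul0r !add0r !addr0 mul1r mulN1r => x0; field; rewrite ?oppr_eq0 x0.
have gL c : gen 1 0 c 1.
  have gFS : gen 0 (-1) 1 (- c) by apply: (comp _ _ _ _ _ _ _ _ _ _ _ _ gF (gS (- c))); ring.
  by apply: (comp _ _ _ _ _ _ _ _ _ _ _ _ gFS gF'); ring.
have gc a b c d : c != 0 -> a * d - b * c = 1 -> gen a b c d.
  move=> c0 det.
  have g1 : gen a ((a - 1) / c) c 1.
    by apply: (comp _ _ _ _ _ _ _ _ _ _ _ _ (gS ((a - 1) / c)) (gL c)); field.
  apply: (comp _ _ _ _ _ _ _ _ _ _ _ _ g1 (gS ((d - 1) / c))); try by field.
  apply: (mulIf c0); rewrite -[LHS](subrK (a * d)) -[b * c - _]opprB det.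
  by field.
move=> a b c d f s9 det; suff [_] : gen a b c d by apply.
have [c0|] := eqVneq c 0; last by move=> c0; apply: gc.
have ad : a * d = 1 by rewrite -det c0 mulr0 subr0.
have d0 : d != 0 by apply: contraTneq (oner_neq0 k) => d0; rewrite -ad d0 mulr0 eqxx.
have g1 : gen b (- a) d 0 by apply: gc => //; rewrite -ad; ring.
by apply: (comp _ _ _ _ _ _ _ _ _ _ _ _ g1 gF'); rewrite ?c0; ring.
Qed.

End Generators.

(** * Invariants as natural families of functions *)

Definition generic_coef (R : comNzRingType) (i : nat) : {mpoly R[9]} :=
  if (i < 9)%N then 'X_(inord i) else 0.

(* A polynomial with integer coefficients in the coefficients of an octic, as a
   family of functions natural in the ring of coefficients. *)
Definition octic_form := forall R : comNzRingType, (nat -> R) -> R.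

(** Naturality carries one formula from the generic coefficients to any particular octic and from
    the integers to [k]. So a single verification gives a polynomial invariant that is defined over
    Z. *)
Record invariant_form (d : nat) (F : octic_form) : Prop := InvariantForm {
  form_natural : forall (R S : comNzRingType) (phi : {rmorphism R -> S}) f,
    phi (F R f) = F S (phi \o f);
  form_local : forall (R : comNzRingType) (f g : nat -> R),
    (forall i, (i < 9)%N -> f i = g i) -> F R f = F R g;
  form_shear : forall (R : comNzRingType) t (f : nat -> R), F R (shear t f) = F R f;
  form_flip : forall (R : comNzRingType) (f : nat -> R), F R (flip f) = F R f;
  form_homog : forall k : fieldType, F {mpoly k[9]} (@generic_coef k) \is d.-homog }.

Section FormPolynomial.
Context (d : nat) (F : octic_form) (FI : invariant_form d F).

Definition form_mpoly (k : fieldType) : {mpoly k[9]} := F (@generic_coef k).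

Lemma octic_eval_form (k K : fieldType) (j : {rmorphism k -> K}) (f : {poly K}) :
  octic_eval j (form_mpoly k) f = F (fun i => f`_i).
Proof.
rewrite /octic_eval -[mmap _ _ _]/((mmap j (fun i : 'I_9 => f`_i) : {rmorphism _ -> _}) _).
rewrite (form_natural FI); apply: (form_local FI) => i i9.
by rewrite /= /generic_coef i9 mmapX mmap1U inordK.
Qed.

Lemma form_over_Z (k : fieldType) : over_Z (form_mpoly k).
Proof.
exists (F (@generic_coef int)).
rewrite -[map_mpoly _ _]/((map_mpoly intr : {rmorphism {mpoly int[9]} -> {mpoly k[9]}}) _).
rewrite (form_natural FI); apply: (form_local FI) => i i9.
by rewrite /= /generic_coef i9 map_mpolyX.
Qed.

(** [octic_invariant] quantifies over arbitrary polynomials, but only coefficients up to degree 8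
    matter; the generators of SL_2 then act on the truncated octic. *)
Lemma form_invariant (k : closedFieldType) : octic_invariant (form_mpoly k).
Proof.
move=> a b c e f det; rewrite !(octic_eval_form idfun) octic_subst_truncate.
pose P (g h : {poly k}) := F (fun i => h`_i) = F (fun i => g`_i).
have -> : F (fun i => f`_i) = F (fun i => (\poly_(i < 9) f`_i)`_i).
  by apply: (form_local FI) => i i9; rewrite coef_poly i9.
have Pt g h l : P g h -> P h l -> P g l by rewrite /P => -> ->.
apply: (octic_subst_generators (P := P) Pt _ _ (size_poly _ _) det) => [t g s9|g s9]; rewrite /P.
- rewrite octic_subst_shear // -[RHS](form_shear FI t); apply: (form_local FI) => i i9.
  by rewrite coef_poly i9.
- rewrite octic_subst_flip // -[RHS](form_flip FI); apply: (form_local FI) => i i9.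
  by rewrite coef_poly i9.
Qed.

End FormPolynomial.

Section Forms.

Lemma invariant_formM d e (F G : octic_form) : invariant_form d F -> invariant_form e G ->
  invariant_form (d + e) (fun R f => F R f * G R f).
Proof.
move=> FI GI; split=> [R S phi f|R f g fg|R t f|R f|k].
- by rewrite rmorphM (form_natural FI) (form_natural GI).
- by rewrite (form_local FI fg) (form_local GI fg).
- by rewrite (form_shear FI) (form_shear GI).
- by rewrite (form_flip FI) (form_flip GI).
- by apply: dhomogM; [apply: form_homog FI k | apply: form_homog GI k].
Qed.

Lemma invariant_formD d (F G : octic_form) : invariant_form d F -> invariant_form d G ->
  invariant_form d (fun R f => F R f + G R f).
Proof.
move=> FI GI; split=> [R S phi f|R f g fg|R t f|R f|k].
- by rewrite rmorphD (form_natural FI) (form_natural GI).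
- by rewrite (form_local FI fg) (form_local GI fg).
- by rewrite (form_shear FI) (form_shear GI).
- by rewrite (form_flip FI) (form_flip GI).
- by apply: rpredD; [apply: form_homog FI k | apply: form_homog GI k].
Qed.

Lemma invariant_formZ d (z : int) (F : octic_form) : invariant_form d F ->
  invariant_form d (fun R f => F R f *~ z).
Proof.
move=> FI; split=> [R S phi f|R f g fg|R t f|R f|k].
- by rewrite rmorphMz (form_natural FI).
- by rewrite (form_local FI fg).
- by rewrite (form_shear FI).
- by rewrite (form_flip FI).
- by apply: rpredMz; apply: form_homog FI k.
Qed.

Lemma generic_ncoef_homog (k : fieldType) i : ncoef (@generic_coef k) i \is 1.-homog.
Proof.
rewrite /ncoef; have -> : [:: 280; 35; 10; 5; 4; 5; 10; 35; 280]`_i * generic_coef k i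
    = generic_coef k i *+ nth 0%N [:: 280; 35; 10; 5; 4; 5; 10; 35; 280]%N i.
  rewrite -[RHS]mulr_natl; congr (_ * _).
  by do 9?[case: i => [|i] /=; first by []]; rewrite !nth_nil.
apply: rpredMn; rewrite /generic_coef; case: ltnP => _; last exact: rpred0.
by rewrite dhomogX; apply/eqP; exact: mdeg1.
Qed.

Definition homog_mx (k : fieldType) (d m n : nat) (M : 'M[{mpoly k[9]}]_(m, n)) :=
  forall i j, M i j \is d.-homog.

Lemma homog_mulmx (k : fieldType) d e m n p (M : 'M[{mpoly k[9]}]_(m, n))
    (N : 'M[{mpoly k[9]}]_(n, p)) :
  homog_mx d M -> homog_mx e N -> homog_mx (d + e) (M *m N).
Proof. by move=> HM HN i j; rewrite mxE; apply: rpred_sum => l _; apply: dhomogM. Qed.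

Lemma homog_int (k : fieldType) (z : int) : (z%:~R : {mpoly k[9]}) \is 0.-homog.
Proof. by apply: rpredMz; apply: dhomog1. Qed.

Lemma homog_transv4 (k : fieldType) : homog_mx 1 (transv4 (@generic_coef k)).
Proof.
move=> m j; rewrite mxE; apply: (dhomogM (d := 0) (e := 1)); last exact: generic_ncoef_homog.
case: j => [[|[|[|[|[|//]]]]] ?] /=.
- exact: (homog_int k 1).
- exact: (homog_int k (-4)).
- exact: (homog_int k 6).
- exact: (homog_int k (-4)).
- exact: (homog_int k 1).
Qed.

Lemma homog_transv4X (k : fieldType) n : homog_mx n (transv4 (@generic_coef k) ^+ n).
Proof.
elim: n => [|n IH]; last by rewrite exprS; apply: (homog_mulmx (d := 1) (homog_transv4 k) IH).
move=> i j; rewrite expr0 mxE; exact: (homog_int k (i == j)).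
Qed.

Lemma homog_transv6 (k : fieldType) : homog_mx 2 (transv6 (@generic_coef k)).
Proof.
have h (i j : nat) : ncoef (@generic_coef k) i * ncoef (@generic_coef k) j \is 2.-homog.
  by apply: (dhomogM (d := 1) (e := 1)); apply: generic_ncoef_homog.
have hz (z : nat) p : p \is 2.-homog -> (z%:R * p : {mpoly k[9]}) \is 2.-homog.
  by move=> hp; rewrite mulr_natl; apply: rpredMn.
have hD : forall p q : {mpoly k[9]}, p \is 2.-homog -> q \is 2.-homog -> p + q \is 2.-homog.
  by move=> p q hp hq; apply: rpredD.
have hB : forall p q : {mpoly k[9]}, p \is 2.-homog -> q \is 2.-homog -> p - q \is 2.-homog.
  by move=> p q hp hq; apply: rpredB.
move=> m j; rewrite mxE; case: m => [[|[|[|[|[|//]]]]] ?] /=.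
3: exact: hB _ _ (hD _ _ (hB _ _ (hB _ _ (h _ _) (hz 2%N _ (h _ _))) (hz 8%N _ (h _ _))) (hz 34%N _ (h _ _)))
  (hz 25%N _ (h _ _)).
1,4: exact: hz 6%N _ (hB _ _ (hD _ _ (hB _ _ (h _ _) (hz 6%N _ (h _ _))) (hz 15%N _ (h _ _))) (hz 10%N _ (h _ _))).
all: exact: hz 3%N _ (hB _ _ (hD _ _ (hB _ _ (h _ _) (hz 5%N _ (h _ _))) (hz 9%N _ (h _ _))) (hz 5%N _ (h _ _))).
Qed.

Lemma homog_quartic_form (k : fieldType) : homog_mx 0 (quartic_form {mpoly k[9]}).
Proof.
move=> -[[|[|[|[|[|//]]]]] ?] -[[|[|[|[|[|//]]]]] ?]; rewrite mxE /=.
all: first [exact: rpred0 | exact: (homog_int k 1) | exact: (homog_int k (-4)) | exact: (homog_int k 6)].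
Qed.

Lemma ncoef_local (R : comNzRingType) (f g : nat -> R) :
  (forall i, (i < 9)%N -> f i = g i) -> ncoef f =1 ncoef g.
Proof.
move=> fg i; rewrite /ncoef; case: (ltnP i 9) => [/fg -> //|i9].
by rewrite nth_default // !mul0r.
Qed.

Lemma transv4_local (R : comNzRingType) (f g : nat -> R) :
  (forall i, (i < 9)%N -> f i = g i) -> transv4 f = transv4 g.
Proof. by move=> /ncoef_local fg; apply/matrixP => i j; rewrite !mxE fg. Qed.

Lemma transv6_local (R : comNzRingType) (f g : nat -> R) :
  (forall i, (i < 9)%N -> f i = g i) -> transv6 f = transv6 g.
Proof. by move=> /ncoef_local fg; apply/matrixP => i j; rewrite !mxE !fg. Qed.

Lemma tr_inv_form n : invariant_form n (fun R => @tr_inv R n).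
Proof.
split=> [R S phi f|R f g fg|R t f|R f|k].
- exact: map_tr_inv.
- by rewrite /tr_inv (transv4_local fg).
- exact: (tr_inv_conj _ (shear_mxV t) (transv4_shear t f)).
- exact: (tr_inv_conj _ (flip_mxV R) (transv4_flip f)).
- by apply: rpred_sum => i _; apply: homog_transv4X.
Qed.

Lemma quad_inv_form n : invariant_form (4 + n) (fun R => @quad_inv R n).
Proof.
split=> [R S phi f|R f g fg|R t f|R f|k].
- exact: map_quad_inv.
- by rewrite /quad_inv (transv4_local fg) (transv6_local fg).
- exact: (quad_inv_conj _ (transv4_shear t f) (transv6_shear t f) (quartic_form_shear t)).
- exact: (quad_inv_conj _ (transv4_flip f) (transv6_flip f) (quartic_form_flip R)).
have -> : (4 + n = 2 + 0 + n + 2)%N by lia.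
have homog_tr : homog_mx 2 (transv6 (@generic_coef k))^T.
  by move=> i j; rewrite mxE; apply: homog_transv6.
exact: homog_mulmx (homog_mulmx (homog_mulmx homog_tr (homog_quartic_form k))
  (homog_transv4X k n)) (homog_transv6 k) 0 0.
Qed.

End Forms.

(** * Values of the invariants on the slice *)

Section SliceValues.
Context (R : comNzRingType) (a b c : R).

Let p := 35 * a.
Let q := 5 * (c - b).
Let r := 4 * (b + c) - a.
Let f i := (slice a b c)`_i.
Let M : 'M[R]_5 := mx5 [:: [:: r; 0; 6 * q; 0; p]; [:: 0; - (4 * r); 0; - (4 * q); 0];
  [:: q; 0; 6 * r; 0; q]; [:: 0; - (4 * q); 0; - (4 * r); 0]; [:: p; 0; 6 * q; 0; r]].
Let e1 := a + b + c.
Let e2 := a * b + a * c + b * c.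
Let e3 := a * b * c.

Lemma transv4_slice : transv4 f = 8 *: M.
Proof.
apply/matrixP => -[[|[|[|[|[|//]]]]] ?] -[[|[|[|[|[|//]]]]] ?];
  rewrite !mxE /= /ncoef /f coef_Poly /addn /subn /= /p /q /r; ring.
Qed.

Lemma slice_mxsq : M *m M = mx5
  [:: [:: p ^+ 2 + 6 * q ^+ 2 + r ^+ 2; 0; 6 * q * (p + 7 * r); 0; 2 * p * r + 6 * q ^+ 2];
      [:: 0; 16 * (q ^+ 2 + r ^+ 2); 0; 32 * q * r; 0];
      [:: q * (p + 7 * r); 0; 12 * q ^+ 2 + 36 * r ^+ 2; 0; q * (p + 7 * r)];
      [:: 0; 32 * q * r; 0; 16 * (q ^+ 2 + r ^+ 2); 0];
      [:: 2 * p * r + 6 * q ^+ 2; 0; 6 * q * (p + 7 * r); 0; p ^+ 2 + 6 * q ^+ 2 + r ^+ 2]].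
Proof.
apply/matrixP => -[[|[|[|[|[|//]]]]] ?] -[[|[|[|[|[|//]]]]] ?];
  rewrite !(mxE, big_ord_recl, big_ord0) /=; ring.
Qed.

Lemma tr_inv2_slice : tr_inv 2 f = 64 * (2520 * e1 ^+ 2 - 5600 * e2).
Proof.
rewrite /tr_inv transv4_slice exprZn mxtraceZ -[M ^+ 2]/(M *m M) slice_mxsq /mxtrace.
by rewrite !(mxE, big_ord_recl, big_ord0) /= /p /q /r /e1 /e2; ring.
Qed.

Lemma tr_inv3_slice : tr_inv 3 f =
  512 * (52 * 1000 * e1 * e2 + 800 * e1 * e2 - 7440 * e1 ^+ 3 - 192 * 1000 * e3).
Proof.
rewrite /tr_inv transv4_slice exprZn mxtraceZ -[M ^+ 3]/(M *m (M *m M)) slice_mxsq /mxtrace.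
by rewrite !(mxE, big_ord_recl, big_ord0) /= /p /q /r /e1 /e2 /e3; ring.
Qed.

Lemma tr_inv4_slice : tr_inv 4 f = 4096 *
  ((3 * 1000 * 1000 + 17760) * e1 ^+ 4 - (12217 * 1000 + 600) * e1 ^+ 2 * e2
   + 8 * 1000 * 1000 * e2 ^+ 2 + 7168 * 1000 * e1 * e3).
Proof.
rewrite /tr_inv transv4_slice exprZn mxtraceZ.
have -> : M ^+ 4 = (M *m M) *m (M *m M) by rewrite mulmxA -[LHS]/(M *m (M *m (M *m M))) !mulmxA.
rewrite slice_mxsq /mxtrace.
by rewrite !(mxE, big_ord_recl, big_ord0) /= /p /q /r /e1 /e2 /e3; ring.
Qed.

(** The quartics fixed by the Klein four-group: a plane that contains (f, f)_6 and is stable under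
    [transv4] of a slice octic. *)
Definition quartic_vec (x y : R) : 'cV[R]_5 := \col_m [:: x; 0; y; 0; x]`_m.

Lemma transv6_slice : transv6 f =
  quartic_vec (384 * (p * q + 15 * q * r)) (64 * (p ^+ 2 - 8 * q ^+ 2 - 25 * r ^+ 2)).
Proof.
apply/colP => -[[|[|[|[|[|//]]]]] ?];
  rewrite !mxE /= /ncoef /f !coef_Poly /= /p /q /r; ring.
Qed.

Lemma transv4_vec x y : transv4 f *m quartic_vec x y =
  quartic_vec (8 * ((p + r) * x + 6 * q * y)) (8 * (2 * q * x + 6 * r * y)).
Proof.
rewrite transv4_slice; apply/colP => -[[|[|[|[|[|//]]]]] ?];
  rewrite !(mxE, big_ord_recl, big_ord0) /= ?mxE /=; ring.
Qed.

Lemma quartic_form_vec x y x' y' :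
  ((quartic_vec x y)^T *m quartic_form R *m quartic_vec x' y') 0 0 = 2 * x * x' + 6 * y * y'.
Proof.
by rewrite !(mxE, big_ord_recl, big_ord0) /= ?mxE /=; ring.
Qed.

Let x0 := 384 * (p * q + 15 * q * r).
Let y0 := 64 * (p ^+ 2 - 8 * q ^+ 2 - 25 * r ^+ 2).
Let x1 := 8 * ((p + r) * x0 + 6 * q * y0).
Let y1 := 8 * (2 * q * x0 + 6 * r * y0).
Let x2 := 8 * ((p + r) * x1 + 6 * q * y1).
Let y2 := 8 * (2 * q * x1 + 6 * r * y1).
Let x3 := 8 * ((p + r) * x2 + 6 * q * y2).
Let y3 := 8 * (2 * q * x2 + 6 * r * y2).

Lemma quad_inv_slice : [/\ quad_inv 0 f = 2 * x0 * x0 + 6 * y0 * y0,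
  quad_inv 1 f = 2 * x0 * x1 + 6 * y0 * y1, quad_inv 2 f = 2 * x0 * x2 + 6 * y0 * y2
  & quad_inv 3 f = 2 * x0 * x3 + 6 * y0 * y3].
Proof.
rewrite /quad_inv transv6_slice -/x0 -/y0; split; rewrite -mulmxA.
- by rewrite expr0 mul1mx quartic_form_vec.
- by rewrite expr1 transv4_vec quartic_form_vec.
- by rewrite -[_ ^+ 2]/(transv4 f *m transv4 f) -(mulmxA (transv4 f)) !transv4_vec quartic_form_vec.
rewrite -[_ ^+ 3]/(transv4 f *m (transv4 f *m transv4 f)) -!(mulmxA (transv4 f)) !transv4_vec.
exact: quartic_form_vec.
Qed.

(** The Gram determinant of v = (f, f)_6 and A v. On the plane the form is 2 x x' + 6 y y', of
    determinant 12. *)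
Lemma gram_slice : quad_inv 0 f * quad_inv 2 f - quad_inv 1 f ^+ 2 = 12 * (x1 * y0 - x0 * y1) ^+ 2.
Proof.
have [-> -> -> _] := quad_inv_slice; rewrite /x2 /y2 /x1 /y1.
by move: x0 y0 p q r => x y p' q' r'; ring.
Qed.

(** Cayley-Hamilton on the plane: if A^2 v = tau A v - delta v, the left side is tau times the Gram
    determinant, and the trace tau is 8 (p + 7 r) = 224 e1. *)
Lemma gram3_slice : quad_inv 0 f * quad_inv 3 f - quad_inv 1 f * quad_inv 2 f =
  224 * e1 * (quad_inv 0 f * quad_inv 2 f - quad_inv 1 f ^+ 2).
Proof.
have [-> -> -> ->] := quad_inv_slice.
have -> : 224 * e1 = 8 * (p + 7 * r) by rewrite /e1 /p /r; ring.
rewrite /x3 /y3 /x2 /y2 /x1 /y1.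
by move: x0 y0 p q r => x y p' q' r'; ring.
Qed.

(** In characteristic zero, v and A v are thus dependent only if two of [a], [b], [c] coincide or 15
    e1^2 + 4 e2 = 0. *)
Lemma gram_det_slice : x1 * y0 - x0 * y1 = 3 * 3125 * 4096 * 4096 *
  ((a - b) * (b - c) * (c - a)) * (15 * e1 ^+ 2 + 4 * e2).
Proof. by rewrite /x1 /y1 /x0 /y0 /p /q /r /e1 /e2; ring. Qed.

Lemma gram_value : quad_inv 0 f * quad_inv 2 f - quad_inv 1 f ^+ 2 =
  12 * (3 * 3125 * 4096 * 4096 * ((a - b) * (b - c) * (c - a)) * (15 * e1 ^+ 2 + 4 * e2)) ^+ 2.
Proof. by rewrite gram_slice gram_det_slice. Qed.

End SliceValues.

(** * Evaluation of invariants *)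

Lemma rmorph_mmap (k R S : comNzRingType) n (phi : {rmorphism R -> S}) (j : k -> R)
    (h : 'I_n -> R) (p : {mpoly k[n]}) :
  phi (mmap j h p) = mmap (phi \o j) (phi \o h) p.
Proof.
rewrite /mmap rmorph_sum; apply: eq_bigr => m _; rewrite rmorphM; congr (_ * _).
by rewrite /mmap1 rmorph_prod; apply: eq_bigr => i _; rewrite rmorphXn.
Qed.

Lemma eq_mmap (k R : comNzRingType) n (j j' : k -> R) (h h' : 'I_n -> R) (p : {mpoly k[n]}) :
  j =1 j' -> h =1 h' -> mmap j h p = mmap j' h' p.
Proof.
by move=> jj hh; apply: eq_bigr => m _; rewrite jj (mmap1_eq _ hh).
Qed.

Section Evaluation.
Context (k : closedFieldType).

Lemma octic_eval_scale d (I : {mpoly k[9]}) e (f : {poly k}) : I \is d.-homog ->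
  octic_eval idfun I (e *: f) = e ^+ d * octic_eval idfun I f.
Proof.
move=> /dhomogP hI; rewrite /octic_eval /mmap mulr_sumr; apply: eq_big_seq => m mI /=.
rewrite mulrCA; congr (_ * _); rewrite -(hI m mI) /mmap1 /= mdegE -prodrXr -big_split /=.
by apply: eq_bigr => i _; rewrite coefZ exprMn.
Qed.

(** Dividing the matrix by a square root of its determinant puts it in SL_2. The factor [t] is
    common to all invariants, so it cancels in quotients of equal degree. *)
Lemma octic_eval_equiv (f g : {poly k}) : octic_equiv f g -> exists2 t : k, t != 0 &
  forall d I, I \is d.-homog -> octic_invariant I ->
  octic_eval idfun I g = t ^+ d * octic_eval idfun I f.
Proof.
move=> [a [b [c [e [s [det s0 fg]]]]]]; have [r r2] := sqrt_exists (a * e - b * c).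
have r0 : r != 0 by apply: contraNneq det => r0; rewrite -r2 r0 expr0n.
exists (r ^+ 8 / s); first by rewrite mulf_neq0 ?expf_neq0 ?invr_neq0.
move=> d I homI invI.
have det1 : a / r * (e / r) - b / r * (c / r) = 1.
  by transitivity ((a * e - b * c) / r ^+ 2); [field | rewrite r2 divff].
have := invI _ _ _ _ f det1.
have -> : octic_subst (a / r) (b / r) (c / r) (e / r) f = (s / r ^+ 8) *: g.
  rewrite [s / r ^+ 8]mulrC -scalerA -fg scaler_sumr; apply: eq_bigr => i _.
  rewrite [RHS]scalerA [_ * f`_i]mulrC -[RHS]scalerA; congr (_ *: _).
  have lin u v : (u / r) *: 'X + (v / r)%:P = r^-1 *: (u *: 'X + v%:P).
    by rewrite scalerDr scalerA -[_ *: v%:P]mul_polyC -polyCM ![r^-1 * _]mulrC.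
  rewrite !lin !exprZn -scalerAl -scalerAr scalerA -exprD subnKC -1?ltnS //.
  by rewrite exprVn.
rewrite (octic_eval_scale _ _ homI) => <-; rewrite mulrA -exprMn.
have -> : r ^+ 8 / s * (s / r ^+ 8) = 1 by field; rewrite r0 s0.
by rewrite expr1n mul1r.
Qed.

Lemma absolute_value_equiv (f g : {poly k}) d (I J : {mpoly k[9]}) : octic_equiv f g ->
  I \is d.-homog -> J \is d.-homog -> octic_invariant I -> octic_invariant J ->
  octic_eval idfun I g / octic_eval idfun J g = octic_eval idfun I f / octic_eval idfun J f.
Proof.
move=> /octic_eval_equiv[t t0 ev] hI hJ iI iJ; rewrite (ev d I) // (ev d J) //.
by rewrite -mulf_div divff ?mul1r // expf_neq0.
Qed.

Lemma mpoly2_eq0 (p : {mpoly k[2]}) : (forall v, p.@[v] = 0) -> p = 0.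
Proof.
move=> p0; pose h (i : 'I_2) : {poly {poly k}} := if i == ord0 then 'X%:P else 'X.
pose psi : {mpoly k[2]} -> {poly {poly k}} := mmap (polyC \o polyC) h.
have ev x y : (psi p).[y%:P].[x] = 0.
  rewrite -[LHS]/((horner_eval x \o horner_eval y%:P) (mmap _ _ p)) rmorph_mmap.
  rewrite -[RHS](p0 (fun i => if i == ord0 then x else y)); apply: eq_mmap.
    by move=> c; rewrite /= /horner_eval !hornerC.
  by move=> i; rewrite /= /h /horner_eval; case: eqP => _; rewrite ?hornerC ?hornerX ?hornerC.
have psi0 : psi p = 0.
  apply/polyP => j; apply/polyP => i; rewrite !coef0.
  have : swapXY (psi p) = 0.
    apply/polyP => l; rewrite coef0; apply: poly0_of_vanishing => y.
    have e := poly0_of_vanishing (fun x => ev x y).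
    have : map_poly (horner_eval y) (swapXY (psi p)) = 0 by rewrite -horner_swapXY swapXYK.
    by move=> /(congr1 (fun q : {poly k} => q`_l)); rewrite coef_map coef0.
  by move=> e; rewrite -coef_swapXY e !coef0.
apply/mpolyP => m; rewrite mcoeff0.
have := congr1 (fun q : {poly {poly k}} => q`_(m ord_max)`_(m ord0)) psi0.
rewrite !coef0 /psi /mmap !coef_sum.
have coefE (m' : 'X_{1..2}) : (((polyC \o polyC) p@_m' * mmap1 h m')`_(m ord_max))`_(m ord0)
    = if m' == m then p@_m else 0.
  rewrite /= coefCM coefCM /mmap1 !big_ord_recl big_ord0 mulr1 /h /= -polyC_exp coefCM.
  rewrite coefXn; have -> : lift ord0 ord0 = ord_max :> 'I_2 by apply/val_inj.
  case: (m' =P m) => [->|ne]; first by rewrite eqxx mulr1 coefXn eqxx mulr1.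
  case: (_ =P m' ord_max) => [e1|_]; last by rewrite mulr0 coef0 mulr0.
  rewrite mulr1 coefXn; case: (_ =P m' ord0) => [e0|_]; last by rewrite mulr0.
  case: ne; apply/mnmP => -[[|[|//]] i2].
    by rewrite (_ : Ordinal i2 = ord0) ?e0 //; apply/val_inj.
  by rewrite (_ : Ordinal i2 = ord_max) ?e1 //; apply/val_inj.
rewrite (eq_bigr (fun m' => if m' == m then p@_m else 0)) => [|m' _]; last exact: coefE.
rewrite -big_mkcond /= => e; case: (boolP (m \in msupp p)) => [mp|].
  by move: e; rewrite -big_filter filter_pred1_uniq ?msupp_uniq // big_seq1.
by rewrite mcoeff_msupp negbK => /eqP.
Qed.

Lemma mpoly2_eq_off (q p : {mpoly k[2]}) : q != 0 -> (forall v, q.@[v] != 0 -> p.@[v] = 0) -> p = 0.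
Proof.
move=> q0 pq; apply/eqP; have : p * q = 0.
  apply: mpoly2_eq0 => v; rewrite mevalM.
  by case: (eqVneq q.@[v] 0) => [->|/pq ->]; rewrite ?mulr0 ?mul0r.
by move/eqP; rewrite mulf_eq0 (negPf q0) orbF.
Qed.

End Evaluation.

(** * The generic normal form *)

Section Families.
Context (k : closedFieldType) (char0 : [pchar k] =i pred0).

Definition family_eval (F : {poly {mpoly k[2]}}) (I : {mpoly k[9]}) : {mpoly k[2]} :=
  mmap (@mpolyC 2 k) (fun i : 'I_9 => F`_i) I.

Lemma meval_family F I v :
  (family_eval F I).@[v] = octic_eval idfun I (map_poly (meval v) F).
Proof.
rewrite /family_eval -[LHS]/((meval v : {rmorphism _ -> _}) _) rmorph_mmap.
by apply: eq_mmap => [c|i]; rewrite /= ?mevalC ?coef_map.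
Qed.

Lemma tofrac_family F I : tofrac (family_eval F I) =
  octic_eval (@ratfun2C k) I (map_poly (@FracField.tofrac _) F).
Proof. by rewrite rmorph_mmap; apply: eq_mmap => [c|i] //=; rewrite coef_map. Qed.

Lemma locus_slice (f : {poly k}) : locus Z2_cubed f ->
  exists a b c : k, good_octic (slice a b c) /\ octic_equiv f (slice a b c).
Proof.
move=> [L [iota [gf aut]]]; have [a [b [c g1]]] := genus3_slice char0 gf aut.
exists a, b, c; split; first exact: genus3_good g1.
exact: (genus3_equation_unique char0 gf g1).
Qed.

Lemma normal_form_slice (a b c : k) : a != 0 ->
  octic_equiv (slice a b c) (normal_form (4 * (c - b) / a) ((8 * (b + c) - 2 * a) / a - 2)).
Proof.
move=> a0; have sE : slice a b c =
    a *: normal_form (4 * (c - b) / a) ((8 * (b + c) - 2 * a) / a - 2).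
  apply: (poly_eq_off (oner_neq0 _)) => x _.
  rewrite hornerZ horner_slice /normal_form !hornerE /=; field.
  exact: a0.
exists 1, 0, 0, 1, a; rewrite mul1r mul0r subr0 oner_neq0; split=> //.
by rewrite -[LHS]/(moebius_sub 8 1 0 0 1 _) moebius_sub_scalar ?size_slice // expr1n scale1r.
Qed.

Lemma octic_eval_equiv_neq0 (f g : {poly k}) d (J : {mpoly k[9]}) : octic_equiv f g ->
  J \is d.-homog -> octic_invariant J ->
  (octic_eval idfun J g == 0) = (octic_eval idfun J f == 0).
Proof.
move=> /octic_eval_equiv[t t0 ev] hJ iJ; rewrite (ev d J) // mulf_eq0.
by rewrite (negPf (expf_neq0 d t0)).
Qed.

Definition pt2 (R : Type) (x y : R) (i : 'I_2) : R := if i == ord0 then x else y.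

Definition X0 : {mpoly k[2]} := 'X_(inord 0).
Definition X1 : {mpoly k[2]} := 'X_(inord 1).

Lemma inord0_2 : inord 0 = ord0 :> 'I_2. Proof. by apply/val_inj; rewrite /= inordK. Qed.
Lemma inord1_2 : (inord 1 == ord0 :> 'I_2) = false.
Proof. by rewrite -val_eqE /= inordK. Qed.

Lemma meval_X0 v : X0.@[v] = v ord0. Proof. by rewrite /X0 mevalXU inord0_2. Qed.
Lemma meval_X1 v : X1.@[v] = v (inord 1). Proof. by rewrite /X1 mevalXU. Qed.
Lemma pt2_X0 x y : X0.@[pt2 x y] = x. Proof. by rewrite meval_X0. Qed.
Lemma pt2_X1 x y : X1.@[pt2 x y] = y. Proof. by rewrite meval_X1 /pt2 inord1_2. Qed.

Lemma map_normal_form (R S : comNzRingType) (phi : {rmorphism R -> S}) u v :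
  map_poly phi (normal_form u v) = normal_form (phi u) (phi v).
Proof.
rewrite /normal_form !rmorphD /= !map_polyZ /= !map_polyXn rmorphD rmorph_nat /=.
by rewrite rmorph1.
Qed.

Lemma natr_ratfun2_neq0 n : n.+1%:R != 0 :> ratfun2 k.
Proof.
by rewrite -(rmorph_nat (@FracField.tofrac _)) tofrac_eq0 -(rmorph_nat (@mpolyC 2 k))
  mpolyC_eq0 (natS_neq0 char0).
Qed.

Lemma dihedral_s3_normal_form (F : fieldType) (u v : F) : 2%:R != 0 :> F -> u != 0 ->
  v = dihedral_s3 u (v + 2) u / (2%:R * u ^+ 2) - 2%:R.
Proof. by move=> two0 u0; rewrite /dihedral_s3; field; rewrite two0 u0. Qed.

Lemma half_double (F : fieldType) (x : F) : 2%:R != 0 :> F -> x = 2%:R^-1 * (x + x).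
Proof. by move=> two0; field; rewrite two0. Qed.

Lemma k_s2_s3_gens : [/\ is_subfield (@k_s2_s3 k), forall c : k, k_s2_s3 (ratfun2C c),
  k_s2_s3 (gen_u k ^+ 2) & k_s2_s3 (gen_v k)].
Proof.
have sE : is_subfield (@k_s2_s3 k) := subfield_gen_is_subfield _.
have [E0 E1 Ea Em Ei] := subfield_closure sE; have [_ Es Ed] := sE.
have Ec (c : k) : k_s2_s3 (ratfun2C c) by move=> E _; apply; right; right; exists c.
have E2 : k_s2_s3 (gen_u k ^+ 2) by move=> E _; apply; left.
have E3 : k_s2_s3 (generic_s3 k) by move=> E _; apply; right; left.
split=> //; have En n : k_s2_s3 (n%:R : ratfun2 k).
  by elim: n => [|n IH] //; rewrite -natr1; apply: (Ea).
have u0 : gen_u k != 0.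
  rewrite tofrac_eq0; apply/eqP => /(congr1 (meval (fun=> 1))) /eqP.
  by rewrite mevalXU meval0 oner_eq0.
have -> : gen_v k = generic_s3 k / (2%:R * gen_u k ^+ 2) - 2%:R.
  exact: dihedral_s3_normal_form (natr_ratfun2_neq0 1) u0.
by apply: (Es) => //; apply: (Ed) => //; apply: (Em).
Qed.

Lemma octic_eval_subfield (E : ratfun2 k -> Prop) (I : {mpoly k[9]}) (f : {poly ratfun2 k}) :
  is_subfield E ->
  (forall c, E (ratfun2C c)) -> (forall i, E f`_i) -> E (octic_eval (@ratfun2C k) I f).
Proof.
move=> sE Ec Ef; have [E0 E1 Ea Em Ei] := subfield_closure sE.
apply: (big_ind E) => // m _; apply: (Em); first exact: Ec.
by apply: (big_ind E) => // i _; elim: (m i) => [|n IH]; rewrite ?expr0 ?exprS //; apply: (Em).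
Qed.

Lemma regular_normal_form I J : regular_on (@locus k Z2_cubed) I J ->
  let F := normal_form (gen_u k) (gen_v k) in
  octic_eval (@ratfun2C k) J F != 0 /\
  k_s2_s3 (octic_eval (@ratfun2C k) I F / octic_eval (@ratfun2C k) J F).
Proof.
move=> [[iI [iJ [d [hI hJ]]]] [f [Sf Jf]]] F.
pose F2 := normal_form X0 X1.
have FE : F = map_poly (@FracField.tofrac _) F2 by rewrite map_normal_form.
have ev v K : (family_eval F2 K).@[v] = octic_eval idfun K (normal_form X0.@[v] X1.@[v]).
  by rewrite meval_family map_normal_form.
split.
  rewrite FE -tofrac_family tofrac_eq0; have [a [b [c [gs eqv]]]] := locus_slice Sf.
  have [a0 _ _ _] := (slice_goodP char0 a b c).1 gs.
  have := normal_form_slice b c a0; set u := _ / a; set w := _ / a - 2 => eqv2.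
  apply: contraNneq Jf => J0.
  rewrite -(octic_eval_equiv_neq0 eqv hJ iJ) -(octic_eval_equiv_neq0 eqv2 hJ iJ).
  by have := ev (pt2 u w) J; rewrite J0 meval0 pt2_X0 pt2_X1 => <-.
have [sE Ec E2 E3] := k_s2_s3_gens; have [_ _ Ed] := sE.
have [E0 E1 Ea Em Ei] := subfield_closure sE.
suff even K : octic_invariant K -> k_s2_s3 (octic_eval (@ratfun2C k) K F).
  by apply: (Ed); apply: even.
move=> iK; have [i i2] := imaginary_exists k; have [z z2] := sqrt_exists i.
have z0 : z != 0.
  apply: contraTneq (oner_neq0 k) => z0.
  by rewrite -[1]opprK -i2 -z2 z0 !expr0n oppr0 eqxx.
have inv u v : octic_eval idfun K (normal_form u v) = octic_eval idfun K (normal_form (- u) v).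
  have det : z * z^-1 - 0 * 0 = 1 by rewrite mulfV // mulr0 subr0.
  rewrite -(iK _ _ _ _ (normal_form u v) det); congr (octic_eval _ _ _).
  rewrite -[RHS]scale1r; apply: octic_subst_eq.
  - have := size_slice 16 (v + 4 - 2 * u) (v + 4 + 2 * u).
    by rewrite slice_normal_form size_scale // (natS_neq0 char0 15).
  - by rewrite det oner_neq0.
  move=> x _; rewrite mul0r add0r addr0.
  have z4 : z ^+ 4 = -1 by rewrite -[4%N]/(2 * 2)%N exprM z2 i2.
  have z8 : z ^+ 8 = 1 by rewrite -[8%N]/(4 * 2)%N exprM z4 sqrrN expr1n.
  have -> : z * x / z^-1 = i * x by rewrite -z2; field; rewrite z0 oner_neq0.
  have i4 : i ^+ 4 = 1 by rewrite -[4%N]/(2 * 2)%N exprM i2 sqrrN expr1n.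
  have i6 : i ^+ 6 = -1 by rewrite -[6%N]/(4 + 2)%N exprD i4 i2 mul1r.
  have i8 : i ^+ 8 = 1 by rewrite -[8%N]/(4 * 2)%N exprM i4 expr1n.
  have h1 y : (1 : {poly k}).[y] = 1 := hornerC 1 y.
  rewrite exprVn z8 invr1 !mul1r /normal_form !hornerD !hornerZ !hornerXn !h1.
  by rewrite !exprMn i8 i6 i4 i2; ring.
pose G2 := normal_form (- X0) X1.
have e : family_eval F2 K = family_eval G2 K.
  apply/eqP; rewrite -subr_eq0; apply/eqP; apply: mpoly2_eq0 => v.
  by rewrite mevalB ev meval_family map_normal_form rmorphN inv subrr.
have two0 := natr_ratfun2_neq0 1.
(* Averaging the values at [u] and [-u] removes the odd powers of [u] monomial by monomial. *)
have -> : octic_eval (@ratfun2C k) K F = 2%:R^-1 * (octic_eval (@ratfun2C k) K F +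
    octic_eval (@ratfun2C k) K (normal_form (- gen_u k) (gen_v k))).
  have -> : octic_eval (@ratfun2C k) K (normal_form (- gen_u k) (gen_v k))
      = octic_eval (@ratfun2C k) K F.
    rewrite FE -tofrac_family e tofrac_family map_normal_form rmorphN.
    by [].
  exact: half_double.
apply: (Em); first by apply: (Ei _ _).2 => //; rewrite mulr2n; apply: (Ea).
pose C : {rmorphism k -> ratfun2 k} := @FracField.tofrac _ \o @mpolyC 2 k.
have sub w : octic_eval (@ratfun2C k) K (normal_form w (gen_v k)) =
    mmap C (pt2 w (gen_v k)) (family_eval F2 K).
  rewrite /family_eval -[RHS]/((mmap C (pt2 w (gen_v k)) : {rmorphism _ -> _}) _) rmorph_mmap.
  apply: eq_mmap => [c|i'] /=; first by rewrite mmapC.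
  rewrite -coef_map map_normal_form /= /X0 /X1 !mmapX !mmap1U.
  by rewrite /pt2 inord1_2 inord0_2.
rewrite !sub -big_split /=; apply: (big_ind (@k_s2_s3 k)) => // m _.
rewrite -mulrDr; apply: (Em); first exact: Ec.
rewrite /mmap1 !big_ord_recl !big_ord0 !mulr1 /pt2 /= -mulrDl.
apply: (Em); last by elim: (m _) => [|n IH]; rewrite ?expr0 ?exprS //; apply: (Em).
have Eu n : k_s2_s3 ((gen_u k ^+ 2) ^+ n).
  elim: n => [|n IH]; first by rewrite expr0.
  by rewrite (exprS (gen_u k ^+ 2)); exact: (Em _ _ E2 IH).
have hX (x : ratfun2 k) n : x ^+ n = x ^+ odd n * (x ^+ 2) ^+ n./2.
  by rewrite -exprM mul2n -exprD odd_double_half.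
rewrite (hX (gen_u k)) (hX (- gen_u k)) sqrrN; set b := odd _; clearbody b.
case: b; first by rewrite !expr1 mulNr addrN.
by rewrite !expr0 !mul1r; apply: (Ea); apply: Eu.
Qed.

End Families.

(** * The generic descended octic *)

Lemma map_descent_octic (R S : comNzRingType) (phi : {rmorphism R -> S}) e1 e2 e3 :
  map_poly phi (descent_octic e1 e2 e3) = descent_octic (phi e1) (phi e2) (phi e3).
Proof.
by rewrite map_Poly /= !(rmorphD phi, rmorphN phi) !(rmorphXn phi, rmorph_nat phi, rmorphM phi).
Qed.

Section Locus.
Context (k : closedFieldType) (char0 : [pchar k] =i pred0).

Lemma cubic_roots (e1 e2 e3 : k) : exists a b c,
  [/\ a + b + c = e1, a * b + a * c + b * c = e2 & a * b * c = e3].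
Proof.
have two0 : (2 : k) != 0 := natS_neq0 char0 1.
have [a] := @solve_monicpoly k 3 (nth 0 [:: e3; - e2; e1]) isT.
rewrite !big_ord_recl big_ord0 /= /bump /= expr0 mulr1 addr0 => ra.
have {}ra : a ^+ 3 = e3 + (- e2 * a + e1 * a ^+ 2) := ra.
have four0 : (4 : k) != 0 := natS_neq0 char0 3.
have [s s2] := sqrt_exists ((e1 - a) ^+ 2 - 4 * (e2 - a * (e1 - a))).
exists a, ((e1 - a + s) / 2), ((e1 - a - s) / 2); split.
- by field.
- apply: (@eq_of_multiple _ (- 4^-1) _ _ _ _ s2); field.
  by rewrite two0 four0.
transitivity (a * ((e1 - a) ^+ 2 - s ^+ 2) / 4); first by field; rewrite two0 four0.
rewrite s2; apply: (@eq_of_multiple _ 1 _ _ _ _ ra); field.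
exact: four0.
Qed.

Definition cubic_disc (R : comNzRingType) (e1 e2 e3 : R) : R :=
  e1 ^+ 2 * e2 ^+ 2 - 4 * e2 ^+ 3 - 4 * e1 ^+ 3 * e3 + 18 * e1 * e2 * e3 - 27 * e3 ^+ 2.

Lemma slice_of_symmetric_functions (e1 e2 e3 : k) : e3 != 0 -> e1 ^+ 2 - 4 * e2 != 0 ->
  cubic_disc e1 e2 e3 != 0 -> exists a b c, [/\ good_octic (slice a b c),
    [/\ a != b, b != c & c != a],
    [/\ a + b + c = e1, a * b + a * c + b * c = e2 & a * b * c = e3]
    & octic_equiv (slice a b c) (descent_octic e1 e2 e3)].
Proof.
move=> e30 D0 disc0; have [a [b [c [E1 E2 E3]]]] := cubic_roots e1 e2 e3.
have discE : cubic_disc e1 e2 e3 = ((a - b) * (b - c) * (c - a)) ^+ 2.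
  by rewrite /cubic_disc -E1 -E2 -E3; ring.
move: disc0 e30; rewrite discE -E3 expf_eq0 /= !mulf_eq0 !negb_or !subr_eq0.
move=> /andP[/andP[ab bc] ca] /andP[/andP[a0 b0] c0].
have D0' : slice_disc a b c != 0.
  rewrite (_ : slice_disc a b c = e1 ^+ 2 - 4 * e2) //.
  by rewrite /slice_disc -E1 -E2; ring.
exists a, b, c; split=> //; first exact/slice_goodP.
by rewrite -E1 -E2; apply: slice_descent.
Qed.

(** The coefficient of X^i is weighted homogeneous of weight 14 - i in e1, e2, e3, which explains
    the factor t^-6 for the matrix diag(1, t). *)
Lemma descent_octic_scale (t e1 e2 e3 : k) : t != 0 ->
  octic_equiv (descent_octic e1 e2 e3) (descent_octic (t * e1) (t ^+ 2 * e2) (t ^+ 3 * e3)).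
Proof.
move=> t0; exists 1, 0, 0, t, (t ^- 6); rewrite mul1r mul0r subr0 t0 invr_neq0 ?expf_neq0 //.
split=> //; apply: octic_subst_eq => [||x _]; first exact: size_Poly.
  by rewrite mul1r mul0r subr0.
rewrite mul0r add0r addr0 mul1r !horner_Poly /=; field.
by rewrite t0.
Qed.

Definition generic_descent : {poly {mpoly k[2]}} := descent_octic 1 (@X0 k ^+ 2) (@X1 k).
Definition descent_K : {poly ratfun2 k} := descent_octic 1 (gen_u k ^+ 2) (gen_v k).

Lemma descent_KE : descent_K = map_poly (@FracField.tofrac _) generic_descent.
Proof. by rewrite map_descent_octic rmorph1 rmorphXn. Qed.

Lemma meval_generic_descent I v : (family_eval generic_descent I).@[v] =
  octic_eval idfun I (descent_octic 1 ((@X0 k).@[v] ^+ 2) (@X1 k).@[v]).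
Proof. by rewrite meval_family map_descent_octic rmorph1 rmorphXn. Qed.

Lemma octic_eval_descent_K I : (octic_eval (@ratfun2C k) I descent_K == 0) =
  (family_eval generic_descent I == 0).
Proof. by rewrite descent_KE -tofrac_family tofrac_eq0. Qed.

(** Off its zeros the descended octic comes from a good slice with distinct parameters, and [gram3]
    does not vanish there. *)
Definition generic_cond : {mpoly k[2]} :=
  X1 k * (1 - 4 * X0 k ^+ 2) * cubic_disc 1 (X0 k ^+ 2) (X1 k) * (15 + 4 * X0 k ^+ 2).

Lemma meval_generic_cond v : generic_cond.@[v] =
  (X1 k).@[v] * (1 - 4 * (X0 k).@[v] ^+ 2) *
  cubic_disc 1 ((X0 k).@[v] ^+ 2) (X1 k).@[v] * (15 + 4 * (X0 k).@[v] ^+ 2).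
Proof.
rewrite /generic_cond /cubic_disc.
have hM (n : nat) (p : {mpoly k[2]}) : (n%:R * p).@[v] = n%:R * p.@[v].
  by rewrite mevalM -[X in X * _ = _]/((meval v : {rmorphism _ -> _}) n%:R) rmorph_nat.
have h1 : (1 : {mpoly k[2]}).@[v] = 1 by exact: meval1.
have hX (p : {mpoly k[2]}) n : (p ^+ n).@[v] = p.@[v] ^+ n.
  by rewrite -[LHS]/((meval v : {rmorphism _ -> _}) _) rmorphXn.
have h15 : (15 : {mpoly k[2]}).@[v] = 15.
  by rewrite -[LHS]/((meval v : {rmorphism _ -> _}) 15%:R) rmorph_nat.
by rewrite !(h15, h1, hX, hM, mevalM, mevalD, mevalN).
Qed.

Lemma generic_cond_neq0 : generic_cond != 0.
Proof.
apply/eqP => /(congr1 (meval (pt2 0 1))) /eqP; rewrite meval_generic_cond pt2_X0 pt2_X1 meval0.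
rewrite expr0n /= mulr0 subr0 !mul1r addr0 mulf_eq0 (negPf (natS_neq0 char0 14)) orbF.
have -> : cubic_disc 1 0 1 = - 31 :> k by rewrite /cubic_disc; ring.
by rewrite oppr_eq0 (negPf (natS_neq0 char0 30)).
Qed.

Lemma generic_point v : generic_cond.@[v] != 0 -> exists a b c, [/\ good_octic (slice a b c),
    [/\ a != b, b != c & c != a],
    [/\ a + b + c = 1, a * b + a * c + b * c = (X0 k).@[v] ^+ 2 & a * b * c = (X1 k).@[v]],
    octic_equiv (slice a b c) (descent_octic 1 ((X0 k).@[v] ^+ 2) (X1 k).@[v])
    & 15 + 4 * (X0 k).@[v] ^+ 2 != 0].
Proof.
rewrite meval_generic_cond !mulf_eq0 !negb_or => /andP[/andP[/andP[y0 D0] disc0] n0].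
have [|a [b [c [H1 H2 H3 H4]]]] := slice_of_symmetric_functions y0 _ disc0; first by rewrite expr1n.
by exists a, b, c.
Qed.

(** A density argument in both directions: generic descended octics are equivalent to curves of the
    locus, and generic slices descend and rescale to e1 = 1. *)
Lemma vanish_on_locus d (I : {mpoly k[9]}) : I \is d.-homog -> octic_invariant I ->
  (forall f, locus Z2_cubed f -> octic_eval idfun I f = 0) <->
  octic_eval (@ratfun2C k) I descent_K = 0.
Proof.
move=> hI iI; split=> [van|/eqP].
  apply/eqP; rewrite octic_eval_descent_K; apply/eqP; apply: (mpoly2_eq_off generic_cond_neq0) => v.
  move=> /generic_point[a [b [c [gs _ _ eqv _]]]].
  rewrite meval_generic_descent; apply/eqP; rewrite (octic_eval_equiv_neq0 eqv hI iI).
  by apply/eqP/van/slice_locus.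
rewrite octic_eval_descent_K => /eqP van f /locus_slice-/(_ char0)[a [b [c [gs eqv]]]].
apply/eqP; rewrite -(octic_eval_equiv_neq0 eqv hI iI).
have [a0 _ _ _] := (slice_goodP char0 a b c).1 gs.
(* Off the zeros of [Q] the slice with parameters 1, X0, X1 descends and has nonzero e1. Vanishing
   there forces vanishing on the whole family, hence also on good slices with coinciding parameters
   or e1 = 0. *)
pose Q : {mpoly k[2]} := X0 k * X1 k * (1 - X0 k) * (X0 k - X1 k) * (X1 k - 1)
  * (1 + X0 k + X1 k) * slice_disc 1 (X0 k) (X1 k).
pose SF := slice 1 (X0 k) (X1 k).
have map_slice v : map_poly (meval v) SF = slice 1 (X0 k).@[v] (X1 k).@[v].
  rewrite map_Poly; congr Poly; rewrite /=.
  have hM (n : nat) (p : {mpoly k[2]}) : (n%:R * p).@[v] = n%:R * p.@[v].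
    by rewrite mevalM -[X in X * _ = _]/((meval v : {rmorphism _ -> _}) n%:R) rmorph_nat.
  by rewrite !(hM, mevalD, mevalN, meval0, meval1).
have QE v : Q.@[v] = (X0 k).@[v] * (X1 k).@[v] * (1 - (X0 k).@[v]) * ((X0 k).@[v] - (X1 k).@[v])
  * ((X1 k).@[v] - 1) * (1 + (X0 k).@[v] + (X1 k).@[v]) * slice_disc 1 (X0 k).@[v] (X1 k).@[v].
  have hM (p : {mpoly k[2]}) : (2 * p).@[v] = 2 * p.@[v].
    by rewrite mevalM -[X in X * _ = _]/((meval v : {rmorphism _ -> _}) 2%:R) rmorph_nat.
  have hX (p : {mpoly k[2]}) n : (p ^+ n).@[v] = p.@[v] ^+ n.
    by rewrite -[LHS]/((meval v : {rmorphism _ -> _}) _) rmorphXn.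
  by rewrite /Q /slice_disc !(hM, hX, mevalM, mevalD, mevalN, meval1).
have Q0 : Q != 0.
  apply/eqP => /(congr1 (meval (pt2 2 3))) /eqP; rewrite QE pt2_X0 pt2_X1 meval0.
  have -> : 2 * 3 * (1 - 2) * (2 - 3) * (3 - 1) * (1 + 2 + 3) * slice_disc 1 2 3 = - 576 :> k.
    by rewrite /slice_disc; ring.
  by rewrite oppr_eq0 (negPf (natS_neq0 char0 575)).
have fam0 : family_eval SF I = 0.
  apply: (mpoly2_eq_off Q0) => v; rewrite QE !mulf_eq0 !negb_or !subr_eq0.
  move=> /andP[/andP[/andP[/andP[/andP[/andP[b0 c0] ab] bc] ca] e10] D0].
  rewrite meval_family map_slice; set B := _.@[v] in b0 ab bc e10 D0 *.
  set C := _.@[v] in c0 bc ca e10 D0 *; apply/eqP.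
  have one0 : (1 : k) != 0 := oner_neq0 k.
  have e1 : octic_equiv (slice 1 B C) (descent_octic (1 + B + C) (1 * B + 1 * C + B * C) (1 * B * C)).
    by apply: slice_descent; rewrite // eq_sym.
  have e2 := descent_octic_scale (1 + B + C) (1 * B + 1 * C + B * C) (1 * B * C) (invr_neq0 e10).
  rewrite -(octic_eval_equiv_neq0 e1 hI iI) -(octic_eval_equiv_neq0 e2 hI iI) mulVf //.
  have [x x2] := sqrt_exists ((1 + B + C)^-1 ^+ 2 * (1 * B + 1 * C + B * C)).
  have := meval_generic_descent I (pt2 x ((1 + B + C)^-1 ^+ 3 * (1 * B * C))).
  by rewrite van meval0 pt2_X0 pt2_X1 x2 => <-.
have sc : octic_equiv (slice a b c) (slice 1 (b / a) (c / a)).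
  have -> : slice a b c = a *: slice 1 (b / a) (c / a).
    by rewrite -slice_scale; congr slice; field.
  exists 1, 0, 0, 1, a; rewrite mul1r mul0r subr0 oner_neq0; split=> //.
  rewrite -[LHS]/(moebius_sub 8 1 0 0 1 _) moebius_sub_scalar ?expr1n ?scale1r //.
  by rewrite (leq_trans (size_scale_leq _ _)) ?size_slice.
rewrite -(octic_eval_equiv_neq0 sc hI iI).
by have := meval_family SF I (pt2 (b / a) (c / a)); rewrite fam0 meval0 map_slice pt2_X0 pt2_X1 => <-.
Qed.

End Locus.

(* [gram] and [gram3] differ by the factor [224 * e1] on the slice, which makes
   the weights of [e2] and [e3] even out in the quotients below. *)
Definition gram : octic_form := fun R f =>
  quad_inv 0 f * quad_inv 2 f + (quad_inv 1 f * quad_inv 1 f) *~ (-1).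

Definition gram3 : octic_form := fun R f =>
  quad_inv 0 f * quad_inv 3 f + (quad_inv 1 f * quad_inv 2 f) *~ (-1).

(** The coefficients 45 and -14 cancel e1^2 between the square of 224 e1 and [tr_inv 2]; what
    remains is proportional to e2. *)
Definition e2_num : octic_form := fun R f =>
  (gram3 f * gram3 f) *~ 45 + (tr_inv 2 f * (gram f * gram f)) *~ (-14).

Definition e2_den : octic_form := fun R f => (gram3 f * gram3 f) *~ 100.

(** The three coefficients cancel both e1^3 and e1 e2 among the cube of 224 e1, its product with
    [tr_inv 2], and [tr_inv 3]; what remains is proportional to e3. *)
Definition e3_num : octic_form := fun R f =>
  (gram3 f * (gram3 f * gram3 f)) *~ 510 + (gram3 f * (tr_inv 2 f * (gram f * gram f))) *~ (-231)
  + (tr_inv 3 f * (gram f * (gram f * gram f))) *~ (-686).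

Definition e3_den : octic_form := fun R f => (gram3 f * (gram3 f * gram3 f)) *~ 6000.

Lemma gram_form : invariant_form 10 gram.
Proof.
exact: (invariant_formD (invariant_formM (quad_inv_form 0) (quad_inv_form 2))
  (invariant_formZ (-1) (invariant_formM (quad_inv_form 1) (quad_inv_form 1)))).
Qed.

Lemma gram3_form : invariant_form 11 gram3.
Proof.
exact: (invariant_formD (invariant_formM (quad_inv_form 0) (quad_inv_form 3))
  (invariant_formZ (-1) (invariant_formM (quad_inv_form 1) (quad_inv_form 2)))).
Qed.

Lemma e2_num_form : invariant_form 22 e2_num.
Proof.
exact: (invariant_formD (invariant_formZ 45 (invariant_formM gram3_form gram3_form))
  (invariant_formZ (-14) (invariant_formM (tr_inv_form 2) (invariant_formM gram_form gram_form)))).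
Qed.

Lemma e2_den_form : invariant_form 22 e2_den.
Proof. exact: (invariant_formZ 100 (invariant_formM gram3_form gram3_form)). Qed.

Lemma e3_num_form : invariant_form 33 e3_num.
Proof.
exact: (invariant_formD (invariant_formD (invariant_formZ 510 (invariant_formM gram3_form (invariant_formM gram3_form gram3_form)))
  (invariant_formZ (-231) (invariant_formM gram3_form (invariant_formM (tr_inv_form 2) (invariant_formM gram_form gram_form)))))
  (invariant_formZ (-686) (invariant_formM (tr_inv_form 3) (invariant_formM gram_form (invariant_formM gram_form gram_form))))).
Qed.

Lemma e3_den_form : invariant_form 33 e3_den.
Proof. exact: (invariant_formZ 6000 (invariant_formM gram3_form (invariant_formM gram3_form gram3_form))). Qed.

Section Values.
Context (R : comNzRingType) (a b c : R).
Let f (i : nat) := (slice a b c)`_i.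
Let e1 := a + b + c.
Let e2 := a * b + a * c + b * c.
Let e3 := a * b * c.

Lemma gramE : gram f =
  12 * (3 * 3125 * 4096 * 4096 * ((a - b) * (b - c) * (c - a)) * (15 * e1 ^+ 2 + 4 * e2)) ^+ 2.
Proof. by rewrite -gram_value /gram mulrN1z. Qed.

Lemma gram3E : gram3 f = 224 * e1 * gram f.
Proof. by rewrite /gram3 /gram !mulrN1z; exact: gram3_slice. Qed.

Lemma e2_numE : e2_num f * e1 ^+ 2 = e2_den f * e2.
Proof.
rewrite /e2_num /e2_den gram3E tr_inv2_slice -/e1 -/e2; move: (gram f) e1 e2 => G s t.
by ring.
Qed.

Lemma e3_numE : e3_num f * e1 ^+ 3 = e3_den f * e3.
Proof.
rewrite /e3_num /e3_den gram3E tr_inv2_slice tr_inv3_slice -/e1 -/e2 -/e3.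
move: (gram f) e1 e2 e3 => G s t u.
by ring.
Qed.

End Values.

(** * The function field of the locus *)

Lemma octic_evalM (k : fieldType) (I J : {mpoly k[9]}) f :
  octic_eval idfun (I * J) f = octic_eval idfun I f * octic_eval idfun J f.
Proof. exact: (rmorphM (mmap idfun (fun i : 'I_9 => f`_i))). Qed.

Lemma octic_evalD (k : fieldType) (I J : {mpoly k[9]}) f :
  octic_eval idfun (I + J) f = octic_eval idfun I f + octic_eval idfun J f.
Proof. exact: (rmorphD (mmap idfun (fun i : 'I_9 => f`_i))). Qed.

Lemma octic_evalN (k : fieldType) (I : {mpoly k[9]}) f :
  octic_eval idfun (- I) f = - octic_eval idfun I f.
Proof. exact: (rmorphN (mmap idfun (fun i : 'I_9 => f`_i))). Qed.

Lemma octic_invariantM (k : fieldType) (I J : {mpoly k[9]}) :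
  octic_invariant I -> octic_invariant J -> octic_invariant (I * J).
Proof. by move=> iI iJ a b c d f det; rewrite !octic_evalM iI // iJ. Qed.

Lemma octic_invariantD (k : fieldType) (I J : {mpoly k[9]}) :
  octic_invariant I -> octic_invariant J -> octic_invariant (I + J).
Proof. by move=> iI iJ a b c d f det; rewrite !octic_evalD iI // iJ. Qed.

Lemma octic_invariantN (k : fieldType) (I : {mpoly k[9]}) :
  octic_invariant I -> octic_invariant (- I).
Proof. by move=> iI a b c d f det; rewrite !octic_evalN iI. Qed.

Lemma octic_invariantC (k : fieldType) (c : k) : octic_invariant c%:MP.
Proof. by move=> a b e d f _; rewrite /octic_eval !mmapC. Qed.

Lemma absolute_invariantM (k : fieldType) (I J I' J' : {mpoly k[9]}) :
  absolute_invariant I J -> absolute_invariant I' J' -> absolute_invariant (I * I') (J * J').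
Proof.
move=> [iI [iJ [d [hI hJ]]]] [iI' [iJ' [d' [hI' hJ']]]].
split; first exact: octic_invariantM.
split; first exact: octic_invariantM.
by exists (d + d')%N; split; apply: dhomogM.
Qed.

Lemma absolute_invariantD (k : fieldType) (I I' J : {mpoly k[9]}) : J != 0 ->
  absolute_invariant I J -> absolute_invariant I' J -> absolute_invariant (I + I') J.
Proof.
move=> J0 [iI [iJ [d [hI hJ]]]] [iI' [_ [d' [hI' hJ']]]].
split; first exact: octic_invariantD.
split=> //; exists d; split=> //; apply: rpredD => //.
by rewrite -(dhomog_uniq J0 hJ' hJ).
Qed.

Lemma absolute_invariantV (k : fieldType) (I J : {mpoly k[9]}) :
  absolute_invariant I J -> absolute_invariant J I.
Proof. by move=> [iI [iJ [d [hI hJ]]]]; do 2?split=> //; exists d. Qed.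

Lemma absolute_invariantN (k : fieldType) (I J : {mpoly k[9]}) :
  absolute_invariant I J -> absolute_invariant (- I) J.
Proof.
move=> [iI [iJ [d [hI hJ]]]]; split; first exact: octic_invariantN.
by split=> //; exists d; split=> //; rewrite -scaleN1r; apply: rpredZ.
Qed.

Lemma absolute_invariantC (k : fieldType) (c e : k) :
  absolute_invariant (c%:MP : {mpoly k[9]}) e%:MP.
Proof.
split; first exact: octic_invariantC.
split; first exact: octic_invariantC.
by exists 0%N; split; rewrite -[_%:MP]mulr1 mul_mpolyC; apply: rpredZ; exact: dhomog1.
Qed.

Section FunctionField.
Context (k : closedFieldType) (char0 : [pchar k] =i pred0).
Implicit Types I J : {mpoly k[9]}.

Definition ratC : {rmorphism k -> ratfun2 k} := @FracField.tofrac _ \o @mpolyC 2 k.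

Definition restr I : ratfun2 k := octic_eval (@ratfun2C k) I (descent_K k).

Let restr_morph : {rmorphism {mpoly k[9]} -> ratfun2 k} :=
  mmap ratC (fun i : 'I_9 => (descent_K k)`_i).

Lemma restrM I J : restr (I * J) = restr I * restr J.
Proof. exact: (rmorphM restr_morph). Qed.

Lemma restrD I J : restr (I + J) = restr I + restr J.
Proof. exact: (rmorphD restr_morph). Qed.

Lemma restrB I J : restr (I - J) = restr I - restr J.
Proof. exact: (rmorphB restr_morph). Qed.

Lemma restr0 : restr 0 = 0.
Proof. exact: (rmorph0 restr_morph). Qed.

Lemma restrC c : restr c%:MP = ratfun2C c.
Proof. by rewrite /restr /octic_eval (mmapC _ ratC). Qed.

Lemma restrE I : restr I = tofrac (family_eval (generic_descent k) I).
Proof. by rewrite tofrac_family -descent_KE. Qed.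

(** Restriction to the locus is evaluation at the generic descended octic. The values lie in a
    field, which gives the irreducibility of the locus. *)
Lemma regular_onP I J : regular_on (locus Z2_cubed) I J <-> absolute_invariant I J /\ restr J != 0.
Proof.
split=> [[abs [f [Sf Jf]]]|[abs J0]]; have [_ [iJ [d [_ hJ]]]] := abs.
  split=> //; apply: contraNneq Jf => J0; apply/eqP.
  exact: ((vanish_on_locus char0 hJ iJ).2 J0).
split=> //; apply: NNPP => nex; move/eqP: J0; apply.
apply: (vanish_on_locus char0 hJ iJ).1 => f Sf; apply/eqP; apply: contraT => Jf.
by case: nex; exists f.
Qed.

(** A relation known on slices with e1 = 1 holds at every point off [generic_cond], since the value
    there is that of such a slice up to a common factor; by density it is an identity in e2 = u^2
    and e3 = v. *)
Lemma ratio_regular d (F G : octic_form) (p : {mpoly k[2]}) :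
  invariant_form d F -> invariant_form d G ->
  (forall (a b c : k) v, a + b + c = 1 -> a * b + a * c + b * c = (X0 k).@[v] ^+ 2 ->
     a * b * c = (X1 k).@[v] -> F k (fun i => (slice a b c)`_i) =
     p.@[v] * G k (fun i => (slice a b c)`_i)) ->
  (forall a b c : k, a != b -> b != c -> c != a -> a + b + c = 1 ->
     15 + 4 * (a * b + a * c + b * c) != 0 -> G k (fun i => (slice a b c)`_i) != 0) ->
  exists I J, regular_on (locus Z2_cubed) I J /\ tofrac p = restr I / restr J.
Proof.
move=> FI GI eqFG G0; pose I := form_mpoly F k; pose J := form_mpoly G k.
pose fam := family_eval (generic_descent k).
have hI : I \is d.-homog := form_homog FI k; have iI : octic_invariant I := form_invariant FI (k := k).
have hJ : J \is d.-homog := form_homog GI k; have iJ : octic_invariant J := form_invariant GI (k := k).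
have ev v : (generic_cond k).@[v] != 0 ->
    (fam I).@[v] = p.@[v] * (fam J).@[v] /\ (fam J).@[v] != 0.
  move=> /(generic_point char0)[a [b [c [_ [ab bc ca] [E1 E2 E3] eqv n0]]]].
  have [t t0 ht] := octic_eval_equiv eqv.
  rewrite /fam !meval_generic_descent (ht d I) ?(ht d J) //.
  rewrite !(octic_eval_form FI idfun, octic_eval_form GI idfun).
  split; first by rewrite (eqFG _ _ _ _ E1 E2 E3) mulrCA.
  by rewrite mulf_neq0 ?expf_neq0 // G0 // E2.
have J0 : fam J != 0.
  apply: contraTneq (oner_neq0 {mpoly k[2]}) => J0; apply/negPn/eqP.
  apply: (mpoly2_eq_off (generic_cond_neq0 char0)) => v /ev[_].
  by rewrite J0 meval0 eqxx.
have IJ : fam I = p * fam J.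
  apply/eqP; rewrite -subr_eq0; apply/eqP.
  apply: (mpoly2_eq_off (generic_cond_neq0 char0)) => v /ev[e _].
  by rewrite mevalB mevalM e subrr.
have rJ : restr J != 0 by rewrite restrE tofrac_eq0.
have e : restr I = tofrac p * restr J.
  by rewrite !restrE -/(fam I) IJ (rmorphM (@FracField.tofrac _)).
exists I, J; split; last by rewrite e; exact: (esym (mulfK rJ _)).
by apply/regular_onP; split=> //; do 2?split=> //; exists d.
Qed.

Definition restr_field (z : ratfun2 k) : Prop :=
  exists I J, regular_on (locus Z2_cubed) I J /\ z = restr I / restr J.

Lemma restr_neq0 I : restr I != 0 -> I != 0.
Proof. by apply: contraNneq => ->; rewrite restr0. Qed.

Lemma restrM_neq0 I J : restr I != 0 -> restr J != 0 -> restr (I * J) != 0.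
Proof. by move=> I0 J0; rewrite restrM; exact: (mulf_neq0 I0 J0). Qed.

Lemma fractionB (K : fieldType) (a b c d : K) : b != 0 -> d != 0 ->
  a / b - c / d = (a * d - c * b) / (b * d).
Proof. by move=> b0 d0; field; rewrite b0 d0. Qed.

Lemma fractionD (K : fieldType) (a b c d : K) : b != 0 -> d != 0 ->
  a / b + c / d = (a * d + c * b) / (b * d).
Proof. by move=> b0 d0; field; rewrite b0 d0. Qed.

Lemma restr_field_const (c : k) : restr_field (ratfun2C c).
Proof.
have r1 : restr 1%:MP = 1 by rewrite restrC; exact: (rmorph1 ratC).
exists c%:MP, 1%:MP; rewrite r1 restrC divr1; split=> //.
by apply/regular_onP; split; [exact: absolute_invariantC | rewrite r1 oner_neq0].
Qed.

Lemma regular_div I J I' J' : regular_on (locus Z2_cubed) I J ->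
  regular_on (locus Z2_cubed) I' J' ->
  [/\ regular_on (locus Z2_cubed) (I * I') (J * J'),
      regular_on (locus Z2_cubed) (I * J' + I' * J) (J * J')
    & regular_on (locus Z2_cubed) (I * J' - I' * J) (J * J')].
Proof.
move=> /regular_onP[a1 n1] /regular_onP[a2 n2].
have n3 := restrM_neq0 n1 n2.
have aJ : absolute_invariant J J by have [_ [iJ [d [_ hJ]]]] := a1; do 2?split=> //; exists d.
have aJ' : absolute_invariant J' J' by have [_ [iJ [d [_ hJ]]]] := a2; do 2?split=> //; exists d.
have a3 := absolute_invariantM a1 aJ'; have a4 := absolute_invariantM a2 aJ.
rewrite [J' * J]mulrC in a4.
split; apply/regular_onP; split=> //; first exact: absolute_invariantM.
  exact: absolute_invariantD (restr_neq0 n3) a3 a4.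
exact: absolute_invariantD (restr_neq0 n3) a3 (absolute_invariantN a4).
Qed.

Lemma restr_field_subfield : is_subfield restr_field.
Proof.
split.
- by rewrite -(rmorph1 ratC); exact: restr_field_const.
- move=> _ _ [I [J [r1 ->]]] [I' [J' [r2 ->]]].
  have [_ _ r3] := regular_div r1 r2; exists (I * J' - I' * J), (J * J'); split=> //.
  have [_ n1] := (regular_onP _ _).1 r1; have [_ n2] := (regular_onP _ _).1 r2.
  by rewrite restrB !restrM; exact: (fractionB _ _ n1 n2).
move=> _ _ [I [J [r1 ->]]] [I' [J' [r2 ->]]].
have [a1 n1] := (regular_onP _ _).1 r1; have [a2 n2] := (regular_onP _ _).1 r2.
(* Division by zero is zero by convention, and that value is a constant of the field. *)
have [I0|I0] := eqVneq (restr I') 0.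
  by rewrite I0 mul0r invr0 mulr0 -(rmorph0 ratC); exact: restr_field_const.
exists (I * J'), (J * I'); split; last first.
  by rewrite !restrM [X in _ * X]invf_div; exact: mulf_div.
apply/regular_onP; split; last exact: restrM_neq0 n1 I0.
exact: absolute_invariantM a1 (absolute_invariantV a2).
Qed.

Lemma gram3_neq0 (a b c : k) : a != b -> b != c -> c != a -> a + b + c != 0 ->
  15 * (a + b + c) ^+ 2 + 4 * (a * b + a * c + b * c) != 0 ->
  gram3 (fun i => (slice a b c)`_i) != 0.
Proof.
move=> ab bc ca e10 n0; rewrite gram3E gramE mulf_neq0 //.
  by rewrite mulf_neq0 // (natS_neq0 char0 223).
rewrite mulf_neq0 ?(natS_neq0 char0 11) // expf_neq0 // !mulf_neq0 ?subr_eq0 //.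
- exact: (natS_neq0 char0 2).
- exact: (natS_neq0 char0 3124).
- exact: (natS_neq0 char0 4095).
- exact: (natS_neq0 char0 4095).
Qed.

Lemma restr_field_gens : restr_field (gen_u k ^+ 2) /\ restr_field (gen_v k).
Proof.
have g0 (a b c : k) : a != b -> b != c -> c != a -> a + b + c = 1 ->
    15 + 4 * (a * b + a * c + b * c) != 0 -> gram3 (fun i => (slice a b c)`_i) != 0.
  move=> ab bc ca E1 n0; apply: gram3_neq0 => //; rewrite E1 ?oner_neq0 //.
  by rewrite expr1n mulr1.
split.
- rewrite -rmorphXn; apply: (ratio_regular e2_num_form e2_den_form).
    move=> a b c v E1 E2 E3; have := e2_numE a b c; rewrite E1 E2 expr1n mulr1 => ->.
    by rewrite mulrC -[(_ ^+ 2).@[v]]/((meval v : {rmorphism _ -> _}) _) rmorphXn.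
  move=> a b c ab bc ca E1 n0; have gn := g0 a b c ab bc ca E1 n0.
  rewrite /e2_den -mulrzr !mulf_neq0 //; exact: (natS_neq0 char0 99).
apply: (ratio_regular e3_num_form e3_den_form).
  move=> a b c v E1 E2 E3; have := e3_numE a b c; rewrite E1 E3 expr1n mulr1 => ->.
  by rewrite mulrC.
move=> a b c ab bc ca E1 n0; have gn := g0 a b c ab bc ca E1 n0.
rewrite /e3_den -mulrzr !mulf_neq0 //; exact: (natS_neq0 char0 5999).
Qed.

End FunctionField.

Lemma descent_octic_subfield (K : fieldType) (E : K -> Prop) (e1 e2 e3 : K) : is_subfield E ->
  E e1 -> E e2 -> E e3 -> forall i, E (descent_octic e1 e2 e3)`_i.
Proof.
move=> sE H1 H2 H3 i; have [E0 E1 Ea Em Ei] := subfield_closure sE; have [_ Eb _] := sE.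
have En n : E n%:R by elim: n => [|n IH] //; rewrite -natr1; apply: (Ea).
have EX x n : E x -> E (x ^+ n).
  by move=> Ex; elim: n => [|n IH]; rewrite ?expr0 // exprS; apply: (Em).
have eN x : E x -> E (- x) by move=> Ex; exact: (Ei x Ex).1.
rewrite coef_Poly; do 9?[case: i => [|i] /=]; rewrite ?nth_nil //;
  repeat lazymatch goal with
  | |- E (?n%:R) => exact (En n)
  | |- E (_ ^+ _) => apply (EX)
  | |- E (_ + _) => apply (Ea)
  | |- E (- _) => apply (eN)
  | |- E (_ * _) => apply (Em)
  | |- _ => eassumption
  end.
Qed.

Section FunctionFieldIso.
Context (k : closedFieldType) (char0 : [pchar k] =i pred0).

(** Quotients of values stay in k(u^2, v) because the coefficients of the descended octic do;
    conversely [restr_field_gens] realizes both generators as such quotients. *)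
Lemma locus_function_field :
  function_field_iso (@locus k Z2_cubed) (@ratfun2C k) (@k_s2_s3 k).
Proof.
exists (fun I J => restr I / restr J); split.
  move=> I J I' J' r1 r2.
  have [a1 n1] := (regular_onP char0 _ _).1 r1; have [a2 n2] := (regular_onP char0 _ _).1 r2.
  have [r3 r4 r5] := regular_div char0 r1 r2.
  split.
  - by have [_ [f [Sf Jf]]] := r3; exists f.
  - have [[iN [_ [d [hN _]]]] _] := r5.
    have van := vanish_on_locus char0 hN iN.
    rewrite -/(restr _) restrB !restrM in van.
    split=> [e f Sf|e].
      apply/eqP; rewrite -subr_eq0 -octic_evalN -octic_evalD; apply/eqP.
      apply: van.2 Sf; apply/eqP; rewrite subr_eq0 -(eqr_div _ _ n1 n2).
      exact/eqP.
    apply/eqP; rewrite (eqr_div _ _ n1 n2) -subr_eq0; apply/eqP/van.1 => f Sf.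
    by rewrite octic_evalD octic_evalN (e f Sf) subrr.
  - by rewrite restrD !restrM; exact: fractionD.
  - by rewrite !restrM; exact: mulf_div.
split.
  move=> c J r; have [_ n] := (regular_onP char0 _ _).1 r.
  by rewrite -mul_mpolyC restrM restrC; exact: (mulfK n).
have [sE Ec E2 E3] := k_s2_s3_gens char0; have [_ _ Ed] := sE.
have [_ E1 _ _ _] := subfield_closure sE.
have sR := restr_field_subfield char0.
have [_ _ Ra Rm _] := subfield_closure sR.
have [R2 R3] := restr_field_gens char0.
have RC c : restr_field (ratfun2C c) := restr_field_const char0 c.
move=> z; split=> [Ez|[I [J [_ ->]]]]; last first.
  apply: (Ed); apply: octic_eval_subfield => //; exact: descent_octic_subfield.
apply: (Ez _ sR) => w [->|[->|[c ->]]] //.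
have R2' : restr_field (2 : ratfun2 k).
  by rewrite -(rmorph_nat (ratC k)); exact: RC.
by apply: (Rm); apply: (Ra).
Qed.

End FunctionFieldIso.

(** * The field of moduli *)

Section FieldOfModuli.
Context (k : closedFieldType) (char0 : [pchar k] =i pred0).

(** Absolute invariants are computed on an equivalent slice and transferred to [f]; an
    [invariant_form] supplies the integrality that [field_of_moduli] requires. *)
Lemma moduli_ratio d (F G : octic_form) (f : {poly k}) (a b c z : k) :
  invariant_form d F -> invariant_form d G -> octic_equiv f (slice a b c) ->
  G k (fun i => (slice a b c)`_i) != 0 ->
  F k (fun i => (slice a b c)`_i) = G k (fun i => (slice a b c)`_i) * z -> field_of_moduli f z.
Proof.
move=> FI GI eqv G0 Fz E sE sub; apply: sub.
pose I := form_mpoly F k; pose J := form_mpoly G k.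
have hI : I \is d.-homog := form_homog FI k; have iI : octic_invariant I := form_invariant FI (k := k).
have hJ : J \is d.-homog := form_homog GI k; have iJ : octic_invariant J := form_invariant GI (k := k).
have evJ : octic_eval idfun J (slice a b c) = G k (fun i => (slice a b c)`_i).
  exact: (octic_eval_form GI idfun).
exists I, J; split.
- by do 2?split=> //; exists d.
- by split; [exact: form_over_Z FI k | exact: form_over_Z GI k].
- by rewrite -(octic_eval_equiv_neq0 eqv hJ iJ) evJ.
rewrite -(absolute_value_equiv eqv hI hJ iI iJ) evJ [octic_eval _ _ _](octic_eval_form FI idfun).
by rewrite Fz mulrC mulKf.
Qed.

Lemma slice_descends (f : {poly k}) (a b c : k) : octic_equiv f (slice a b c) ->
  good_octic (slice a b c) -> a != b -> b != c -> c != a ->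
  exists x y z, [/\ field_of_moduli f x, field_of_moduli f y, field_of_moduli f z
    & octic_equiv (slice a b c) (descent_octic x y z)].
Proof.
move=> eqv gs ab bc ca; have [a0 b0 c0 D0] := (slice_goodP char0 a b c).1 gs.
have sM : is_subfield (field_of_moduli f) := subfield_gen_is_subfield _.
have [M0 M1 Ma Mm Mi] := subfield_closure sM; have [_ Mb Md] := sM.
have Mn n : field_of_moduli f n%:R by elim: n => [|n IH] //; rewrite -natr1; apply: (Ma).
set e1 := a + b + c; set e2 := a * b + a * c + b * c; set e3 := a * b * c.
have e30 : e3 != 0 by rewrite !mulf_neq0.
have scaled t : t != 0 ->
    octic_equiv (slice a b c) (descent_octic (t * e1) (t ^+ 2 * e2) (t ^+ 3 * e3)).
  move=> t0; apply: (octic_equiv_trans (size_slice _ _ _) (slice_descent char0 a0 b0 c0 ab bc ca)).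
  exact: descent_octic_scale.
have tr2 := tr_inv2_slice a b c; have tr3 := tr_inv3_slice a b c.
have tr4 := tr_inv4_slice a b c; rewrite -/e1 -/e2 -/e3 in tr2 tr3 tr4.
(* For e1 = 0 the traces reduce to multiples of e2 and e3, and the integers -72 and 343 normalize
   the quotient of cube by square to e2^3 / e3^2. Scaling by e2 / e3 turns both remaining parameters
   into this value. *)
have [e10|e10] := eqVneq e1 0.
  have e20 : e2 != 0.
    apply: contraNneq D0 => e20; have -> : slice_disc a b c = e1 ^+ 2 - 4 * e2.
      by rewrite /slice_disc /e1 /e2; ring.
    by rewrite e10 e20 mulr0 subr0 expr0n.
  have Mz : field_of_moduli f (e2 ^+ 3 / e3 ^+ 2).
    have F2 := tr_inv_form 2; have F3 := tr_inv_form 3.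
    apply: (moduli_ratio (invariant_formZ (-72) (invariant_formM F2 (invariant_formM F2 F2)))
      (invariant_formZ 343 (invariant_formM F3 F3)) eqv); cbv beta; rewrite ?tr2 tr3 e10.
      have -> : (512 * (52 * 1000 * 0 * e2 + 800 * 0 * e2 - 7440 * 0 ^+ 3 - 192 * 1000 * e3)
        * (512 * (52 * 1000 * 0 * e2 + 800 * 0 * e2 - 7440 * 0 ^+ 3 - 192 * 1000 * e3))) *~ 343
        = 343 * (512 * 192 * 1000 * e3) ^+ 2 by ring.
      rewrite mulf_neq0 ?expf_neq0 ?mulf_neq0 //; try exact: (natS_neq0 char0).
    by field.
  exists 0, (e2 ^+ 3 / e3 ^+ 2), (e2 ^+ 3 / e3 ^+ 2); split=> //.
  have := scaled (e2 / e3) (mulf_neq0 e20 (invr_neq0 e30)); rewrite e10 mulr0.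
  have -> : (e2 / e3) ^+ 2 * e2 = e2 ^+ 3 / e3 ^+ 2 by field.
  by have -> : (e2 / e3) ^+ 3 * e3 = e2 ^+ 3 / e3 ^+ 2 by field.
suff [My Mz] : field_of_moduli f (e2 / e1 ^+ 2) /\ field_of_moduli f (e3 / e1 ^+ 3).
  exists 1, (e2 / e1 ^+ 2), (e3 / e1 ^+ 3); split=> //.
  have := scaled e1^-1 (invr_neq0 e10).
  by rewrite mulVf // !exprVn ![_^-1 * _]mulrC.
have [n0|n0] := eqVneq (15 * e1 ^+ 2 + 4 * e2) 0; last first.
  have gn := gram3_neq0 char0 ab bc ca e10 n0.
  split.
    apply: (moduli_ratio e2_num_form e2_den_form eqv).
      by rewrite /e2_den -mulrzr !mulf_neq0 //; exact: (natS_neq0 char0 99).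
    apply: (mulIf (expf_neq0 2 e10)); rewrite e2_numE -/e2.
    by rewrite -mulrA divfK ?expf_neq0.
  apply: (moduli_ratio e3_num_form e3_den_form eqv).
    by rewrite /e3_den -mulrzr !mulf_neq0 //; exact: (natS_neq0 char0 5999).
  apply: (mulIf (expf_neq0 3 e10)); rewrite e3_numE -/e3.
  by rewrite -mulrA divfK ?expf_neq0.
have four0 : (4 : k) != 0 := natS_neq0 char0 3.
have e2E : e2 = - (15 / 4) * e1 ^+ 2.
  apply: (@eq_of_multiple _ (4^-1) _ _ _ _ n0); field.
  exact: four0.
split.
  have -> : e2 / e1 ^+ 2 = 0 - 15 / 4 by rewrite e2E; field; rewrite four0 e10.
  by apply: (Mb) => //; apply: (Md); exact: Mn.
(* The trace of A^4 is linear in e3 and has the degree of the squared trace of A^2, whereas the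
   square of [tr_inv 3] is quadratic in e3. The combination 10290 tr(A^4) - 3001 tr(A^2)^2 cancels
   the e1^4 term when 4 e2 = -15 e1^2. *)
have F2 := tr_inv_form 2; have F4 := tr_inv_form 4.
apply: (moduli_ratio (invariant_formZ 3 (invariant_formD
    (invariant_formZ 10 (invariant_formZ 1029 F4)) (invariant_formZ (-3001) (invariant_formM F2 F2))))
  (invariant_formZ 400 (invariant_formM F2 F2)) eqv); cbv beta; rewrite tr2 ?tr4 e2E.
  have -> : (64 * (2520 * e1 ^+ 2 - 5600 * (- (15 / 4) * e1 ^+ 2))) *
    (64 * (2520 * e1 ^+ 2 - 5600 * (- (15 / 4) * e1 ^+ 2))) *~ 400
    = 400 * (64 * 48 * 490 * e1 ^+ 2) ^+ 2.
    by field.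
  rewrite mulf_neq0 ?expf_neq0 ?mulf_neq0 ?expf_neq0 //; exact: (natS_neq0 char0).
by field; rewrite four0 e10.
Qed.

Lemma moduli_field_of_definition (L : fieldType) (iota : {rmorphism k -> L}) (f : {poly k}) :
  genus3_equation iota f -> Aut_isomorphic iota Z2_cubed ->
  field_of_definition iota (field_of_moduli f).
Proof.
move=> gf aut; have [a [b [c [g1 ab bc ca]]]] := full_group_slice char0 gf aut.
have eqv := genus3_equation_unique char0 gf g1.
have [x [y [z [Mx My Mz e]]]] := slice_descends eqv (genus3_good g1) ab bc ca.
exists (descent_octic x y z); split; last exact: octic_equiv_genus3 e g1.
exact: descent_octic_subfield (subfield_gen_is_subfield _) Mx My Mz.
Qed.

End FieldOfModuli.

Theorem lemma6 (k : closedFieldType) (char0 : [pchar k] =i pred0) :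
  [/\ (forall (L : fieldType) (iota : {rmorphism k -> L}),
         genus3_hyperelliptic iota -> Aut_isomorphic iota Z2_cubed ->
         exists u v s2 s3 : k,
           [/\ genus3_equation iota (normal_form u v),
               s2 = dihedral_s2 u (v + 2) u,
               s3 = dihedral_s3 u (v + 2) u,
               [/\ s2 != 0, s2 != 4, s3 != 0 & s3 != 4]
             & genus3_equation iota (dihedral_equation s2 s3)]),
      (forall I J : {mpoly k[9]}, regular_on (@locus k Z2_cubed) I J ->
         let F := normal_form (gen_u k) (gen_v k) in
         octic_eval (@ratfun2C k) J F != 0 /\
         k_s2_s3 (octic_eval (@ratfun2C k) I F / octic_eval (@ratfun2C k) J F)),
      function_field_iso (@locus k Z2_cubed) (@ratfun2C k) (@k_s2_s3 k)
    & (forall (L : fieldType) (iota : {rmorphism k -> L}),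
         genus3_hyperelliptic iota -> Aut_isomorphic iota Z2_cubed ->
         forall f : {poly k}, genus3_equation iota f ->
         field_of_definition iota (field_of_moduli f))].
Proof.
split.
- by move=> L iota; exact: dihedral_form.
- by move=> I J; exact: regular_normal_form.
- exact: locus_function_field.
by move=> L iota _ aut f gf; exact: moduli_field_of_definition.
Qed.
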